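(* Let $\lambda\in S^1$ be Brjuno, let $l\in\mathbb{N}$ with $l\ge 4$, $\theta_0\in(0,\pi/2)$, $\beta_0\in(0,1/2)$ with $\beta_0(l+1)\ge 4$. Let $\check F$ be an automorphism of $\mathbb{C}^2$ such that, near the origin, $$\check F(z,w)=F_{\mathrm N}(z,w)+O(\|(z,w)\|^l),\qquad F_{\mathrm N}(z,w)=(\lambda z,\overline{\lambda}w)\cdot\Bigl(1-\frac{zw}{2}\Bigr),$$ and let $\check\Omega$ be the non-recurrent invariant Fatou component of $\check F$ attracted to $(0,0)$ described in the context. Then there exists a biholomorphic map $\check\Psi:\check\Omega\to\mathbb{C}\times\mathbb{C}^*$ conjugating $\check F$ to $(z,w)\mapsto(z+1,w)$, i.e. $\check\Psi\circ\check F=T\circ\check\Psi$ on $\check\Omega$ with $T(z,w)=(z+1,w)$.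
   Context: $\lambda\in S^1=\{|\lambda|=1\}$ is Brjuno if $-\sum_{\nu=1}^\infty 2^{-\nu}\log\omega(2^\nu)<\infty$, where $\omega(m):=\min\{|\lambda^k-\lambda|\mid 2\le k\le m\}$ for $m\ge2$. For $r>0$, $\theta\in(0,\pi/2)$, $\beta\in(0,1/2)$ let $W(\beta):=\{(z,w)\in\mathbb{C}^2\mid |z|<|zw|^\beta,\ |w|<|zw|^\beta\}$, $S(r,\theta):=\{u\in\mathbb{C}\mid|\arg u|<\theta,\ |u-r|<r\}$, and $\check B(r,\theta,\beta):=\{(z,w)\in W(\beta)\mid zw\in S(r,\theta)\}$. It is a known theorem (Bracci, Raissy, Stensønes) that every automorphism $\check F$ of the form in the claim has a non-recurrent invariant Fatou component $\check\Omega$, biholomorphic to $\mathbb{C}\times\mathbb{C}^*$, all of whose orbits converge to $(0,0)$, and that there is $r_0>0$ such that for $\check B:=\check B(r_0,\theta_0,\beta_0)$ one has $\check F(\check B)\subseteq\check B$, $\check F^n\to(0,0)$ uniformly on $\check B$, and $\check\Omega=\bigcup_{n\in\mathbb{N}}\check F^{-n}(\check B)$. This is the component $\check\Omega$ in the claim. Fatou components are the connected components of the set of points having a neighbourhood on which $\{\check F^n\}_{n\in\mathbb N}$ is normal; such a component $V$ is invariant if $\check F(V)=V$ and non-recurrent if it contains no accumulation point of an orbit starting in $V$. $\mathbb{C}^*=\mathbb{C}\setminus\{0\}$. *)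

(* Defs.v *)
From HB Require Import structures.
From mathcomp Require Import all_boot all_order all_algebra complex.
From mathcomp Require Import all_classical all_reals all_analysis.

Set Implicit Arguments.
Unset Strict Implicit.
Unset Printing Implicit Defensive.

Import Order.TTheory GRing.Theory Num.Theory.
Import numFieldNormedType.Exports.

Local Open Scope classical_set_scope.
Local Open Scope ring_scope.

(* Going through numClosedFieldType gives R[i] the topology and normed-module
   structures of numFieldNormedType, so that [differentiable] between
   normedModType's over [C R] is differentiability over the complex numbers. *)
Definition C (R : realType) : numClosedFieldType := R[i].

(* The product norm is the maximum norm, equivalent to the Euclidean one. *)
Notation C2 R := (C R * C R)%type.

(* [`|z|] lives in [C R]; [cabs z] is the same modulus as an element of [R]. *)
Definition cabs (R : realType) (z : C R) : R := complex.Re `|z|.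

(* Principal argument, in ]-pi, pi] for z != 0. *)
Definition carg (R : realType) (z : C R) : R :=
  if 0 <= complex.Im z then acos (complex.Re z / cabs z)
  else - acos (complex.Re z / cabs z).

Definition brjuno_omega (R : realType) (la : C R) (m : nat) : R :=
  \big[Num.min/cabs (la ^+ 2 - la)]_(2 <= k < m.+1) cabs (la ^+ k - la).

(* [lne 0 = -oo], so roots of unity are not Brjuno. *)
Definition brjuno (R : realType) (la : C R) : Prop :=
  (- (\sum_(1 <= nu <oo)
        ((2 ^- nu)%:E * lne (brjuno_omega la (2 ^ nu)%N)%:E)) < +oo)%E.

Section Holomorphy.
Variable R : realType.

Definition holomorphic_on (U : set (C2 R)) (f : C2 R -> C2 R) : Prop :=
  forall p, U p -> differentiable f p.

(* Meaningful for open [U] and [V]; the values of [f] off [U] are irrelevant. *)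
Definition biholomorphic_map (U V : set (C2 R)) (f : C2 R -> C2 R) : Prop :=
  [/\ set_bij U V f, holomorphic_on U f &
      exists2 g : C2 R -> C2 R, {in U, cancel f g} & holomorphic_on V g].

Definition automorphism (F : C2 R -> C2 R) : Prop :=
  biholomorphic_map setT setT F.

Definition C_x_Cstar : set (C2 R) := [set p | p.2 != 0].

Definition translation (p : C2 R) : C2 R := (p.1 + 1, p.2).

End Holomorphy.

Section Fatou.
Variable R : realType.

(* Every sequence of the family has a subsequence that, uniformly on compact
   subsets of [U], either converges to a finite limit or tends to infinity. *)
Definition normal_on (U : set (C2 R)) (family : set (C2 R -> C2 R)) : Prop :=
  forall s : nat -> C2 R -> C2 R, (forall n, family (s n)) ->
  exists2 phi : nat -> nat, {homo phi : m n / (m < n)%N} &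
    (exists g : C2 R -> C2 R, forall K, compact K -> K `<=` U ->
       {uniform K, (fun n => s (phi n)) @ \oo --> g}) \/
    (forall K, compact K -> K `<=` U -> forall m : nat,
       \forall n \near \oo, forall p, K p -> m%:R < `|s (phi n) p|).

Definition fatou_set (F : C2 R -> C2 R) : set (C2 R) :=
  [set p | exists2 U, open_nbhs p U & normal_on U (range (fun n => iter n F))].

Definition fatou_component (F : C2 R -> C2 R) (V : set (C2 R)) : Prop :=
  exists2 p, fatou_set F p & V = connected_component (fatou_set F) p.

Definition invariant (F : C2 R -> C2 R) (V : set (C2 R)) : Prop := F @` V = V.

Definition non_recurrent (F : C2 R -> C2 R) (V : set (C2 R)) : Prop :=
  forall p, V p -> V `&` cluster ((fun n => iter n F p) @ \oo) = set0.

End Fatou.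

Section LocalModel.
Variable R : realType.

Definition F_N (la : C R) (p : C2 R) : C2 R :=
  (la * p.1 * (1 - p.1 * p.2 / 2), la^* * p.2 * (1 - p.1 * p.2 / 2)).

Definition W_set (beta : R) : set (C2 R) :=
  [set p | cabs p.1 < cabs (p.1 * p.2) `^ beta /\
           cabs p.2 < cabs (p.1 * p.2) `^ beta].

Definition sector (r theta : R) : set (C R) :=
  [set u | `|carg u| < theta /\ cabs (u - real_complex R r) < r].

Definition B_check (r theta beta : R) : set (C2 R) :=
  [set p | W_set beta p /\ sector r theta (p.1 * p.2)].

(* The component provided by the theorem of Bracci, Raissy and Stensones. *)
Record attracted_component (F : C2 R -> C2 R) (theta beta : R)
    (Omega : set (C2 R)) : Prop := AttractedComponent {
  attracted_fatou : fatou_component F Omega;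
  attracted_invariant : invariant F Omega;
  attracted_non_recurrent : non_recurrent F Omega;
  attracted_biholomorphic :
    exists Phi, biholomorphic_map Omega (@C_x_Cstar R) Phi;
  attracted_cvg :
    forall p, Omega p -> (fun n => iter n F p) @ \oo --> (0 : C2 R);
  attracted_basin : exists2 r0 : R, 0 < r0 &
    [/\ F @` B_check r0 theta beta `<=` B_check r0 theta beta,
        {uniform B_check r0 theta beta,
           (fun n => iter n F) @ \oo --> (fun=> 0 : C2 R)} &
        Omega = \bigcup_n (iter n F @^-1` B_check r0 theta beta)]
}.

End LocalModel.

(* Main.v *)
Require Import Defs.
From HB Require Import structures.
From mathcomp Require Import all_boot all_order all_algebra complex.
From mathcomp Require Import all_classical all_reals all_analysis.
From mathcomp Require Import ring lra.
Import Order.TTheory GRing.Theory Num.Theory.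
Import numFieldNormedType.Exports.

(** The conjugacy is a limit of rescaled iterates of F.

    Write u = z w and U = 1 / u for a point (z, w) of the invariant region
    [B_check].  There |z| and |w| are smaller than |u|^beta, so the remainder of
    F contributes to z w at most a multiple of |u|^(beta (l + 1)), hence of |u|^4,
    and one step of F reads
      U' = U + 1 + 3 / (4 U) + O(U^-2),   w' = conj la w (1 - u / 2 + O(u^3))
    ([relative_form]).  Let a_n be the real sequence with
    a_(n+1) = a_n + 1 + 3 / (4 a_n) ([model_orbit]), and look at the n-th iterate
    in the coordinates
      x = U - a_n,   y = la^n sqrt(a_n) w        ([chart]).
    The time-dependent change of coordinates absorbs the whole main part of the
    dynamics: in one step x moves by O((1 + |x|) / n^2) and y by a relative amount
    of the same size ([chart_step]), and these displacements are summable.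

    - Along each orbit of Omega the coordinates therefore converge, and the limit
      of y is not 0 ([orbit_limit], [orbit_has_chart_limit]).  Call the limit
      (psi, sigma).  Shifting time by one gives psi o F = psi + 1 and
      sigma o F = sigma / la ([chart_limit_shift]).

    - Conversely fix (x, y) with y <> 0.  For late N the point with coordinates
      (x, y) at time N lies in [B_check], because |w| is of the size of |U|^(-1/2)
      and 1/2 lies strictly between beta and 1 - beta ([region_estimate]).
      Starting there at time N, the total displacement is O(1 / N), so that the
      limit map Th is holomorphic and as close to the identity as desired on a
      ball of fixed radius ([local_limit]).

    A holomorphic map close to the identity is injective with a holomorphic local
    inverse ([near_id_inj], [near_id_inverse]).  Since (psi, sigma) is Th in the
    coordinates of time N composed with the N-th iterate of F, which is an
    automorphism, (psi, sigma) is holomorphic and injective, takes every value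
    with nonzero second coordinate, and has a holomorphic inverse
    ([fatou_coordinates]).  With la = exp (i al), multiplying sigma by
    exp (i al psi) finally makes the second coordinate invariant.

    The function theory behind this is a single Cauchy estimate: a holomorphic
    function bounded by M on a disc of radius rho differs near the centre from its
    value there by at most 16 M / rho times the distance ([cauchy_lipschitz1]).  It
    implies that uniform limits of holomorphic maps are holomorphic
    ([differentiable_uniform_limit]).  The estimate rests on Goursat's theorem for
    rectangles: applied to the difference quotient of h it bounds h at the centre
    of a square by twice its maximum on the boundary ([square_bound]), and this
    bound, used for all functions z k(z)^n where k is the difference quotient at
    0, gives the bound on k as n grows. *)

Set Implicit Arguments.
Unset Strict Implicit.
Unset Printing Implicit Defensive.
Local Open Scope classical_set_scope.
Local Open Scope ring_scope.

(** * Complex numbers and their modulus *)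

Section ComplexModulus.
Variable R : realType.
Implicit Types (z w : C R) (x y : R).

(** The operations below are stated on [C R] itself, so that rewriting never has
    to convert between [C R] and the underlying type of pairs. *)
Definition rc x : C R := real_complex R x.
Definition mkc x y : C R := Complex x y.
Definition re z : R := complex.Re z.
Definition im z : R := complex.Im z.

Lemma rcD x y : rc (x + y) = rc x + rc y. Proof. exact: rmorphD. Qed.
Lemma rcB x y : rc (x - y) = rc x - rc y. Proof. exact: rmorphB. Qed.
Lemma rcM x y : rc (x * y) = rc x * rc y. Proof. exact: rmorphM. Qed.
Lemma rcV x : rc x^-1 = (rc x)^-1. Proof. exact: fmorphV. Qed.
Lemma rc0 : rc 0 = 0. Proof. exact: rmorph0. Qed.
Lemma rc1 : rc 1 = 1. Proof. exact: rmorph1. Qed.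
Lemma rc_nat n : rc n%:R = n%:R. Proof. exact: rmorph_nat. Qed.
Lemma rc_inj : injective rc. Proof. by move=> x y []. Qed.
Lemma rc_eq0 x : (rc x == 0) = (x == 0).
Proof. by rewrite -rc0; apply/eqP/eqP => [/rc_inj|->]. Qed.
Lemma rc_le x y : (rc x <= rc y) = (x <= y). Proof. exact: lecR. Qed.
Lemma rc_lt x y : (rc x < rc y) = (x < y). Proof. exact: ltcR. Qed.
Lemma reD z w : re (z + w) = re z + re w. Proof. by case: z; case: w. Qed.
Lemma imD z w : im (z + w) = im z + im w. Proof. by case: z; case: w. Qed.
Lemma reN z : re (- z) = - re z. Proof. by case: z. Qed.
Lemma imN z : im (- z) = - im z. Proof. by case: z. Qed.
Lemma reB z w : re (z - w) = re z - re w. Proof. by rewrite reD reN. Qed.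
Lemma imB z w : im (z - w) = im z - im w. Proof. by rewrite imD imN. Qed.
Lemma reM z w : re (z * w) = re z * re w - im z * im w.
Proof. by case: z; case: w. Qed.
Lemma imM z w : im (z * w) = re z * im w + im z * re w.
Proof. by case: z => a b; case: w => c d; rewrite /im /=; ring. Qed.
Lemma re_rc x : re (rc x) = x. Proof. by []. Qed.
Lemma im_rc x : im (rc x) = 0. Proof. by []. Qed.
Lemma mkc_reim z : mkc (re z) (im z) = z. Proof. by case: z. Qed.
Lemma c_ext z w : re z = re w -> im z = im w -> z = w.
Proof. by case: z => a b; case: w => c d /= -> ->. Qed.

Lemma normE z : `|z| = rc (cabs z).
Proof. by rewrite /cabs; have := normc_def z => ->. Qed.
Lemma cabsE z : cabs z = Num.sqrt (re z ^+ 2 + im z ^+ 2).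
Proof. by rewrite /cabs; have := normc_def z => ->. Qed.
Lemma cabs_ge0 z : 0 <= cabs z. Proof. by rewrite cabsE sqrtr_ge0. Qed.
Lemma cabs0 : cabs (0 : C R) = 0. Proof. by rewrite /cabs normr0. Qed.
Lemma cabs1 : cabs (1 : C R) = 1. Proof. by rewrite /cabs normr1. Qed.
Lemma cabsM z w : cabs (z * w) = cabs z * cabs w.
Proof. by apply: rc_inj; rewrite rcM -!normE normrM. Qed.
Lemma cabsN z : cabs (- z) = cabs z.
Proof. by rewrite /cabs normrN. Qed.
Lemma cabsC z w : cabs (z - w) = cabs (w - z).
Proof. by rewrite /cabs distrC. Qed.
Lemma cabsV z : cabs z^-1 = (cabs z)^-1.
Proof. by apply: rc_inj; rewrite rcV -!normE normfV. Qed.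
Lemma cabsX z n : cabs (z ^+ n) = cabs z ^+ n.
Proof. by elim: n => [|n IH]; rewrite ?expr0 ?cabs1// !exprS cabsM IH. Qed.
Lemma cabsD z w : cabs (z + w) <= cabs z + cabs w.
Proof. by rewrite -rc_le rcD -!normE ler_normD. Qed.
Lemma cabsB z w : cabs (z - w) <= cabs z + cabs w.
Proof. by rewrite -(cabsN w) cabsD. Qed.
Lemma cabs_le_dist z w : cabs z - cabs w <= cabs (z - w).
Proof. by have := cabsD (z - w) w; rewrite subrK; lra. Qed.
Lemma cabs_eq0 z : (cabs z == 0) = (z == 0).
Proof. by rewrite -rc_eq0 -normE normr_eq0. Qed.
Lemma cabs_gt0 z : (0 < cabs z) = (z != 0).
Proof. by rewrite lt_def cabs_ge0 cabs_eq0 andbT. Qed.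
Lemma cabs_rc x : cabs (rc x) = `|x|.
Proof. by rewrite cabsE re_rc im_rc expr0n addr0 sqrtr_sqr. Qed.
Lemma re_le_cabs z : `|re z| <= cabs z.
Proof.
rewrite cabsE -sqrtr_sqr ler_sqrt ?lerDl ?sqr_ge0//.
by rewrite addr_ge0 ?sqr_ge0.
Qed.
Lemma im_le_cabs z : `|im z| <= cabs z.
Proof.
rewrite cabsE -sqrtr_sqr ler_sqrt ?lerDr ?sqr_ge0//.
by rewrite addr_ge0 ?sqr_ge0.
Qed.
Lemma cabs_le_reim z : cabs z <= `|re z| + `|im z|.
Proof.
have zE : z = rc (re z) + mkc 0 1 * rc (im z).
  by apply: c_ext; rewrite ?reD ?imD ?reM ?imM ?re_rc ?im_rc /re /im /=; ring.
rewrite {1}zE; apply: le_trans (cabsD _ _) _; rewrite cabsM !cabs_rc.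
have -> : cabs (mkc 0 1) = 1 by rewrite cabsE /= expr0n expr1n add0r sqrtr1.
by rewrite mul1r.
Qed.

End ComplexModulus.

(** * Neighbourhoods and derivatives in terms of real radii *)

Section ComplexTopology.
Variable R : realType.
Implicit Types (z w : C R) (x y : R).

(** Positive elements of [C R] are real: this is what turns neighbourhoods of the
    complex topology into discs of real radius. *)
Lemma posC (e : C R) : 0 < e -> exists2 x : R, 0 < x & e = rc x.
Proof.
case: e => a b; have -> : ((0 : C R) < Complex a b) = (b == 0) && (0 < a).
  exact: ltcE.
by case/andP => /eqP -> a0; exists a.
Qed.

Lemma nbhsCP z (A : set (C R)) :
  nbhs z A <-> exists2 d : R, 0 < d & forall w, cabs (w - z) < d -> A w.
Proof.
split.
  move/nbhs_ballP => [e /posC [x x0 ->]] h; exists x => // w wz.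
  by apply: h; rewrite /ball/= normE rc_lt cabsC.
move=> [d d0 h]; apply/nbhs_ballP; exists (rc d); first by rewrite /= -(rc0 R) rc_lt.
by move=> w; rewrite /ball/= normE rc_lt cabsC; exact: h.
Qed.

Definition maxnorm (p : C2 R) : R := Num.max (cabs p.1) (cabs p.2).

Lemma maxnormE (p : C2 R) : `|p| = rc (maxnorm p).
Proof.
rewrite prod_normE /maxnorm !normE /Num.max /Order.max.
by rewrite rc_lt; case: ifP.
Qed.

Lemma maxnorm_ge0 (p : C2 R) : 0 <= maxnorm p.
Proof. by rewrite -rc_le rc0 -maxnormE normr_ge0. Qed.
Lemma maxnorm_0 : maxnorm 0 = 0.
Proof. by rewrite /maxnorm /= cabs0 maxxx. Qed.
Lemma maxnormD (p q : C2 R) : maxnorm (p + q) <= maxnorm p + maxnorm q.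
Proof. by rewrite -rc_le rcD -!maxnormE ler_normD. Qed.
Lemma maxnormN (p : C2 R) : maxnorm (- p) = maxnorm p.
Proof. by apply: rc_inj; rewrite -!maxnormE normrN. Qed.
Lemma maxnormC (p q : C2 R) : maxnorm (p - q) = maxnorm (q - p).
Proof. by rewrite -maxnormN opprB. Qed.
Lemma maxnorm_tri (p q r : C2 R) : maxnorm (p - r) <= maxnorm (p - q) + maxnorm (q - r).
Proof. by apply: le_trans (maxnormD _ _); rewrite addrA subrK. Qed.
Lemma maxnorm_eq0 (p : C2 R) : maxnorm p = 0 -> p = 0.
Proof.
by move=> h; apply/eqP; rewrite -normr_eq0 maxnormE h rc0.
Qed.
Lemma maxnormZ (t : C R) (p : C2 R) : maxnorm (t * p.1, t * p.2) = cabs t * maxnorm p.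
Proof. by rewrite /maxnorm /= !cabsM maxr_pMr ?cabs_ge0. Qed.
Lemma cabs_fst (p : C2 R) : cabs p.1 <= maxnorm p.
Proof. by rewrite /maxnorm le_max lexx. Qed.
Lemma cabs_snd (p : C2 R) : cabs p.2 <= maxnorm p.
Proof. by rewrite /maxnorm le_max lexx orbT. Qed.
Lemma maxnorm_le (p : C2 R) x : (maxnorm p <= x) = (cabs p.1 <= x) && (cabs p.2 <= x).
Proof. by rewrite /maxnorm ge_max. Qed.
Lemma maxnorm_lt (p : C2 R) x : (maxnorm p < x) = (cabs p.1 < x) && (cabs p.2 < x).
Proof. by rewrite /maxnorm gt_max. Qed.

Lemma nbhsC2P (p : C2 R) (A : set (C2 R)) :
  nbhs p A <-> exists2 d : R, 0 < d & forall q, maxnorm (q - p) < d -> A q.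
Proof.
split.
  move/nbhs_ballP => [e /posC [x x0 ->]] h; exists x => // w.
  by rewrite maxnorm_lt /= => /andP[h1 h2]; apply: h; split; rewrite /ball /= normE rc_lt cabsC.
move=> [d d0 h]; apply/nbhs_ballP; exists (rc d); first by rewrite /= -(rc0 R) rc_lt.
move=> w [h1 h2]; apply: h; rewrite maxnorm_lt /=.
by move: h1 h2; rewrite /ball /= !normE !rc_lt !(cabsC (w.1)) !(cabsC (w.2)) => -> ->.
Qed.

(** Complex derivatives with real epsilons; unlike [differentiable], the
    derivative is a number and all quantities compared are real. *)
Definition has_deriv (f : C R -> C R) z (d : C R) := forall e : R, 0 < e ->
  exists2 r : R, 0 < r & forall h, cabs h < r ->
  cabs (f (z + h) - f z - d * h) <= e * cabs h.

Lemma differentiable_deriv f z : differentiable f z -> exists d, has_deriv f z d.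
Proof.
move=> /diff_locallyP [_ /eqaddoP H].
exists ('d f z 1) => e e0.
have /H /nbhsCP [r r0 hr] : 0 < rc e by rewrite -(rc0 R) rc_lt.
exists r => // h hh; have := hr h; rewrite subr0 => /(_ hh).
rewrite !fctE /= !normE -rcM rc_le [h + z]addrC.
suff <- : 'd f z h = 'd f z 1 * h by rewrite opprD addrA.
have {1}-> : h = h *: (1 : C R) by rewrite /GRing.scale /= mulr1.
by rewrite linearZ /= mulrC.
Qed.

Definition has_deriv2 (f : C2 R -> C R) p (a b : C R) := forall e : R, 0 < e ->
  exists2 r : R, 0 < r & forall h, maxnorm h < r ->
  cabs (f (p + h) - f p - (a * h.1 + b * h.2)) <= e * maxnorm h.

Lemma differentiable_deriv2 f p : differentiable f p -> exists a b, has_deriv2 f p a b.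
Proof.
move=> /diff_locallyP [_ /eqaddoP H].
exists ('d f p (1, 0)), ('d f p (0, 1)) => e e0.
have /H /nbhsC2P [r r0 hr] : 0 < rc e by rewrite -(rc0 R) rc_lt.
exists r => // h hh; have := hr h; rewrite subr0 => /(_ hh).
rewrite !fctE /= maxnormE normE -rcM rc_le [h + p]addrC => H1.
suff -> : 'd f p (1, 0) * h.1 + 'd f p (0, 1) * h.2 = 'd f p h.
  by rewrite -addrA -opprD.
have {3}-> : h = h.1 *: (1, 0) + h.2 *: (0, 1).
  apply/eqP; rewrite -pair_eqE /pair_eq /=.
  by rewrite /GRing.scale /= !mulr1 !mulr0 addr0 add0r !eqxx.
by rewrite linearD !linearZ /= ![_ *: _]mulrC.
Qed.

Definition lin2 (a b : C R) (h : C2 R) : C R := a * h.1 + b * h.2.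

Lemma has_deriv2_differentiable f p a b : has_deriv2 f p a b -> differentiable f p.
Proof.
move=> H.
have linL : linear (lin2 a b).
  by move=> k x y; rewrite /lin2 /= /GRing.scale /=; ring.
pose L : {linear C2 R -> C R} := HB.pack (lin2 a b) (GRing.isLinear.Build _ _ _ _ (lin2 a b) linL).
have cL : continuous L.
  move=> q; rewrite /continuous_at.
  apply: (@cvgD _ _ _ _ _ (fun h : C2 R => a * h.1) (fun h : C2 R => b * h.2)).
    by apply: cvgMl_tmp; exact: cvg_fst.
  by apply: cvgMl_tmp; exact: cvg_snd.
have eqL : f \o shift p = cst (f p) + L +o_ (0 : C2 R) id.
  apply/eqaddoP => e /posC [x x0 ->].
  have [r r0 hr] := H _ x0.
  apply/nbhsC2P; exists r => // h; rewrite subr0 => /hr.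
  by rewrite !fctE /= maxnormE normE -rcM rc_le [h + p]addrC (opprD (f p)) addrA.
apply/diff_locallyP; have -> : 'd f p = L :> (C2 R -> C R) by apply: diff_unique.
by split.
Qed.
End ComplexTopology.

(** * Integrals over segments *)

Section SegmentIntegral.
Variable R : realType.
Implicit Types (f g : R -> R) (a b c k M : R).
Let mu := @lebesgue_measure R.

Definition seg_int f a b : R := (\int[mu]_(x in `[a, b]) f x)%R.

Lemma seg_int_integrable f a b : continuous f -> mu.-integrable `[a, b] (EFin \o f).
Proof.
move=> cf; apply: continuous_compact_integrable; first exact: segment_compact.
exact: continuous_subspaceT.
Qed.

Lemma seg_intxx f a : seg_int f a a = 0.
Proof. by rewrite /seg_int set_itv1 Rintegral_set1. Qed.

Lemma seg_int_cat f a b c : continuous f -> a <= b -> b <= c ->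
  seg_int f a c = seg_int f a b + seg_int f b c.
Proof.
move=> cf ab bc; rewrite /seg_int.
have h := @Rintegral_itvB R f (BLeft a) (BRight c) b (@seg_int_integrable f a c cf).
have := h; rewrite !bnd_simp => /(_ ab bc) h1.
have <- : \int[mu]_(x in `]b, c]) f x = \int[mu]_(x in `[b, c]) f x.
  apply: Rintegral_itv_obnd_cbnd.
  apply: integrableS (@seg_int_integrable f b c cf) => //.
  exact: subset_itv_oc_cc.
by rewrite -h1 addrC subrK.
Qed.

Lemma seg_intD f g a b : continuous f -> continuous g ->
  seg_int (fun x => f x + g x) a b = seg_int f a b + seg_int g a b.
Proof. by move=> cf ctsg; rewrite /seg_int RintegralD//; exact: seg_int_integrable. Qed.

Lemma seg_intZ k f a b : continuous f ->
  seg_int (fun x => k * f x) a b = k * seg_int f a b.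
Proof. by move=> cf; rewrite /seg_int RintegralZl//; exact: seg_int_integrable. Qed.

Lemma seg_int_cst k a b : a <= b -> seg_int (fun=> k) a b = k * (b - a).
Proof.
move=> ab; rewrite /seg_int Rintegral_cst//; congr (_ * _).
apply: etrans (congr1 fine (@lebesgue_measure_itv R `[a, b])) _ => /=.
by rewrite lte_fin; case: ltgtP ab => // ->; rewrite subrr.
Qed.

Lemma seg_int_le f g a b : continuous f -> continuous g ->
  (forall x, a <= x -> x <= b -> f x <= g x) -> seg_int f a b <= seg_int g a b.
Proof.
move=> cf ctsg h; apply: le_Rintegral => //; try exact: seg_int_integrable.
by move=> x /=; rewrite in_itv/= => /andP[]; exact: h.
Qed.

Lemma seg_int_bound f a b M : continuous f -> a <= b ->
  (forall x, a <= x -> x <= b -> `|f x| <= M) -> `|seg_int f a b| <= M * (b - a).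
Proof.
move=> cf ab h; rewrite ler_norml -mulNr -!seg_int_cst//; apply/andP; split;
  apply: seg_int_le => //; try by move=> ?; exact: cst_continuous.
  by move=> x ax xb; have := h x ax xb; rewrite ler_norml => /andP[].
by move=> x ax xb; have := h x ax xb; rewrite ler_norml => /andP[].
Qed.

Lemma seg_int_id a b : a <= b -> seg_int id a b = (b ^+ 2 - a ^+ 2) / 2.
Proof.
rewrite le_eqVlt => /orP[/eqP ->|ab]; first by rewrite seg_intxx subrr mul0r.
pose F := 2^-1 *: (@id R ^+ 2).
have dF (x : R) : is_derive x 1 F x.
  by apply: is_derive_eq; rewrite /GRing.scale /= expr1; field.
have cF : continuous F.
  move=> t; apply: differentiable_continuous; apply/derivable1_diffP.
  exact: (@ex_derive _ _ _ _ _ _ _ (dF t)).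
apply: etrans (congr1 fine (@continuous_FTC2 R id F a b ab _ _ _)) _.
- exact: continuous_subspaceT (fun x => @cvg_id _ _).
- split.
  + by move=> x _; apply: (@ex_derive _ _ _ _ _ _ _ (dF x)).
  + by apply: cvg_at_right_filter; exact: cF.
  + by apply: cvg_at_left_filter; exact: cF.
- by move=> x _; rewrite derive1E; apply: (@derive_val _ _ _ _ _ _ _ (dF x)).
- by rewrite /F /= !fctE /GRing.scale /= !expr2; field.
Qed.

End SegmentIntegral.

(** * Contour integrals around rectangles *)

Section RectangleIntegral.
Variable R : realType.
Implicit Types (g : R -> C R) (h : C R -> C R) (a b c d m M x y : R).

(** Curves in the complex plane have a real parameter, so that continuity across
    the two different base fields is spelled out. *)
Definition path_continuous g := forall x e, 0 < e -> exists2 r : R, 0 < r &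
  forall t, `|t - x| < r -> cabs (g t - g x) < e.
Definition eps_continuous h := forall z (e : R), 0 < e -> exists2 r : R, 0 < r &
  forall w, cabs (w - z) < r -> cabs (h w - h z) < e.

Lemma path_continuous_re g : path_continuous g -> continuous (fun x => re (g x)).
Proof.
move=> hg x; apply/cvgrPdist_lt => e e0; have [r r0 hr] := hg x e e0.
apply/nbhs_ballP; exists r => //= t; rewrite /ball /= => xt.
rewrite distrC -reB; apply: le_lt_trans (re_le_cabs _) _.
by apply: hr; rewrite distrC.
Qed.

Lemma path_continuous_im g : path_continuous g -> continuous (fun x => im (g x)).
Proof.
move=> hg x; apply/cvgrPdist_lt => e e0; have [r r0 hr] := hg x e e0.
apply/nbhs_ballP; exists r => //= t; rewrite /ball /= => xt.
rewrite distrC -imB; apply: le_lt_trans (im_le_cabs _) _.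
by apply: hr; rewrite distrC.
Qed.

Lemma eps_continuous_h h y : eps_continuous h -> path_continuous (fun x => h (mkc x y)).
Proof.
move=> ch x e e0; have [r r0 hr] := ch (mkc x y) e e0; exists r => // t tx.
apply: hr; have -> : mkc t y - mkc x y = rc (t - x).
  by apply: c_ext; rewrite ?reB ?imB /re /im /= ?subrr.
by rewrite cabs_rc.
Qed.

Lemma eps_continuous_v h x : eps_continuous h -> path_continuous (fun y => h (mkc x y)).
Proof.
move=> ch y e e0; have [r r0 hr] := ch (mkc x y) e e0; exists r => // t tx.
apply: hr; apply: le_lt_trans (cabs_le_reim _) _.
by rewrite reB imB /re /im /= subrr normr0 add0r.
Qed.

Definition cseg_int (g : R -> C R) (a b : R) : C R := mkc (seg_int (fun x => re (g x)) a b) (seg_int (fun x => im (g x)) a b).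

Lemma cseg_int_cat g a b c : path_continuous g -> a <= b -> b <= c -> cseg_int g a c = cseg_int g a b + cseg_int g b c.
Proof.
move=> hg ab bc; rewrite /cseg_int (seg_int_cat (path_continuous_re hg) ab bc) (seg_int_cat (path_continuous_im hg) ab bc).
by [].
Qed.

Lemma cseg_intD g1 g2 a b : path_continuous g1 -> path_continuous g2 ->
  cseg_int (fun x => g1 x + g2 x) a b = cseg_int g1 a b + cseg_int g2 a b.
Proof.
move=> h1 h2; rewrite /cseg_int.
rewrite [X in seg_int X](_ : _ = fun x => re (g1 x) + re (g2 x)); last by apply/funext => x; rewrite reD.
rewrite [X in mkc _ (seg_int X _ _)](_ : _ = fun x => im (g1 x) + im (g2 x)); last by apply/funext => x; rewrite imD.
rewrite seg_intD ?seg_intD//; by [exact: path_continuous_re|exact: path_continuous_im].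
Qed.

Lemma cseg_intZ (k : C R) g a b : path_continuous g -> cseg_int (fun x => k * g x) a b = k * cseg_int g a b.
Proof.
move=> hg; have cr := path_continuous_re hg; have ci := path_continuous_im hg.
have cZ (l : R) (f : R -> R) : continuous f -> continuous (fun x => l * f x).
  by move=> cf x; apply: cvgMl_tmp; exact: cf.
rewrite /cseg_int.
rewrite [X in seg_int X](_ : _ = fun x => re k * re (g x) + (- im k) * im (g x)); last first.
  by apply/funext => x; rewrite reM mulNr.
rewrite [X in mkc _ (seg_int X _ _)](_ : _ = fun x => re k * im (g x) + im k * re (g x)); last first.
  by apply/funext => x; rewrite imM.
rewrite !seg_intD ?seg_intZ//; try exact: cZ.
by apply: c_ext; rewrite ?reM ?imM /re /im /= ?mulNr.
Qed.

Lemma cseg_int_bound g a b M : path_continuous g -> a <= b ->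
  (forall x, a <= x -> x <= b -> cabs (g x) <= M) -> cabs (cseg_int g a b) <= 2 * M * (b - a).
Proof.
move=> hg ab h; apply: le_trans (cabs_le_reim _) _; rewrite /re /im /=.
have H1 : `|seg_int (fun x => re (g x)) a b| <= M * (b - a).
  apply: (seg_int_bound (path_continuous_re hg)) => // x ax xb.
  exact: le_trans (re_le_cabs _) (h x ax xb).
have H2 : `|seg_int (fun x => im (g x)) a b| <= M * (b - a).
  apply: (seg_int_bound (path_continuous_im hg)) => // x ax xb.
  exact: le_trans (im_le_cabs _) (h x ax xb).
by lra.
Qed.

Definition ci : C R := mkc 0 1.

(** The integral of h dz around the rectangle with sides x = a, x = b, y = c and
    y = d, counterclockwise. *)
Definition rect_int h a b c d : C R :=
  cseg_int (fun x => h (mkc x c)) a b - cseg_int (fun x => h (mkc x d)) a b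
  + ci * (cseg_int (fun y => h (mkc b y)) c d - cseg_int (fun y => h (mkc a y)) c d).

Lemma rect_int_vcut h a m b c d : eps_continuous h -> a <= m -> m <= b ->
  rect_int h a b c d = rect_int h a m c d + rect_int h m b c d.
Proof.
move=> ch am mb; rewrite /rect_int (cseg_int_cat (eps_continuous_h c ch) am mb) (cseg_int_cat (eps_continuous_h d ch) am mb); ring.
Qed.

Lemma rect_int_hcut h a b c m d : eps_continuous h -> c <= m -> m <= d ->
  rect_int h a b c d = rect_int h a b c m + rect_int h a b m d.
Proof.
move=> ch cm md; rewrite /rect_int (cseg_int_cat (eps_continuous_v b ch) cm md) (cseg_int_cat (eps_continuous_v a ch) cm md); ring.
Qed.

Lemma rect_intD h1 h2 a b c d : eps_continuous h1 -> eps_continuous h2 ->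
  rect_int (fun z => h1 z + h2 z) a b c d = rect_int h1 a b c d + rect_int h2 a b c d.
Proof.
move=> c1 c2; rewrite /rect_int !cseg_intD; [ring|..]; by [exact: eps_continuous_h|exact: eps_continuous_v].
Qed.

Lemma rect_intZ (k : C R) h a b c d : eps_continuous h -> rect_int (fun z => k * h z) a b c d = k * rect_int h a b c d.
Proof.
move=> ch; rewrite /rect_int !cseg_intZ; [ring|..]; by [exact: eps_continuous_h|exact: eps_continuous_v].
Qed.

Lemma cabs_ci : cabs ci = 1.
Proof. by rewrite cabsE /re /im /= expr0n expr1n add0r sqrtr1. Qed.

(** The factor is 4 rather than 2 because real and imaginary parts are bounded
    separately. *)
Lemma rect_int_bound h a b c d M : eps_continuous h -> a <= b -> c <= d ->
  (forall x y, a <= x -> x <= b -> c <= y -> y <= d -> cabs (h (mkc x y)) <= M) ->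
  cabs (rect_int h a b c d) <= 4 * M * ((b - a) + (d - c)).
Proof.
move=> ch ab cd hM.
have H1 := cseg_int_bound (M := M) (eps_continuous_h c ch) ab (fun x p q => hM x c p q (lexx _) cd).
have H2 := cseg_int_bound (M := M) (eps_continuous_h d ch) ab (fun x p q => hM x d p q cd (lexx _)).
have H3 := cseg_int_bound (M := M) (eps_continuous_v b ch) cd (fun y p q => hM b y ab (lexx _) p q).
have H4 := cseg_int_bound (M := M) (eps_continuous_v a ch) cd (fun y p q => hM a y (lexx _) ab p q).
rewrite /rect_int; apply: le_trans (cabsD _ _) _; rewrite cabsM cabs_ci mul1r.
by apply: le_trans (lerD (cabsB _ _) (cabsB _ _)) _; lra.
Qed.

Lemma eps_continuous_cst (k : C R) : eps_continuous (fun=> k).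
Proof. by move=> z e e0; exists 1 => // w _; rewrite subrr cabs0. Qed.
Lemma eps_continuous_id : eps_continuous (fun z => z).
Proof. by move=> z e e0; exists e. Qed.
Lemma eps_continuousD h1 h2 : eps_continuous h1 -> eps_continuous h2 -> eps_continuous (fun z => h1 z + h2 z).
Proof.
move=> c1 c2 x e e0; have e2 : 0 < e / 2 by lra.
have [r1 r10 h1'] := c1 x _ e2; have [r2 r20 h2'] := c2 x _ e2.
exists (Num.min r1 r2) => [|t]; rewrite lt_min ?r10 ?r20// => /andP[t1 t2].
have -> : h1 t + h2 t - (h1 x + h2 x) = (h1 t - h1 x) + (h2 t - h2 x) by ring.
have := cabsD (h1 t - h1 x) (h2 t - h2 x); have := h1' t t1; have := h2' t t2; lra.
Qed.
Lemma eps_continuousZ (k : C R) h : eps_continuous h -> eps_continuous (fun z => k * h z).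
Proof.
move=> ch x e e0; have k0 := cabs_ge0 k.
have [r r0 hr] := ch x (e / (cabs k + 1)) (divr_gt0 e0 (ltr_wpDl k0 ltr01)).
exists r => // t /hr; rewrite -mulrBr cabsM ltr_pdivlMr; last by lra.
by have := cabs_ge0 (h t - h x); nra.
Qed.

Lemma rect_int_affine (k l : C R) a b c d : a <= b -> c <= d ->
  rect_int (fun z => k + l * z) a b c d = 0.
Proof.
move=> ab cd.
have -> : rect_int (fun z => k + l * z) a b c d
   = rect_int (fun=> k) a b c d + l * rect_int (fun z => z) a b c d.
  rewrite -rect_intZ; last exact: eps_continuous_id.
  by rewrite -rect_intD//; [exact: eps_continuous_cst|exact/eps_continuousZ/eps_continuous_id].
rewrite {1}/rect_int !subrr mulr0 !add0r.
suff -> : rect_int (fun z => z) a b c d = 0 by rewrite mulr0.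
rewrite /rect_int /cseg_int /re /im /= !seg_int_cst// !(seg_int_id ab) !(seg_int_id cd).
by apply: c_ext; rewrite ?reD ?imD ?reN ?imN ?reM ?imM ?reB ?imB /re /im /=; ring.
Qed.

End RectangleIntegral.

(** * The theorem of Goursat *)

Section Goursat.
Variable R : realType.
Implicit Types (h : C R -> C R) (a b c d m M x y s t : R).

(** Bisected intervals share a point, namely the supremum of the left endpoints. *)
Lemma nested_point (u : nat -> R) s : 0 <= s ->
  (forall k, u k <= u k.+1) ->
  (forall k, u k.+1 + s / 2 ^+ k.+1 <= u k + s / 2 ^+ k) ->
  exists X, forall k, u k <= X /\ X <= u k + s / 2 ^+ k.
Proof.
move=> s0 hu hv.
have su i k : u i <= u (i + k)%N.
  by elim: k => [|k IH]; rewrite ?addn0// addnS; exact: le_trans IH (hu _).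
have sv i k : u (i + k)%N + s / 2 ^+ (i + k) <= u i + s / 2 ^+ i.
  by elim: k => [|k IH]; rewrite ?addn0// addnS; exact: le_trans (hv _) IH.
have pos k : 0 <= s / 2 ^+ k by rewrite divr_ge0// exprn_ge0.
have ub i j : u j <= u i + s / 2 ^+ i.
  case: (leqP i j) => ij.
    by have := sv i (j - i)%N; rewrite subnKC//; have := pos j; lra.
  by have := su j (i - j)%N; rewrite subnKC ?(ltnW ij)//; have := pos i; lra.
have hs : has_sup (range u).
  by split; [exists (u 0%N), 0%N|exists (u 0%N + s / 2 ^+ 0) => _ [j _ <-]; exact: ub].
exists (sup (range u)) => k; split; first by apply: ub_le_sup; [exact: hs.2|exists k].
by apply: ge_sup; [exact: hs.1|move=> _ [j _ <-]; exact: ub].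
Qed.

Lemma halves_small s (r : R) : 0 <= s -> 0 < r -> exists k : nat, s / 2 ^+ k < r.
Proof.
move=> s0 r0; have [k hk] : exists k : nat, s / r < 2 ^+ k.
  exists (Num.bound (s / r)); apply: lt_trans (archi_boundP _) _.
    by rewrite divr_ge0// ltW.
  by rewrite -natrX ltr_nat; exact: ltn_expl.
by exists k; rewrite ltr_pdivrMr ?exprn_gt0// mulrC -ltr_pdivrMr.
Qed.

(** A property that passes from the four quarters of a rectangle to the rectangle
    and holds for all small rectangles around each point holds for the whole: else
    some quarter fails, then some quarter of that one, and so on, and the
    rectangles so obtained shrink to a point where the local hypothesis fails.
    Here (x, y) is the lower left corner and s', t' are the side lengths. *)
Lemma bisection_rect (P : R -> R -> R -> R -> Prop) x0 y0 s t : 0 <= s -> 0 <= t ->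
  (forall x y s' t', 0 <= s' -> 0 <= t' ->
     (forall i j : bool, P (x + i%:R * (s' / 2)) (y + j%:R * (t' / 2)) (s' / 2) (t' / 2)) ->
     P x y s' t') ->
  (forall X Y, x0 <= X -> X <= x0 + s -> y0 <= Y -> Y <= y0 + t ->
     exists2 r, 0 < r & forall x y s' t', 0 <= s' -> 0 <= t' -> s' < r -> t' < r ->
       x0 <= x -> x + s' <= x0 + s -> y0 <= y -> y + t' <= y0 + t ->
       x <= X -> X <= x + s' -> y <= Y -> Y <= y + t' -> P x y s' t') ->
  P x0 y0 s t.
Proof.
move=> s0 t0 hjoin hloc; apply: contrapT => nP.
pose bad k (p : R * R) := ~ P p.1 p.2 (s / 2 ^+ k) (t / 2 ^+ k).
have pos k (u : R) : 0 <= u -> 0 <= u / 2 ^+ k.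
  by move=> u0; rewrite divr_ge0// exprn_ge0.
have half k u : u / 2 ^+ k / 2 = u / 2 ^+ k.+1 :> R.
  by rewrite exprS; field; rewrite expf_neq0// pnatr_eq0.
have step (kp : nat * (R * R)) : exists q : R * R, bad kp.1 kp.2 ->
   bad kp.1.+1 q /\ exists i j : bool,
    q = (kp.2.1 + i%:R * (s / 2 ^+ kp.1.+1), kp.2.2 + j%:R * (t / 2 ^+ kp.1.+1)).
  case: kp => k p /=; have [hb|] := pselect (bad k p); last by exists p.
  suff : exists ij : bool * bool, bad k.+1 (p.1 + ij.1%:R * (s / 2 ^+ k.+1), p.2 + ij.2%:R * (t / 2 ^+ k.+1)).
    move=> [[i j] /= h].
    by exists (p.1 + i%:R * (s / 2 ^+ k.+1), p.2 + j%:R * (t / 2 ^+ k.+1)) => _; split=> //; exists i, j.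
  apply: contrapT => /forallNP h; apply: hb; apply: hjoin; rewrite ?pos// => i j.
  by have /contrapT := h (i, j); rewrite !half.
have [nx hnx] := choice step.
pose q := fix q k := if k is k'.+1 then nx (k', q k') else (x0, y0).
have qbad k : bad k (q k).
  elim: k => [|k IH]; first by rewrite /bad /= !expr0 !divr1.
  by have [] := hnx (k, q k) IH.
have qs k : exists i j : bool,
    q k.+1 = ((q k).1 + i%:R * (s / 2 ^+ k.+1), (q k).2 + j%:R * (t / 2 ^+ k.+1)).
  by have [_] := hnx (k, q k) (qbad k).
have bnd (i : bool) (u : R) : 0 <= u -> 0 <= i%:R * u <= u.
  by case: i => u0; rewrite ?mul1r ?mul0r ?lexx ?u0.
have dbl k u : u / 2 ^+ k = u / 2 ^+ k.+1 * 2 :> R by rewrite -half divfK// pnatr_eq0.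
have mono1 k : (q k).1 <= (q k.+1).1 /\ (q k.+1).1 + s / 2 ^+ k.+1 <= (q k).1 + s / 2 ^+ k.
  have [i [j ->]] /= := qs k; have /andP[] := bnd i _ (pos k.+1 s s0).
  by rewrite (dbl k); lra.
have mono2 k : (q k).2 <= (q k.+1).2 /\ (q k.+1).2 + t / 2 ^+ k.+1 <= (q k).2 + t / 2 ^+ k.
  have [i [j ->]] /= := qs k; have /andP[] := bnd j _ (pos k.+1 t t0).
  by rewrite (dbl k); lra.
have [X hX] := @nested_point (fun k => (q k).1) s s0 (fun k => (mono1 k).1) (fun k => (mono1 k).2).
have [Y hY] := @nested_point (fun k => (q k).2) t t0 (fun k => (mono2 k).1) (fun k => (mono2 k).2).
have := hX 0%N; have := hY 0%N; rewrite /= expr0 !divr1 => -[Y1 Y2] [X1 X2].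
have [r r0 hr] := hloc X Y X1 X2 Y1 Y2.
have [k1 hk1] := halves_small (addr_ge0 s0 t0) r0.
have inside1 k : x0 <= (q k).1 /\ (q k).1 + s / 2 ^+ k <= x0 + s.
  elim: k => [|k [IH1 IH2]]; first by rewrite /= expr0 divr1.
  by have := mono1 k; lra.
have inside2 k : y0 <= (q k).2 /\ (q k).2 + t / 2 ^+ k <= y0 + t.
  elim: k => [|k [IH1 IH2]]; first by rewrite /= expr0 divr1.
  by have := mono2 k; lra.
have := hk1; rewrite mulrDl => hk; have ps := pos k1 s s0; have pt := pos k1 t t0.
have [? ?] := inside1 k1; have [? ?] := inside2 k1.
have [? ?] := hX k1; have [? ?] := hY k1.
by apply: (qbad k1); apply: hr; lra.
Qed.

(** At a point of differentiability the integral of the affine part vanishes and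
    the remainder is at most e times the diameter, on a contour whose length is
    comparable to the diameter. *)
Lemma rect_int_small h x y : eps_continuous h -> (exists l, has_deriv h (mkc x y) l) ->
  forall e : R, 0 < e -> exists2 r : R, 0 < r &
  forall a b c d, a <= x -> x <= b -> c <= y -> y <= d -> b - a < r -> d - c < r ->
    cabs (rect_int h a b c d) <= e * ((b - a) + (d - c)) ^+ 2.
Proof.
move=> ch [l hl] e e0; have e4 : 0 < e / 4 by lra.
have [r r0 hr] := hl _ e4; exists (r / 2) => [|a b c d ax xb cy yd bar dcr]; first by lra.
have ab : a <= b by lra. have cd : c <= d by lra.
pose z0 := mkc x y.
pose g z := h z + ((- h z0 + l * z0) + (- l) * z).
have ca k k' : eps_continuous (fun z : C R => k + k' * z).
  by apply: eps_continuousD; [exact: eps_continuous_cst|exact/eps_continuousZ/eps_continuous_id].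
have <- : rect_int g a b c d = rect_int h a b c d.
  by rewrite rect_intD//; rewrite (rect_int_affine _ _ ab cd) addr0.
set S := (b - a) + (d - c).
have S0 : 0 <= S by rewrite /S; lra.
have -> : e * S ^+ 2 = 4 * (e / 4 * S) * S by field.
apply: rect_int_bound => //; first by apply: eps_continuousD.
move=> x' y' h1 h2 h3 h4.
have le1 : cabs (mkc x' y' - z0) <= S.
  apply: le_trans (cabs_le_reim _) _; rewrite reB imB /re /im /= /S.
  by apply: lerD; rewrite ler_norml; apply/andP; split; lra.
have lt1 : cabs (mkc x' y' - z0) < r by apply: le_lt_trans le1 _; rewrite /S; lra.
have zE : mkc x y + (mkc x' y' - z0) = mkc x' y' by rewrite /z0; ring.
have := hr _ lt1; rewrite zE => H.
have -> : g (mkc x' y') = h (mkc x' y') - h z0 - l * (mkc x' y' - z0) by rewrite /g; ring.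
by apply: le_trans H _; rewrite ler_wpM2l// ltW.
Qed.

(** The bound e (s + t)^2 on the integral around an s by t rectangle is inherited
    from its quarters and holds for small rectangles by differentiability, hence
    holds for the whole rectangle, for every e > 0. *)
Theorem Goursat h a b c d : eps_continuous h -> a <= b -> c <= d ->
  (forall x y, a <= x -> x <= b -> c <= y -> y <= d -> exists l, has_deriv h (mkc x y) l) ->
  rect_int h a b c d = 0.
Proof.
move=> ch ab cd hd.
pose S := (b - a) + (d - c).
suff H e : 0 < e -> cabs (rect_int h a b c d) <= e * S ^+ 2.
  have S0 : 0 <= S ^+ 2 by exact: sqr_ge0.
  apply/eqP; rewrite -cabs_eq0; apply/eqP/le_anti; rewrite cabs_ge0 andbT.
  apply/ler_addgt0Pr => e e0; rewrite add0r.
  have e1 : 0 < e / (S ^+ 2 + 1) by apply: divr_gt0 => //; lra.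
  apply: le_trans (H _ e1) _; rewrite mulrAC ler_pdivrMr; last by lra.
  by nra.
move=> e0.
pose P x y s t := cabs (rect_int h x (x + s) y (y + t)) <= e * (s + t) ^+ 2.
have -> : b = a + (b - a) by ring.
have -> : d = c + (d - c) by ring.
rewrite /S; apply: (@bisection_rect P); rewrite /P; try lra.
  move=> x y s' t' s0 t0 hq.
  have H00 := hq false false; have H01 := hq false true.
  have H10 := hq true false; have H11 := hq true true.
  move: H00 H01 H10 H11; rewrite /= !mul0r !mul1r !addr0 => H00 H01 H10 H11.
  have E1 : x + s' / 2 + s' / 2 = x + s' by field.
  have E2 : y + t' / 2 + t' / 2 = y + t' by field.
  rewrite E1 in H10 H11; rewrite E2 in H01 H11.
  have [x1 x2] : x <= x + s' / 2 /\ x + s' / 2 <= x + s' by clear -s0; lra.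
  have [y1 y2] : y <= y + t' / 2 /\ y + t' / 2 <= y + t' by clear -t0; lra.
  rewrite (rect_int_vcut _ _ ch x1 x2) !(rect_int_hcut _ _ ch y1 y2).
  apply: le_trans (cabsD _ _) _; apply: le_trans (lerD (cabsD _ _) (cabsD _ _)) _.
  have -> : e * (s' + t') ^+ 2 = 4 * (e * (s' / 2 + t' / 2) ^+ 2) by field.
  set m := e * _ in H00 H01 H10 H11 *; have -> : 4 * m = m + m + (m + m) by ring.
  exact: lerD (lerD H00 H01) (lerD H10 H11).
move=> X Y X1 X2 Y1 Y2.
have [||||r r0 hr] := rect_int_small ch (hd X Y _ _ _ _) e0; try lra.
exists r => // x y s' t' s0 t0 sr tr _ _ _ _ xX Xx yY Yy.
have -> : s' + t' = (x + s' - x) + (y + t' - y) by ring.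
by apply: hr => //; lra.
Qed.

End Goursat.

(** * Difference quotients *)

Section MaximumBound.
Variable R : realType.
Implicit Types (h f g : C R -> C R) (z w : C R) (M x y r e : R).

Lemma continuous_is_eps_continuous f : continuous f -> eps_continuous f.
Proof.
move=> cf z e e0; have : nbhs (f z) [set w | cabs (w - f z) < e].
  by apply/nbhsCP; exists e.
by move/cf => /nbhsCP [d d0 hd]; exists d.
Qed.

Lemma eps_continuous_at f z : (forall e : R, 0 < e -> exists2 r : R, 0 < r &
  forall w, cabs (w - z) < r -> cabs (f w - f z) < e) -> {for z, continuous f}.
Proof.
move=> H A /nbhsCP [e e0 he]; have [r r0 hr] := H e e0.
by apply/nbhsCP; exists r => // w /hr; exact: he.
Qed.

Lemma eps_continuous_is_continuous f : eps_continuous f -> continuous f.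
Proof. by move=> cf z; apply: eps_continuous_at => e; exact: cf. Qed.

(** Converse of [differentiable_deriv]; together they let derivatives be computed
    by the rules for [differentiable]. *)
Lemma has_deriv_differentiable f z d : has_deriv f z d -> differentiable f z.
Proof.
move=> H.
have linL : linear (fun h : C R => d * h).
  by move=> k x y; rewrite /GRing.scale /=; ring.
pose L : {linear C R -> C R} := HB.pack (fun h : C R => d * h)
  (GRing.isLinear.Build _ _ _ _ (fun h : C R => d * h) linL).
have cL : continuous L.
  exact: eps_continuous_is_continuous (eps_continuousZ d (@eps_continuous_id R)).
have eqL : f \o shift z = cst (f z) + L +o_ (0 : C R) id.
  apply/eqaddoP => e /posC [x x0 ->].
  have [r r0 hr] := H _ x0.
  apply/nbhsCP; exists r => // h; rewrite subr0 => /hr.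
  by rewrite !fctE /= !normE -rcM rc_le [h + z]addrC (opprD (f z)) addrA.
apply/diff_locallyP; have -> : 'd f z = L :> (C R -> C R) by apply: diff_unique.
by split.
Qed.

Lemma has_deriv_local f g z d (r : R) : 0 < r -> (forall w, cabs (w - z) < r -> f w = g w) ->
  has_deriv f z d -> has_deriv g z d.
Proof.
move=> r0 fg H e e0; have [r1 r10 h1] := H e e0.
exists (Num.min r r1) => [|t]; rewrite lt_min ?r0 ?r10// => /andP[t1 t2].
rewrite -!fg; first exact: h1; last by rewrite addrC addKr.
by rewrite subrr cabs0.
Qed.

Lemma differentiable_local f g z (r : R) : 0 < r ->
  (forall w, cabs (w - z) < r -> f w = g w) -> differentiable f z -> differentiable g z.
Proof.
move=> r0 fg /differentiable_deriv [d hd].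
by apply: has_deriv_differentiable (has_deriv_local r0 fg hd).
Qed.

Lemma has_deriv_continuous f z d : has_deriv f z d -> forall e : R, 0 < e -> exists2 r : R, 0 < r &
  forall w, cabs (w - z) < r -> cabs (f w - f z) < e.
Proof.
move=> /has_deriv_differentiable /differentiable_continuous cf e e0.
have : nbhs (f z) [set w | cabs (w - f z) < e] by apply/nbhsCP; exists e.
by move/cf => /nbhsCP [r r0 hr]; exists r.
Qed.

(** The difference quotient of h at a, completed by the value l at a; with l the
    derivative of h it is continuous. *)
Definition diff_quot h a l z : C R := if z == a then l else (h z - h a) / (z - a).

Lemma differentiable_diff_quot h a l z : z != a -> differentiable h z -> differentiable (diff_quot h a l) z.
Proof.
move=> za dh; have r0 : 0 < cabs (z - a) by rewrite cabs_gt0 subr_eq0.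
have : differentiable (fun w => (h w - h a) * (w - a)^-1) z.
  apply: (@differentiableM _ _ (fun w => h w - h a) (fun w => (w - a)^-1)).
    apply: (@differentiableB _ _ _ h (cst (h a))) => //; exact: differentiable_cst.
  apply: (@differentiableV _ _ (fun w => w - a)); last by rewrite subr_eq0.
  apply: (@differentiableB _ _ _ id (cst a)) => //; exact: differentiable_cst.
apply: differentiable_local r0 _ => w hw; rewrite /diff_quot; case: eqP => // wa.
by move: hw; rewrite wa cabsC ltxx.
Qed.

Lemma diff_quot_continuous_at h a l : has_deriv h a l -> forall e : R, 0 < e -> exists2 r : R, 0 < r &
  forall w, cabs (w - a) < r -> cabs (diff_quot h a l w - diff_quot h a l a) < e.
Proof.
move=> hl e e0; have e2 : 0 < e / 2 by lra.
have [r r0 hr] := hl _ e2; exists r => // w wr; rewrite /diff_quot eqxx.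
case: eqP => [_|/eqP wa]; first by rewrite subrr cabs0.
have wa0 : w - a != 0 by rewrite subr_eq0.
have := hr (w - a) wr; have -> : a + (w - a) = w by ring.
have -> : (h w - h a) / (w - a) - l = (h w - h a - l * (w - a)) / (w - a) by field.
rewrite cabsM cabsV => H; apply: le_lt_trans (_ : e / 2 < e); last by lra.
by rewrite ler_pdivrMr ?cabs_gt0.
Qed.

Lemma diff_quot_continuous h a l : eps_continuous h -> has_deriv h a l -> eps_continuous (diff_quot h a l).
Proof.
move=> ch hl z e e0; have [->|za] := eqVneq z a; first exact: diff_quot_continuous_at.
have r0 : 0 < cabs (z - a) by rewrite cabs_gt0 subr_eq0.
have c1 : {for z, continuous (fun w => (h w - h a) * (w - a)^-1)}.
  have ca (f : C R -> C R) k : continuous f -> {for z, continuous (fun w => f w - k)}.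
    move=> cf; apply: (@continuousD _ _ _ f (fun=> - k)); first exact: cf.
    exact: cst_continuous.
  apply: (@continuousM _ _ (fun w => h w - h a) (fun w => (w - a)^-1)).
    exact/ca/eps_continuous_is_continuous.
  apply: (@continuousV _ _ (fun w => w - a)); first by rewrite subr_eq0.
  by apply: (ca id) => w; exact: cvg_id.
pose D z := (h z - h a) * (z - a)^-1.
have : nbhs (D z) [set w | cabs (w - D z) < e] by apply/nbhsCP; exists e.
move/c1 => /nbhsCP [d d0 hd].
exists (Num.min d (cabs (z - a))) => [|w]; rewrite lt_min ?d0 ?r0// => /andP[w1 w2].
have wa : w != a by apply: contraTneq w2 => ->; rewrite cabsC ltxx.
by rewrite /diff_quot (negbTE wa) (negbTE za); exact: hd.
Qed.

Definition in_square x0 y0 r z :=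
  [/\ x0 - r <= re z, re z <= x0 + r, y0 - r <= im z & im z <= y0 + r].

(** The quotient may fail to be differentiable at the centre, which is therefore
    cut out: the four surrounding rectangles contribute 0 by Goursat's theorem, and
    the small square of half side p contributes O(p) as the quotient is bounded. *)
Lemma rect_int_diff_quot h x0 y0 r l : 0 < r -> eps_continuous h -> has_deriv h (mkc x0 y0) l ->
  (forall z, in_square x0 y0 r z -> differentiable h z) ->
  rect_int (diff_quot h (mkc x0 y0) l) (x0 - r) (x0 + r) (y0 - r) (y0 + r) = 0.
Proof.
move=> r0 ch hl hd; set a := mkc x0 y0; set q := diff_quot h a l.
have cq : eps_continuous q by exact: diff_quot_continuous.
have qd x y : x0 - r <= x -> x <= x0 + r -> y0 - r <= y -> y <= y0 + r ->
    (x != x0) || (y != y0) -> exists m, has_deriv q (mkc x y) m.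
  move=> h1 h2 h3 h4 ne; apply: differentiable_deriv; apply: differentiable_diff_quot.
    by apply: contraTneq ne => -[-> ->]; rewrite !eqxx.
  by apply: hd; split.
apply/eqP; rewrite -cabs_eq0; apply/eqP/le_anti; rewrite cabs_ge0 andbT.
apply/ler_addgt0Pr => e e0; rewrite add0r.
have [r1 r10 hr1] := diff_quot_continuous_at hl ltr01.
pose B := cabs l + 1; have B0 : 0 < B by rewrite /B; have := cabs_ge0 l; lra.
have [p p0 [pr pr1 pe]] : exists2 p : R, 0 < p & [/\ p < r, 2 * p < r1 & 16 * B * p <= e].
  exists (Num.min (r / 2) (Num.min (r1 / 4) (e / (16 * B)))).
    rewrite !lt_min; apply/and3P; split; try lra.
    by apply: divr_gt0 => //; lra.
  have H x y : Num.min x y <= x by rewrite ge_min lexx.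
  have H' x y : Num.min x y <= y by rewrite ge_min lexx orbT.
  split.
  - by apply: le_lt_trans (H _ _) _; lra.
  - have := le_trans (H' (r / 2) _) (H (r1 / 4) (e / (16 * B))); lra.
  - have := le_trans (H' (r / 2) _) (H' (r1 / 4) (e / (16 * B))).
    by rewrite ler_pdivlMr; [lra|lra].
rewrite (@rect_int_vcut _ q (x0 - r) (x0 - p))//; try lra.
rewrite (@rect_int_vcut _ q (x0 - p) (x0 + p) (x0 + r))//; try lra.
rewrite (@rect_int_hcut _ q (x0 - p) (x0 + p) (y0 - r) (y0 - p))//; try lra.
rewrite (@rect_int_hcut _ q (x0 - p) (x0 + p) (y0 - p) (y0 + p) (y0 + r))//; try lra.
have nex x : x < x0 \/ x0 < x -> x != x0.
  by case=> h'; apply/eqP => E; rewrite E ltxx in h'.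
have ney y : y < y0 \/ y0 < y -> y != y0.
  by case=> h'; apply/eqP => E; rewrite E ltxx in h'.
rewrite (Goursat cq (a := x0 - r)); [|lra|lra|]; last first.
  move=> x y h1 h2 h3 h4; apply: qd; try lra; apply/orP; left; apply: nex; lra.
rewrite (Goursat cq (a := x0 + p)); [|lra|lra|]; last first.
  move=> x y h1 h2 h3 h4; apply: qd; try lra; apply/orP; left; apply: nex; lra.
rewrite (Goursat cq (c := y0 - r)); [|lra|lra|]; last first.
  move=> x y h1 h2 h3 h4; apply: qd; try lra; apply/orP; right; apply: ney; lra.
rewrite (Goursat cq (c := y0 + p)); [|lra|lra|]; last first.
  move=> x y h1 h2 h3 h4; apply: qd; try lra; apply/orP; right; apply: ney; lra.
rewrite !add0r !addr0; apply: le_trans pe.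
have -> : 16 * B * p = 4 * B * ((x0 + p - (x0 - p)) + (y0 + p - (y0 - p))) by ring.
apply: rect_int_bound => //; try lra.
move=> x y h1 h2 h3 h4.
have H : cabs (mkc x y - a) < r1.
  apply: le_lt_trans (cabs_le_reim _) _; rewrite reB imB /re /im /=.
  have : `|x - x0| <= p by rewrite ler_norml; apply/andP; split; lra.
  have : `|y - y0| <= p by rewrite ler_norml; apply/andP; split; lra.
  lra.
have := hr1 _ H; rewrite -/q => H2.
have := cabsD (q (mkc x y) - q a) (q a); rewrite subrK.
have -> : cabs (q a) = cabs l by rewrite /q /diff_quot eqxx.
by rewrite /B; lra.
Qed.

End MaximumBound.

(** * A maximum bound on squares *)

Section CauchyLipschitz.
Variable R : realType.
Implicit Types (h f g : C R -> C R) (z w : C R) (M x y r e : R).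

Lemma re_inv w : re w^-1 = re w / (re w ^+ 2 + im w ^+ 2).
Proof. by case: w. Qed.
Lemma im_inv w : im w^-1 = - im w / (re w ^+ 2 + im w ^+ 2).
Proof. by case: w => a b; rewrite /im /= mulNr. Qed.

(** Lower bound for the real or imaginary part of 1 / (u + i v) on a side of the
    square of half side r, where v = r or v = - r. *)
Lemma sq_frac (u v r : R) : 0 < r -> `|u| <= r -> v ^+ 2 = r ^+ 2 ->
  1 / 2 / r <= r / (u ^+ 2 + v ^+ 2).
Proof.
move=> r0 ur ->; have u2 : u ^+ 2 <= r ^+ 2.
  by rewrite -(real_normK (num_real u)) lerXn2r ?nnegrE// ltW.
have r2 : 0 < r ^+ 2 by exact: exprn_gt0.
have u20 := sqr_ge0 u.
rewrite ler_pdivlMr; last by lra.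
apply: le_trans (_ : 1 / 2 / r * (r ^+ 2 + r ^+ 2) <= _).
  by rewrite ler_wpM2l//; [rewrite divr_ge0// ltW|lra].
by rewrite le_eqVlt; apply/orP; left; apply/eqP; field; exact: lt0r_neq0.
Qed.

Lemma four_sides (i1 i2 i3 i4 i5 t : R) : i1 <= t -> - i2 <= t -> i3 <= t -> - i4 <= t ->
  i1 - i2 + (0 * i5 + 1 * (i3 - i4)) = 0 -> 0 <= t.
Proof. by lra. Qed.

(** Let h = 1 at the centre.  On each side, the tangential part of
    (h - 1) / (z - a) is at most eta / r - 1 / (2 r), because |h| <= eta and
    |z - a| >= r, while 1 / (z - a) alone contributes at least 1 / (2 r)
    ([sq_frac]).  The integral around the square being 0, this cannot be
    negative. *)
Lemma square_mean_bound h x0 y0 r (eta : R) : 0 < r -> eps_continuous h -> h (mkc x0 y0) = 1 ->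
  (forall z, in_square x0 y0 r z -> differentiable h z) ->
  (forall z, in_square x0 y0 r z -> (`|re z - x0| = r \/ `|im z - y0| = r) ->
     cabs (h z) <= eta) -> 1 / 2 <= eta.
Proof.
move=> r0 ch h1 hd hb; set a := mkc x0 y0.
have [l hl] : exists l, has_deriv h a l.
  by apply: differentiable_deriv; apply: hd; split; rewrite /re /im /=; lra.
have := rect_int_diff_quot r0 ch hl hd; rewrite -/a; set q := diff_quot h a l => rq0.
have cq : eps_continuous q by exact: diff_quot_continuous.
set T := eta / r - 1 / 2 / r.
(* Split the quotient into the part containing h and the part - 1 / (z - a). *)
have key z : in_square x0 y0 r z -> (`|re z - x0| = r \/ `|im z - y0| = r) ->
   exists2 k : C R, cabs k <= eta / r & q z = k - (z - a)^-1.
  move=> zq zb; exists (h z * (z - a)^-1).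
    rewrite cabsM cabsV; have le_r : r <= cabs (z - a).
      case: zb => E; rewrite -E.
        by apply: le_trans (re_le_cabs _); rewrite reB.
      by apply: le_trans (im_le_cabs _); rewrite imB.
    have c0 : 0 < cabs (z - a) by lra.
    apply: ler_pM; rewrite ?invr_ge0 ?cabs_ge0//; first exact: hb.
    by rewrite lef_pV2.
  have za : z != a.
    apply/eqP => E; case: zb; rewrite E /re /im /= subrr normr0 => E'; lra.
  by rewrite /q /diff_quot (negbTE za) h1 mulrBl mul1r.
have absle u : - r <= u -> u <= r -> `|u| <= r by move=> p1 p2; rewrite ler_norml p1.
have absr : `|r| = r by rewrite gtr0_norm.
have absNr : `|- r| = r by rewrite normrN.
have cM : continuous (fun _ : R => T) by exact: cst_continuous.
have bot x : x0 - r <= x -> x <= x0 + r -> im (q (mkc x (y0 - r))) <= T.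
  move=> p1 p2; have [||k kle ->] := key (mkc x (y0 - r)).
  - by split; rewrite /re /im /=; lra.
  - by right; rewrite /im /= (_ : y0 - r - y0 = - r)//; ring.
  rewrite imB im_inv reB imB /re /im /= -/(re k) -/(im k).
  have := sq_frac r0 (absle (x - x0) _ _) (sqrrN r) => /(_ ltac:(lra) ltac:(lra)).
  have -> : y0 - r - y0 = - r by ring.
  rewrite opprK /T.
  by have := le_trans (ler_norm _) (le_trans (im_le_cabs k) kle); lra.
have top x : x0 - r <= x -> x <= x0 + r -> - im (q (mkc x (y0 + r))) <= T.
  move=> p1 p2; have [||k kle ->] := key (mkc x (y0 + r)).
  - by split; rewrite /re /im /=; lra.
  - by right; rewrite /im /= (_ : y0 + r - y0 = r)//; ring.
  rewrite imB im_inv reB imB /re /im /= -/(re k) -/(im k).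
  have := sq_frac r0 (absle (x - x0) _ _) (erefl (r ^+ 2)) => /(_ ltac:(lra) ltac:(lra)).
  have -> : y0 + r - y0 = r by ring.
  rewrite /T mulNr.
  by have := le_trans (ler_norm _) (le_trans (im_le_cabs (- k)) _); rewrite imN cabsN => /(_ _ kle); lra.
have rgt y : y0 - r <= y -> y <= y0 + r -> re (q (mkc (x0 + r) y)) <= T.
  move=> p1 p2; have [||k kle ->] := key (mkc (x0 + r) y).
  - by split; rewrite /re /im /=; lra.
  - by left; rewrite /re /= (_ : x0 + r - x0 = r)//; ring.
  rewrite reB re_inv reB imB /re /im /= -/(re k) -/(im k).
  have := sq_frac r0 (absle (y - y0) _ _) (erefl (r ^+ 2)) => /(_ ltac:(lra) ltac:(lra)).
  rewrite [(y - y0) ^+ 2 + _]addrC.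
  have -> : x0 + r - x0 = r by ring.
  rewrite /T.
  by have := le_trans (ler_norm _) (le_trans (re_le_cabs k) kle); lra.
have lft y : y0 - r <= y -> y <= y0 + r -> - re (q (mkc (x0 - r) y)) <= T.
  move=> p1 p2; have [||k kle ->] := key (mkc (x0 - r) y).
  - by split; rewrite /re /im /=; lra.
  - by left; rewrite /re /= (_ : x0 - r - x0 = - r)//; ring.
  rewrite reB re_inv reB imB /re /im /= -/(re k) -/(im k).
  have := sq_frac r0 (absle (y - y0) _ _) (sqrrN r) => /(_ ltac:(lra) ltac:(lra)).
  rewrite [(y - y0) ^+ 2 + _]addrC.
  have -> : x0 - r - x0 = - r by ring.
  rewrite /T mulNr.
  by have := le_trans (ler_norm _) (le_trans (re_le_cabs (- k)) _); rewrite reN cabsN => /(_ _ kle); lra.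
have sz u : u + r - (u - r) = 2 * r by ring.
have igT u : seg_int (fun=> T) (u - r) (u + r) = 2 * r * T by rewrite seg_int_cst ?sz 1?mulrC//; lra.
have cN (f : R -> R) : continuous f -> continuous (fun t => - f t).
  by move=> cf t; apply: cvgN; exact: cf.
have igN (f : R -> R) u v : continuous f -> seg_int (fun t => - f t) u v = - seg_int f u v.
  move=> cf; rewrite -mulN1r -seg_intZ//; congr seg_int; apply/funext => t; by rewrite mulN1r.
have B1 : seg_int (fun x => im (q (mkc x (y0 - r)))) (x0 - r) (x0 + r) <= 2 * r * T.
  by rewrite -(igT x0); apply: seg_int_le => //; exact: (path_continuous_im (eps_continuous_h _ cq)).
have B2 : - seg_int (fun x => im (q (mkc x (y0 + r)))) (x0 - r) (x0 + r) <= 2 * r * T.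
  have c := path_continuous_im (eps_continuous_h (y0 + r) cq).
  by rewrite -(igT x0) -igN//; apply: seg_int_le => //; exact: cN.
have B3 : seg_int (fun y => re (q (mkc (x0 + r) y))) (y0 - r) (y0 + r) <= 2 * r * T.
  by rewrite -(igT y0); apply: seg_int_le => //; exact: (path_continuous_re (eps_continuous_v _ cq)).
have B4 : - seg_int (fun y => re (q (mkc (x0 - r) y))) (y0 - r) (y0 + r) <= 2 * r * T.
  have c := path_continuous_re (eps_continuous_v (x0 - r) cq).
  by rewrite -(igT y0) -igN//; apply: seg_int_le => //; exact: cN.
have := congr1 (@im R) rq0; rewrite /rect_int imD imB imM reB imB /cseg_int /re /im /= => E.
have T0 : 0 <= 2 * r * T by exact: four_sides B1 B2 B3 B4 E.
have r20 : 0 < 2 * r by rewrite mulr_gt0.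
move: T0; rewrite pmulr_rge0//.
by rewrite /T subr_ge0 ler_pM2r ?invr_gt0.
Qed.

Lemma square_bound h x0 y0 r M : 0 < r -> eps_continuous h ->
  (forall z, in_square x0 y0 r z -> differentiable h z) ->
  (forall z, in_square x0 y0 r z -> (`|re z - x0| = r \/ `|im z - y0| = r) ->
     cabs (h z) <= M) -> cabs (h (mkc x0 y0)) <= 2 * M.
Proof.
move=> r0 ch hd hb; set a := mkc x0 y0.
have M0 : 0 <= M.
  apply: le_trans (cabs_ge0 _) (hb (mkc (x0 + r) y0) _ _).
    by split; rewrite /re /im /=; lra.
  by left; rewrite /re /= (_ : x0 + r - x0 = r) ?gtr0_norm//; ring.
have [->|ha] := eqVneq (h a) 0; first by rewrite cabs0; lra.
have c0 : 0 < cabs (h a) by rewrite cabs_gt0.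
have := @square_mean_bound (fun z => (h a)^-1 * h z) x0 y0 r (M / cabs (h a)) r0.
move=> /(_ (eps_continuousZ _ ch) (mulVf ha)) H.
suff : 1 / 2 <= M / cabs (h a) by rewrite ler_pdivlMr//; lra.
apply: H.
  by move=> z hz; apply: (@differentiableZ _ _ _ h) => //; exact: hd.
move=> z hz zb; rewrite cabsM cabsV mulrC; apply: ler_pM => //; rewrite ?invr_ge0 ?cabs_ge0//.
exact: hb.
Qed.

(** Bounds for all powers forget multiplicative constants. *)
Lemma geom_le (c D x B : R) : 0 < c -> 0 <= x -> 0 <= B ->
  (forall n, c * x ^+ n <= D * B ^+ n) -> x <= B.
Proof.
move=> c0 x0 B0 H; rewrite leNgt; apply/negP => Bx.
have xp : 0 < x by lra.
have D0 : 0 < D by have := H 0%N; rewrite !expr0 !mulr1; lra.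
have [B00|Bn0] := eqVneq B 0.
  by have := H 1%N; rewrite B00 !expr1 mulr0; nra.
have Bp : 0 < B by rewrite lt_def Bn0.
pose s := x / B - 1.
have s0 : 0 < s by rewrite /s subr_gt0 ltr_pdivlMr// mul1r.
have bern n : 1 + n%:R * s <= (1 + s) ^+ n.
  elim: n => [|n IH]; first by rewrite mul0r addr0 expr0.
  rewrite exprS; apply: le_trans (_ : (1 + s) * (1 + n%:R * s) <= _).
    rewrite -natr1; have : 0 <= n%:R * s * s by rewrite !mulr_ge0// ltW.
    by lra.
  by rewrite ler_wpM2l//; lra.
have xs : x = B * (1 + s) by rewrite /s addrC subrK mulrC divfK.
pose n := Num.bound (D / c / s).
have := H n; rewrite xs exprMn mulrCA [D * _]mulrC ler_pM2l ?exprn_gt0// => H1.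
have : D / c / s < n%:R.
  by apply: archi_boundP; rewrite divr_ge0 ?ltW// divr_gt0.
rewrite ltr_pdivrMr// ltr_pdivrMr// => H2.
by have := ler_wpM2l (ltW c0) (bern n); nra.
Qed.

End CauchyLipschitz.

(** * Cauchy estimates *)

Section Weierstrass.
Variable R : realType.
Implicit Types (z w : C R) (M x y r : R).

Definition clamp (s x : R) : R := Num.max (- s) (Num.min x s).
(** Truncating both coordinates extends a function given near a square to a
    continuous function on the whole plane without changing it on the square. *)
Definition cclamp (s : R) z : C R := mkc (clamp s (re z)) (clamp s (im z)).

Lemma clamp_in s x : 0 <= s -> - s <= clamp s x <= s.
Proof.
move=> s0; rewrite /clamp le_max lexx /= ge_max; apply/andP; split; first by lra.
by rewrite ge_min lexx orbT.
Qed.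

Lemma clamp_id s x : - s <= x -> x <= s -> clamp s x = x.
Proof. by move=> h1 h2; rewrite /clamp min_l// max_r. Qed.

Lemma min_lip s x y : `|Num.min x s - Num.min y s| <= `|x - y|.
Proof.
have := ler_norm (x - y); have := ler_norm (- (x - y)); rewrite normrN => le1 le2.
by rewrite ler_norml; apply/andP; case: (ltP x s) => ?; case: (ltP y s) => ?; split; lra.
Qed.

Lemma max_lip s x y : `|Num.max s x - Num.max s y| <= `|x - y|.
Proof.
have := ler_norm (x - y); have := ler_norm (- (x - y)); rewrite normrN => le1 le2.
by rewrite ler_norml; apply/andP; case: (ltP s x) => ?; case: (ltP s y) => ?; split; lra.
Qed.

Lemma clamp_lip s x y : `|clamp s x - clamp s y| <= `|x - y|.
Proof. exact: le_trans (max_lip _ _ _) (min_lip _ _ _). Qed.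

Lemma differentiable_idC z : differentiable (fun w : C R => w) z.
Proof.
apply: (@has_deriv_differentiable _ _ _ 1) => e e0; exists 1 => // h _.
by rewrite mul1r [z + h]addrC addrK subrr cabs0 mulr_ge0 ?cabs_ge0// ltW.
Qed.

Lemma differentiable_pow (V : normedModType (C R)) (f : V -> C R) n (p : V) :
  differentiable f p -> differentiable (fun v => f v ^+ n) p.
Proof.
move=> df; elim: n => [|n IH]; first exact: (differentiable_cst (1 : C R)).
have -> : (fun v => f v ^+ n.+1) = (fun v => f v) * (fun v => f v ^+ n).
  by apply/funext => v; rewrite exprS.
exact: differentiableM.
Qed.

(** With k the difference quotient of e at 0, the claim is a bound on k t.  The
    functions z k(z)^n are differentiable also at 0, since k is continuous there,
    so [square_bound] on a square centred at t gives |t| |k t|^n <= 2 rho B^n, where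
    B bounds k on the boundary of the square; now let n grow. *)
Lemma cauchy_lipschitz1 (e : C R -> C R) (rho M : R) : 0 < rho ->
  (forall z, cabs z < rho -> differentiable e z) ->
  (forall z, cabs z < rho -> cabs (e z) <= M) ->
  forall t, cabs t < rho / 8 -> cabs (e t - e 0) <= 16 * M / rho * cabs t.
Proof.
move=> rho0 ed eb t ht.
have [->|t0] := eqVneq t 0; first by rewrite subrr cabs0 mulr0.
have tp : 0 < cabs t by rewrite cabs_gt0.
have M0 : 0 <= M by apply: le_trans (cabs_ge0 _) (eb 0 _); rewrite cabs0.
(* Large enough for the square around t to lie inside, small enough for the
   corners, at distance at most 2 s, to stay in the disc. *)
pose s := 7 / 16 * rho; have s0 : 0 <= s by rewrite /s; lra.
have clin z : cabs (cclamp s z) < rho.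
  apply: le_lt_trans (cabs_le_reim _) _; rewrite /re /im /=.
  have : `|clamp s (complex.Re z)| <= s by rewrite ler_norml clamp_in.
  have : `|clamp s (complex.Im z)| <= s by rewrite ler_norml clamp_in.
  by rewrite /s; lra.
have clid z : `|re z| <= s -> `|im z| <= s -> cclamp s z = z.
  rewrite !ler_norml => /andP[? ?] /andP[? ?].
  by rewrite /cclamp !clamp_id// mkc_reim.
pose g z := e (cclamp s z).
have ctsg : eps_continuous g.
  move=> z eps eps0.
  have [l hl] := differentiable_deriv (ed _ (clin z)).
  have [r r0 hr] := has_deriv_continuous hl eps0.
  exists (r / 2) => [|w hw]; first by lra.
  apply: hr; apply: le_lt_trans (cabs_le_reim _) _; rewrite reB imB.
  have h1 := clamp_lip s (re w) (re z); have h2 := clamp_lip s (im w) (im z).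
  have h3 := re_le_cabs (w - z); have h4 := im_le_cabs (w - z).
  by move: h3 h4; rewrite reB imB /cclamp /re /im /= -/(re _) -/(re _) -/(im _) -/(im _); lra.
have gd z : `|re z| < s -> `|im z| < s -> differentiable g z.
  move=> h1 h2; have zE : cclamp s z = z by apply: clid; exact: ltW.
  apply: (@differentiable_local _ e _ _ (Num.min (s - `|re z|) (s - `|im z|))).
  - by rewrite lt_min !subr_gt0 h1.
  - move=> w; rewrite lt_min => /andP[w1 w2]; rewrite /g clid//.
      have := re_le_cabs (w - z); rewrite reB => h3.
      by have := ler_normD (re w - re z) (re z); rewrite subrK; lra.
    have := im_le_cabs (w - z); rewrite imB => h3.
    by have := ler_normD (im w - im z) (im z); rewrite subrK; lra.
  - by apply: ed; rewrite -zE.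
have g0 : g 0 = e 0 by rewrite /g clid// /re /im /= normr0.
have [l hl] : exists l, has_deriv g 0 l.
  by apply: differentiable_deriv; apply: gd; rewrite /re /im /= normr0 /s; lra.
pose k := diff_quot g 0 l; pose B := 16 * M / rho.
have B0 : 0 <= B by rewrite /B divr_ge0 ?mulr_ge0// ltW.
suff : cabs (k t) <= B.
  have tE : cclamp s t = t.
    apply: clid; first by apply: le_trans (re_le_cabs _) _; rewrite /s; lra.
    by apply: le_trans (im_le_cabs _) _; rewrite /s; lra.
  by rewrite /k /diff_quot (negbTE t0) subr0 g0 cabsM cabsV ler_pdivrMr// /g tE.
have ck : continuous k by apply: eps_continuous_is_continuous; exact: diff_quot_continuous.
apply: (@geom_le _ (cabs t) (2 * rho)) => // [|n]; first exact: cabs_ge0.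
pose h z : C R := z * k z ^+ n.
have ckn : continuous (fun z => k z ^+ n).
  move=> z; apply: (@continuous_comp _ _ _ k (fun w : C R => w ^+ n)).
    exact: ck.
  by apply: differentiable_continuous; exact: differentiable_pow.
have ch : eps_continuous h.
  apply: continuous_is_eps_continuous => z.
  by apply: (@continuousM _ _ id (fun z => k z ^+ n)); [exact: cvg_id|exact: ckn].
have hd z : `|re z| < s -> `|im z| < s -> differentiable h z.
  move=> h1 h2; have [->|z0] := eqVneq z 0.
    apply: (@has_deriv_differentiable _ _ _ (k 0 ^+ n)) => eps eps0.
    have [r r0 hr] := continuous_is_eps_continuous ckn 0 eps0.
    exists r => // w wr; rewrite /h mul0r subr0 add0r mulrC -mulrBl cabsM.
    by rewrite ler_wpM2r ?cabs_ge0//; apply: ltW; apply: hr; rewrite subr0.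
  have did : differentiable (fun z : C R => z) z by exact: differentiable_idC.
  suff dkn : differentiable (fun z => k z ^+ n) z by exact: differentiableM did dkn.
  have dk : differentiable k z := differentiable_diff_quot l z0 (gd z h1 h2).
  exact: differentiable_pow.
have inb z : in_square (re t) (im t) (rho / 4) z -> `|re z| < s /\ `|im z| < s.
  move=> [h1 h2 h3 h4]; have := re_le_cabs t; have := im_le_cabs t.
  by rewrite !ler_norml !ltr_norml => /andP[? ?] /andP[? ?]; rewrite /s; split; apply/andP; split; lra.
have -> : cabs t * cabs (k t) ^+ n = cabs (h (mkc (re t) (im t))).
  by rewrite mkc_reim cabsM cabsX.
have -> : 2 * rho * B ^+ n = 2 * (rho * B ^+ n) by rewrite mulrA.
apply: (@square_bound _ _ _ _ (rho / 4)).
- by lra.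
- exact: ch.
- by move=> z /inb [h1 h2]; exact: hd.
move=> z zin zb; have [z1 z2] := inb z zin.
have zlow : rho / 8 <= cabs z.
  suff : rho / 4 <= cabs (z - t) by have := cabsB z t; lra.
  case: zb => E; rewrite -E.
    by rewrite -reB re_le_cabs.
  by rewrite -imB im_le_cabs.
have z0 : z != 0 by rewrite -cabs_gt0; lra.
have gz : g z = e z by rewrite /g clid//; exact: ltW.
have zrho : cabs z < rho by have := clin z; rewrite clid//; exact: ltW.
rewrite cabsM cabsX; apply: ler_pM; rewrite ?exprn_ge0 ?cabs_ge0//; first exact: ltW.
apply: lerXn2r; rewrite ?nnegrE ?cabs_ge0//.
rewrite /k /diff_quot (negbTE z0) subr0 gz g0 cabsM cabsV ler_pdivrMr; last by lra.
have H : cabs (e z - e 0) <= 2 * M.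
  have := cabsB (e z) (e 0); have := eb z zrho.
  by have := eb 0; rewrite cabs0 => /(_ rho0); lra.
apply: le_trans H _; apply: le_trans (ler_wpM2l B0 zlow).
by rewrite le_eqVlt; apply/orP; left; apply/eqP; rewrite /B; field; exact: lt0r_neq0.
Qed.

(** Restrict f to the complex line through p and q. *)
Lemma cauchy_lipschitz2 (f : C2 R -> C R) p (rho M : R) : 0 < rho ->
  (forall q, maxnorm (q - p) < rho -> differentiable f q) ->
  (forall q, maxnorm (q - p) < rho -> cabs (f q) <= M) ->
  forall q, maxnorm (q - p) < rho / 8 -> cabs (f q - f p) <= 16 * M / rho * maxnorm (q - p).
Proof.
move=> rho0 fd fb q hq.
have [qp|qp] := eqVneq (maxnorm (q - p)) 0.
  have/eqP := maxnorm_eq0 qp; rewrite subr_eq0 => /eqP ->.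
  by rewrite subrr cabs0 subrr maxnorm_0 mulr0.
set N := maxnorm (q - p) in hq qp *.
have N0 : 0 < N by rewrite lt_def qp maxnorm_ge0.
pose v : C2 R := ((rc N)^-1 * (q - p).1, (rc N)^-1 * (q - p).2).
have nv : maxnorm v = 1.
  by rewrite maxnormZ cabsV cabs_rc gtr0_norm// mulVf.
pose ln z : C2 R := (p.1 + z * v.1, p.2 + z * v.2).
have nl z : maxnorm (ln z - p) = cabs z.
  have -> : ln z - p = (z * v.1, z * v.2).
    by rewrite /ln; apply/eqP; rewrite -pair_eqE /pair_eq /= ![_ + _ - _]addrC !addKr !eqxx.
  by rewrite maxnormZ nv mulr1.
have lnN : ln (rc N) = q.
  rewrite /ln /v /= !mulrA mulfV ?rc_eq0// !mul1r.
  by rewrite ![_ + (_ - _)]addrC !subrK; case: (q).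
have ln0 : ln 0 = p by rewrite /ln !mul0r !addr0; case: (p).
have cN : cabs (rc N) = N by rewrite cabs_rc gtr0_norm.
have := @cauchy_lipschitz1 (fun z => f (ln z)) rho M rho0 _ _ (rc N).
rewrite lnN ln0 cN; apply; last exact: hq.
- move=> z hz; apply: (@differentiable_comp _ _ _ _ ln f z); last by apply: fd; rewrite nl.
  have da (a b : C R) : differentiable (fun z : C R => a + z * b) z.
    apply: (@differentiableD _ _ _ (cst a) (fun z => z * b)); first exact: differentiable_cst.
    apply: (@differentiableM _ _ (fun z => z) (cst b)); first exact: differentiable_idC.
    exact: differentiable_cst.
  exact: differentiable_pair (da _ _) (da _ _).
- by move=> z hz; apply: fb; rewrite nl.
Qed.

End Weierstrass.

(** * Uniform limits of holomorphic functions *)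

Section UniformLimit.
Variable R : realType.

Lemma real_cauchy (u : nat -> R) :
  (forall e, 0 < e -> exists N, forall n m, (N <= n)%N -> (N <= m)%N -> `|u n - u m| <= e) ->
  exists l, forall e, 0 < e -> exists N, forall n, (N <= n)%N -> `|u n - l| <= e.
Proof.
move=> H; have cu : cvg (u @ \oo).
  apply: R_complete; apply/cauchy_ballP => e e0.
  have e2 : 0 < e / 2 by lra.
  have [N hN] := H _ e2.
  exists ([set x | exists2 n, (N <= n)%N & x = u n], [set x | exists2 n, (N <= n)%N & x = u n]).
    by split; exists N => // n /= hn; exists n.
  move=> [a b] /= [[n hn ->] [m hm ->]]; rewrite /ball /=.
  by apply: le_lt_trans (hN _ _ hn hm) _; lra.
exists (lim (u @ \oo)) => e e0.
have /cvgrPdist_le /(_ _ e0) [N _ hN] := cu.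
by exists N => n hn; rewrite distrC; exact: hN.
Qed.

Lemma complex_cauchy (u : nat -> C R) :
  (forall e, 0 < e -> exists N, forall n m, (N <= n)%N -> (N <= m)%N -> cabs (u n - u m) <= e) ->
  exists l, forall e, 0 < e -> exists N, forall n, (N <= n)%N -> cabs (u n - l) <= e.
Proof.
move=> H.
have [|a ha] := @real_cauchy (fun n => re (u n)).
  move=> e /H [N hN]; exists N => n m hn hm; rewrite -reB.
  exact: le_trans (re_le_cabs _) (hN _ _ hn hm).
have [|b hb] := @real_cauchy (fun n => im (u n)).
  move=> e /H [N hN]; exists N => n m hn hm; rewrite -imB.
  exact: le_trans (im_le_cabs _) (hN _ _ hn hm).
exists (mkc a b) => e e0; have e2 : 0 < e / 2 by lra.
have [N1 h1] := ha _ e2; have [N2 h2] := hb _ e2.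
exists (maxn N1 N2) => n; rewrite geq_max => /andP[m1 m2].
apply: le_trans (cabs_le_reim _) _; rewrite reB imB /re /im /= -/(re _) -/(im _).
by have := h1 n m1; have := h2 n m2; lra.
Qed.

Lemma has_deriv2_coeff (f : C2 R -> C R) p a b (K r : R) : 0 < r -> has_deriv2 f p a b ->
  (forall q, maxnorm (q - p) < r -> cabs (f q - f p) <= K * maxnorm (q - p)) ->
  cabs a <= K /\ cabs b <= K.
Proof.
move=> r0 hf hK.
have gen (v : C2 R) : maxnorm v = 1 -> cabs (a * v.1 + b * v.2) <= K.
  move=> v1; apply/ler_addgt0Pr => e e0.
  have [s s0 hs] := hf e e0.
  pose t := Num.min (r / 2) (s / 2).
  have t0 : 0 < t by rewrite /t lt_min; apply/andP; split; lra.
  have tr : t < r by apply: le_lt_trans (_ : r / 2 < r); [rewrite /t ge_min lexx|lra].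
  have ts : t < s by apply: le_lt_trans (_ : s / 2 < s); [rewrite /t ge_min lexx orbT|lra].
  pose h : C2 R := (rc t * v.1, rc t * v.2).
  have nh : maxnorm h = t by rewrite maxnormZ v1 mulr1 cabs_rc gtr0_norm.
  have H1 := hs h; rewrite nh in H1; have {}H1 := H1 ts.
  have H2 := hK (p + h); rewrite [p + h]addrC addrK nh in H2; have {}H2 := H2 tr.
  rewrite [p + h]addrC in H1.
  have E : a * h.1 + b * h.2 = rc t * (a * v.1 + b * v.2) by rewrite /h /=; ring.
  have H3 := cabs_le_dist (a * h.1 + b * h.2) (f (h + p) - f p).
  rewrite [X in _ <= X]cabsC in H3.
  have cE : cabs (a * h.1 + b * h.2) = t * cabs (a * v.1 + b * v.2).
    by rewrite E cabsM cabs_rc gtr0_norm.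
  by rewrite -(ler_pM2l t0) -cE; lra.
split.
  have := gen (1, 0); rewrite /= mulr1 mulr0 addr0; apply.
  by rewrite /maxnorm /= cabs1 cabs0 max_l.
have := gen (0, 1); rewrite /= mulr1 mulr0 add0r; apply.
by rewrite /maxnorm /= cabs1 cabs0 max_r.
Qed.

Lemma has_deriv2B (f g : C2 R -> C R) p a b c d : has_deriv2 f p a b -> has_deriv2 g p c d ->
  has_deriv2 (fun q => f q - g q) p (a - c) (b - d).
Proof.
move=> hf hg e e0; have e2 : 0 < e / 2 by lra.
have [r1 r10 h1] := hf _ e2; have [r2 r20 h2] := hg _ e2.
exists (Num.min r1 r2) => [|h]; rewrite lt_min ?r10 ?r20// => /andP[t1 t2].
have -> : f (p + h) - g (p + h) - (f p - g p) - ((a - c) * h.1 + (b - d) * h.2) =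
  (f (p + h) - f p - (a * h.1 + b * h.2)) - (g (p + h) - g p - (c * h.1 + d * h.2)) by ring.
by have := cabsB (f (p + h) - f p - (a * h.1 + b * h.2)) (g (p + h) - g p - (c * h.1 + d * h.2));
  have := h1 h t1; have := h2 h t2; lra.
Qed.

(** By the Cauchy estimate, fs n - fs m is Lipschitz at p with a constant that
    tends to 0.  Hence the partial derivatives at p form Cauchy sequences, and f
    differs from fs n by a function with a small Lipschitz constant at p. *)
Lemma differentiable_uniform_limit (fs : nat -> C2 R -> C R) (f : C2 R -> C R) p (rho : R) :
  0 < rho ->
  (forall n q, maxnorm (q - p) < rho -> differentiable (fs n) q) ->
  (forall e : R, 0 < e -> exists N, forall n, (N <= n)%N -> forall q, maxnorm (q - p) < rho ->
     cabs (fs n q - f q) <= e) ->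
  differentiable f p.
Proof.
move=> rho0 fd fu.
have r8 : 0 < rho / 8 by lra.
(* On the disc the difference of two late terms is at most e rho / 16. *)
have lip e : 0 < e -> exists N, forall n m, (N <= n)%N -> (N <= m)%N ->
    forall q, maxnorm (q - p) < rho / 8 ->
    cabs ((fs n q - fs m q) - (fs n p - fs m p)) <= e * maxnorm (q - p).
  move=> e0; have e1 : 0 < e * rho / 32 by rewrite divr_gt0// mulr_gt0.
  have [N hN] := fu _ e1; exists N => n m hn hm q hq.
  have -> : e = 16 * (e * rho / 16) / rho by field; exact: lt0r_neq0.
  apply: (@cauchy_lipschitz2 _ (fun q => fs n q - fs m q) p rho _ rho0 _ _ q hq).
    by move=> z hz; apply: differentiableB; exact: fd.
  move=> z hz; have -> : fs n z - fs m z = (fs n z - f z) - (fs m z - f z) by ring.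
  apply: le_trans (cabsB _ _) _; have := hN n hn z hz; have := hN m hm z hz; lra.
have lipf e : 0 < e -> exists N, forall n, (N <= n)%N ->
    forall q, maxnorm (q - p) < rho / 8 ->
    cabs ((fs n q - f q) - (fs n p - f p)) <= e * maxnorm (q - p).
  move=> e0; have [N hN] := lip e e0; exists N => n hn q hq.
  apply/ler_addgt0Pr => d d0; have d2 : 0 < d / 2 by lra.
  have [N' hN'] := fu _ d2; pose m := maxn N N'.
  have H := hN n m hn (leq_maxl _ _) q hq.
  have H1 := hN' m (leq_maxr _ _) q; have H2 := hN' m (leq_maxr _ _) p.
  rewrite subrr maxnorm_0 in H2; have {}H2 := H2 rho0; have {}H1 := H1 ltac:(lra).
  have -> : fs n q - f q - (fs n p - f p) =
    (fs n q - fs m q - (fs n p - fs m p)) + ((fs m q - f q) - (fs m p - f p)) by ring.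
  have := cabsD (fs n q - fs m q - (fs n p - fs m p)) ((fs m q - f q) - (fs m p - f p)).
  by have := cabsB (fs m q - f q) (fs m p - f p); lra.
have dn n : exists ab : C R * C R, has_deriv2 (fs n) p ab.1 ab.2.
  have [|a [b hab]] := @differentiable_deriv2 _ (fs n) p.
    by apply: fd; rewrite subrr maxnorm_0.
  by exists (a, b).
have [ab hab] := choice dn.
have cau e : 0 < e -> exists N, forall n m, (N <= n)%N -> (N <= m)%N ->
    cabs ((ab n).1 - (ab m).1) <= e /\ cabs ((ab n).2 - (ab m).2) <= e.
  move=> e0; have [N hN] := lip e e0; exists N => n m hn hm.
  exact: (has_deriv2_coeff r8 (has_deriv2B (hab n) (hab m)) (hN n m hn hm)).
have [|a ha] := @complex_cauchy (fun n => (ab n).1).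
  by move=> e /cau [N hN]; exists N => n m hn hm; have [] := hN n m hn hm.
have [|b hb] := @complex_cauchy (fun n => (ab n).2).
  by move=> e /cau [N hN]; exists N => n m hn hm; have [] := hN n m hn hm.
apply: (@has_deriv2_differentiable _ _ _ a b) => e e0.
have e4 : 0 < e / 4 by lra.
have [N1 h1] := lipf _ e4; have [N2 h2] := ha _ e4; have [N3 h3] := hb _ e4.
pose n := maxn N1 (maxn N2 N3).
have n1 : (N1 <= n)%N by exact: leq_maxl.
have n2' : (N2 <= n)%N by rewrite /n !leq_max leqnn orbT.
have n3 : (N3 <= n)%N by rewrite /n !leq_max leqnn !orbT.
have {}h1 := h1 n n1; have {}h2 := h2 n n2'; have {}h3 := h3 n n3.
have [r r0 hr] := hab n _ e4.
exists (Num.min r (rho / 8)) => [|h]; rewrite lt_min ?r0 ?r8// => /andP[t1 t2].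
have H1 := h1 (p + h); rewrite [p + h]addrC addrK -[h + p]addrC in H1; have {}H1 := H1 t2.
have H2 := hr h t1.
have -> : f (p + h) - f p - (a * h.1 + b * h.2) =
  (fs n (p + h) - fs n p - ((ab n).1 * h.1 + (ab n).2 * h.2))
  - ((fs n (p + h) - f (p + h)) - (fs n p - f p))
  + (((ab n).1 - a) * h.1 + ((ab n).2 - b) * h.2) by ring.
have T1 : cabs (((ab n).1 - a) * h.1) <= e / 4 * maxnorm h.
  by rewrite cabsM; apply: ler_pM; rewrite ?cabs_ge0// cabs_fst.
have T2 : cabs (((ab n).2 - b) * h.2) <= e / 4 * maxnorm h.
  by rewrite cabsM; apply: ler_pM; rewrite ?cabs_ge0// cabs_snd.
apply: le_trans (cabsD _ _) _; apply: le_trans (lerD (cabsB _ _) (cabsD _ _)) _.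
by lra.
Qed.

End UniformLimit.

(** * Holomorphic maps close to the identity *)

Section NearIdentity.
Variable R : realType.
Implicit Types (p q : C2 R) (f g : C2 R -> C2 R).

Lemma c2_ext p q : p.1 = q.1 -> p.2 = q.2 -> p = q.
Proof. by case: p; case: q => a b c d /= -> ->. Qed.
Ltac c2ring := apply: c2_ext; rewrite /=; ring.

Lemma differentiable_fst f p : differentiable f p -> differentiable (fun q => (f q).1) p.
Proof.
move=> df; apply: (@differentiable_comp _ _ _ _ f (fun q : C2 R => q.1) p df).
apply: (@has_deriv2_differentiable _ _ _ 1 0) => e e0; exists 1 => // h _.
by rewrite /= mul1r mul0r addr0 [_ + h.1]addrC addrK subrr cabs0 mulr_ge0 ?maxnorm_ge0// ltW.
Qed.

Lemma differentiable_snd f p : differentiable f p -> differentiable (fun q => (f q).2) p.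
Proof.
move=> df; apply: (@differentiable_comp _ _ _ _ f (fun q : C2 R => q.2) p df).
apply: (@has_deriv2_differentiable _ _ _ 0 1) => e e0; exists 1 => // h _.
by rewrite /= mul1r mul0r add0r [_ + h.2]addrC addrK subrr cabs0 mulr_ge0 ?maxnorm_ge0// ltW.
Qed.

Lemma differentiable_prod f p : differentiable (fun q => (f q).1) p ->
  differentiable (fun q => (f q).2) p -> differentiable f p.
Proof.
move=> d1 d2; have -> : f = (fun q => ((f q).1, (f q).2)).
  by apply/funext => q; case: (f q).
exact: differentiable_pair.
Qed.

Lemma differentiable_id2 p : differentiable (fun q : C2 R => q) p.
Proof.
apply: differentiable_prod.
  apply: (@has_deriv2_differentiable _ _ _ 1 0) => e e0; exists 1 => // h _.
  by rewrite /= mul1r mul0r addr0 [_ + h.1]addrC addrK subrr cabs0 mulr_ge0 ?maxnorm_ge0// ltW.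
apply: (@has_deriv2_differentiable _ _ _ 0 1) => e e0; exists 1 => // h _.
by rewrite /= mul1r mul0r add0r [_ + h.2]addrC addrK subrr cabs0 mulr_ge0 ?maxnorm_ge0// ltW.
Qed.

Lemma has_deriv2_local (f g : C2 R -> C R) p a b (r : R) : 0 < r ->
  (forall q, maxnorm (q - p) < r -> f q = g q) -> has_deriv2 f p a b -> has_deriv2 g p a b.
Proof.
move=> r0 fg H e e0; have [r1 r10 h1] := H e e0.
exists (Num.min r r1) => [|t]; rewrite lt_min ?r0 ?r10// => /andP[t1 t2].
rewrite -!fg; first exact: h1; last by rewrite [p + t]addrC addrK.
by rewrite subrr maxnorm_0.
Qed.

Lemma differentiable2_local f g p (r : R) : 0 < r ->
  (forall q, maxnorm (q - p) < r -> f q = g q) -> differentiable f p -> differentiable g p.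
Proof.
move=> r0 fg df; apply: differentiable_prod.
  have [a [b H]] := differentiable_deriv2 (differentiable_fst df).
  by apply: has_deriv2_differentiable (has_deriv2_local r0 _ H) => q /fg ->.
have [a [b H]] := differentiable_deriv2 (differentiable_snd df).
by apply: has_deriv2_differentiable (has_deriv2_local r0 _ H) => q /fg ->.
Qed.

Lemma differentiable2_limit (fs : nat -> C2 R -> C2 R) f p (rho : R) :
  0 < rho ->
  (forall n q, maxnorm (q - p) < rho -> differentiable (fs n) q) ->
  (forall e : R, 0 < e -> exists N, forall n, (N <= n)%N -> forall q, maxnorm (q - p) < rho ->
     maxnorm (fs n q - f q) <= e) ->
  differentiable f p.
Proof.
move=> rho0 fd fu; apply: differentiable_prod.
  apply: (@differentiable_uniform_limit _ (fun n q => (fs n q).1) _ _ rho rho0).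
    by move=> n q /(fd n) /differentiable_fst.
  move=> e /fu [N hN]; exists N => n hn q hq.
  exact: le_trans (cabs_fst (fs n q - f q)) (hN n hn q hq).
apply: (@differentiable_uniform_limit _ (fun n q => (fs n q).2) _ _ rho rho0).
  by move=> n q /(fd n) /differentiable_snd.
move=> e /fu [N hN]; exists N => n hn q hq.
exact: le_trans (cabs_snd (fs n q - f q)) (hN n hn q hq).
Qed.

Lemma differentiable2_eps f p : differentiable f p -> forall e : R, 0 < e ->
  exists2 r : R, 0 < r & forall q, maxnorm (q - p) < r -> maxnorm (f q - f p) < e.
Proof.
move=> /differentiable_continuous cf e e0.
have : nbhs (f p) [set q | maxnorm (q - f p) < e] by apply/nbhsC2P; exists e.
by move/cf => /nbhsC2P [r r0 hr]; exists r.
Qed.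

Lemma complex2_cauchy (u : nat -> C2 R) :
  (forall e : R, 0 < e -> exists N, forall n m, (N <= n)%N -> (N <= m)%N -> maxnorm (u n - u m) <= e) ->
  exists l, forall e : R, 0 < e -> exists N, forall n, (N <= n)%N -> maxnorm (u n - l) <= e.
Proof.
move=> H.
have [|a ha] := @complex_cauchy _ (fun n => (u n).1).
  move=> e /H [N hN]; exists N => n m hn hm.
  exact: le_trans (cabs_fst (u n - u m)) (hN _ _ hn hm).
have [|b hb] := @complex_cauchy _ (fun n => (u n).2).
  move=> e /H [N hN]; exists N => n m hn hm.
  exact: le_trans (cabs_snd (u n - u m)) (hN _ _ hn hm).
exists (a, b) => e e0; have [N1 h1] := ha e e0; have [N2 h2] := hb e e0.
exists (maxn N1 N2) => n; rewrite geq_max => /andP[n1 n2'].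
by rewrite maxnorm_le /=; apply/andP; split; [exact: h1|exact: h2].
Qed.

(** The displacement f - id is bounded by eta, so the Cauchy estimate makes it
    Lipschitz with constant O(eta / d). *)
Lemma near_id_lip f q0 (d eta : R) : 0 < d ->
  (forall q, maxnorm (q - q0) < d -> differentiable f q) ->
  (forall q, maxnorm (q - q0) < d -> maxnorm (f q - q) <= eta) ->
  forall p q, maxnorm (p - q0) < d / 32 -> maxnorm (q - q0) < d / 32 ->
  maxnorm ((f q - q) - (f p - p)) <= 32 * eta / d * maxnorm (q - p).
Proof.
move=> d0 fd fe p q hp hq.
have d2 : 0 < d / 2 by lra.
have -> : 32 * eta / d = 16 * eta / (d / 2) by field; exact: lt0r_neq0.
have pb z : maxnorm (z - p) < d / 2 -> maxnorm (z - q0) < d.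
  by move=> hz; apply: le_lt_trans (maxnorm_tri z p q0) _; lra.
have qp : maxnorm (q - p) < d / 2 / 8.
  by apply: le_lt_trans (maxnorm_tri q q0 p) _; rewrite (maxnormC q0); lra.
have de z : maxnorm (z - p) < d / 2 -> differentiable (fun z => f z - z) z.
  move=> hz; apply: (@differentiableB _ _ _ f (fun z => z)).
    by apply: fd; exact: pb.
  exact: differentiable_id2.
rewrite maxnorm_le; apply/andP; split.
  apply: (@cauchy_lipschitz2 _ (fun z => (f z - z).1) p (d / 2) eta d2 _ _ q qp).
    by move=> z hz; apply: differentiable_fst; exact: de.
  by move=> z hz; apply: le_trans (cabs_fst _) (fe _ (pb _ hz)).
apply: (@cauchy_lipschitz2 _ (fun z => (f z - z).2) p (d / 2) eta d2 _ _ q qp).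
  by move=> z hz; apply: differentiable_snd; exact: de.
by move=> z hz; apply: le_trans (cabs_snd _) (fe _ (pb _ hz)).
Qed.

Lemma near_id_half f q0 (d eta : R) : 0 < d -> eta <= d / 256 ->
  (forall q, maxnorm (q - q0) < d -> differentiable f q) ->
  (forall q, maxnorm (q - q0) < d -> maxnorm (f q - q) <= eta) ->
  forall p q, maxnorm (p - q0) < d / 32 -> maxnorm (q - q0) < d / 32 ->
  maxnorm ((f q - q) - (f p - p)) <= 1 / 2 * maxnorm (q - p).
Proof.
move=> d0 he fd fe p q hp hq.
apply: le_trans (near_id_lip d0 fd fe hp hq) _.
by rewrite ler_wpM2r ?maxnorm_ge0// ler_pdivrMr//; lra.
Qed.

Lemma near_id_inj f q0 (d eta : R) : 0 < d -> eta <= d / 256 ->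
  (forall q, maxnorm (q - q0) < d -> differentiable f q) ->
  (forall q, maxnorm (q - q0) < d -> maxnorm (f q - q) <= eta) ->
  forall p q, maxnorm (p - q0) < d / 32 -> maxnorm (q - q0) < d / 32 -> f p = f q -> p = q.
Proof.
move=> d0 he fd fe p q hp hq fpq.
have := near_id_half d0 he fd fe hp hq; rewrite fpq.
have -> : f q - q - (f q - p) = p - q by c2ring.
rewrite maxnormC => H; apply/eqP; rewrite eq_sym -subr_eq0; apply/eqP; apply: maxnorm_eq0.
by apply/le_anti; rewrite maxnorm_ge0 andbT; lra.
Qed.

(** The equation f x = q is the fixed point equation x = q - (f x - x) of a
    contraction.  Its iterates are holomorphic in q and converge uniformly, hence
    so is the solution. *)
Lemma near_id_inverse f q0 (d eta : R) : 0 < d -> eta <= d / 256 ->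
  (forall q, maxnorm (q - q0) < d -> differentiable f q) ->
  (forall q, maxnorm (q - q0) < d -> maxnorm (f q - q) <= eta) ->
  exists S : C2 R -> C2 R, forall q, maxnorm (q - q0) < d / 128 ->
    [/\ differentiable S q, maxnorm (S q - q0) < d / 32 & f (S q) = q].
Proof.
move=> d0 he fd fe.
have half := near_id_half d0 he fd fe.
have eta0 : 0 <= eta.
  by apply: le_trans (maxnorm_ge0 _) (fe q0 _); rewrite subrr maxnorm_0.
pose S_ := fix S k q := if k is k'.+1 then q - (f (S k' q) - S k' q) else q.
have Sin k q : maxnorm (q - q0) < d / 128 -> maxnorm (S_ k q - q0) < d / 64.
  move=> hq; elim: k => [|k IH] /=; first by lra.
  have -> : q - (f (S_ k q) - S_ k q) - q0 = (q - q0) - (f (S_ k q) - S_ k q) by rewrite addrAC.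
  apply: le_lt_trans (maxnormD _ _) _; rewrite maxnormN.
  by have := fe (S_ k q) ltac:(lra); lra.
have pos k : 0 <= eta / 2 ^+ k :> R by rewrite divr_ge0// exprn_ge0.
have half2 k : eta / 2 ^+ k.+1 = eta / 2 ^+ k / 2.
  by rewrite exprS; field; rewrite expf_neq0// pnatr_eq0.
have Sstep k q : maxnorm (q - q0) < d / 128 -> maxnorm (S_ k.+1 q - S_ k q) <= eta / 2 ^+ k.
  move=> hq; elim: k => [|k IH].
    have -> : S_ 1%N q - S_ 0%N q = - (f q - q) by rewrite /= addrAC subrr add0r.
    by rewrite maxnormN expr0 divr1; apply: fe; lra.
  have -> : S_ k.+2 q - S_ k.+1 q =
     - ((f (S_ k.+1 q) - S_ k.+1 q) - (f (S_ k q) - S_ k q)).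
    have E j : S_ j.+1 q = q - (f (S_ j q) - S_ j q) by [].
    rewrite (E k.+1) [in LHS](E k); set u := S_ k.+1 q; set v := S_ k q; c2ring.
  rewrite maxnormN half2; have h1 := Sin k.+1 q hq; have h2 := Sin k q hq.
  by apply: le_trans (half _ _ _ _) _; lra.
have Sdist k m q : maxnorm (q - q0) < d / 128 -> maxnorm (S_ (k + m)%N q - S_ k q) <= 2 * (eta / 2 ^+ k) - 2 * (eta / 2 ^+ (k + m)).
  move=> hq; elim: m => [|m IH]; first by rewrite addn0 subrr maxnorm_0 subrr.
  rewrite addnS; apply: le_trans (maxnorm_tri _ (S_ (k + m)%N q) _) _.
  have := Sstep (k + m)%N q hq; rewrite [in X in _ -> X]half2; lra.
have Sd k q : maxnorm (q - q0) < d / 128 -> differentiable (S_ k) q.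
  move=> hq; elim: k => [|k IH]; first exact: differentiable_id2.
  apply: (@differentiableB _ _ _ (fun q => q) (fun q => f (S_ k q) - S_ k q)).
    exact: differentiable_id2.
  apply: (@differentiableB _ _ _ (fun q => f (S_ k q)) (S_ k)); last exact: IH.
  apply: (@differentiable_comp _ _ _ _ (S_ k) f); first exact: IH.
  by apply: fd; have := Sin k q hq; lra.
have small e : 0 < e -> exists K, 2 * (eta / 2 ^+ K) <= e.
  move=> e0; have [K hK] := halves_small eta0 (divr_gt0 e0 (ltr0n R 2)).
  by exists K; lra.
have anti k m : (k <= m)%N -> eta / 2 ^+ m <= eta / 2 ^+ k.
  move=> km; rewrite -(subnKC km); elim: (m - k)%N => [|j IH]; first by rewrite addn0.
  by rewrite addnS half2; have := pos (k + j)%N; lra.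
have lim q : exists s, maxnorm (q - q0) < d / 128 -> forall k, maxnorm (S_ k q - s) <= 2 * (eta / 2 ^+ k).
  have [hq|] := pselect (maxnorm (q - q0) < d / 128); last by exists q.
  have [|s hs] := @complex2_cauchy (fun k => S_ k q).
    move=> e e0; have [K hK] := small _ (divr_gt0 e0 (ltr0n R 2)); exists K => n m hn hm.
    have := Sdist K (n - K)%N q hq; have := Sdist K (m - K)%N q hq; rewrite !subnKC//.
    have := maxnorm_tri (S_ n q) (S_ K q) (S_ m q); rewrite (maxnormC (S_ K q)).
    by have := pos n; have := pos m; lra.
  exists s => _ k; apply/ler_addgt0Pr => e e0; have [N hN] := hs _ e0.
  have := hN (k + N)%N (leq_addl _ _); have := Sdist k N q hq.
  have := maxnorm_tri (S_ k q) (S_ (k + N)%N q) s; rewrite (maxnormC (S_ k q) (S_ (k + N)%N q)).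
  by have := pos (k + N)%N; lra.
have [S hS] := choice lim.
exists S => q hq.
have Sq : maxnorm (S q - q0) < d / 32.
  apply: le_lt_trans (maxnorm_tri _ (S_ 0%N q) _) _; rewrite maxnormC.
  by have := hS q hq 0%N; have := Sin 0%N q hq; rewrite expr0 divr1; lra.
split; [|exact: Sq|].
  apply: (@differentiable2_limit S_ S q (d / 128 - maxnorm (q - q0))); first by lra.
    move=> n z hz; apply: Sd; have := maxnorm_tri z q q0; lra.
  move=> e e0; have [K hK] := small _ e0; exists K => n hn z hz.
  have hz' : maxnorm (z - q0) < d / 128 by have := maxnorm_tri z q q0; lra.
  by apply: le_trans (hS z hz' n) _; have := anti _ _ hn; lra.
apply/eqP; rewrite -subr_eq0; apply/eqP; apply: maxnorm_eq0; apply/le_anti; rewrite maxnorm_ge0 andbT.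
apply/ler_addgt0Pr => e e0; rewrite add0r.
have [K hK] := small _ (divr_gt0 e0 (ltr0n R 2)).
have E : f (S q) - q = ((f (S q) - S q) - (f (S_ K q) - S_ K q)) + (S q - S_ K.+1 q).
  have -> : S_ K.+1 q = q - (f (S_ K q) - S_ K q) by [].
  by set u := S q; set v := S_ K q; c2ring.
rewrite E; apply: le_trans (maxnormD _ _) _.
have := half (S_ K q) (S q) ltac:(have := Sin K q hq; lra) Sq.
have := hS q hq K; have := hS q hq K.+1; rewrite (maxnormC (S q)) (maxnormC (S q)).
by have := anti K K.+1 (leqnSn K); lra.
Qed.

End NearIdentity.

(** * One step of the perturbed normal form *)

Section OneStep.
Variable R : realType.

(** This is where beta (l + 1) >= 4 is used: (|u|^beta)^(l + 1) <= |u|^4. *)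
Lemma powR_estimate (s b : R) (l : nat) : 0 < s -> s <= 1 -> 4 <= b * l.+1%:R ->
  (s `^ b) ^+ l.+1 <= s ^+ 4.
Proof.
move=> s0 s1 hb; rewrite -(powR_mulrn l.+1 (powR_ge0 s b)) -powRrM -(powR_mulrn 4 (ltW s0)).
by apply: ger_powR => //; rewrite s0.
Qed.

(** The product of one coordinate with the error of the other is at most
    X (K X^l) <= K s^4, hence of order u^4.  For the second coordinate, e2 / w is
    (z e2) / u, of order u^3. *)
Lemma normal_form_step (la z w e1 e2 : C R) (X K s : R) (l : nat) :
  cabs la = 1 -> (0 < l)%N -> 1 <= K -> s = cabs (z * w) -> 0 < s -> s <= 1 ->
  X <= 1 -> X ^+ l.+1 <= s ^+ 4 -> cabs z <= X -> cabs w <= X ->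
  cabs e1 <= K * X ^+ l -> cabs e2 <= K * X ^+ l ->
  let u := z * w in
  let z1 := la * z * (1 - u / 2) + e1 in
  let w1 := la^-1 * w * (1 - u / 2) + e2 in
  exists k1 k2 : C R, [/\ cabs k1 <= 4 * K ^+ 2, cabs k2 <= 4 * K ^+ 2,
    z1 * w1 = u * (1 - u + u ^+ 2 / 4 + u ^+ 3 * k1) &
    w1 = la^-1 * w * (1 - u / 2 + u ^+ 3 * k2)].
Proof.
move=> la1 l0 K1 sE s0 s1 X1 XS zX wX e1X e2X u z1 w1.
have X0 : 0 <= X by apply: le_trans (cabs_ge0 _) zX.
have u0 : u != 0 by rewrite -cabs_gt0 -sE.
have la0 : la != 0 by rewrite -cabs_gt0 la1.
have w0 : w != 0 by apply: contra_neq u0 => w0; rewrite /u w0 mulr0.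
have z0 : z != 0 by apply: contra_neq u0 => z0; rewrite /u z0 mul0r.
have cla : cabs la^-1 = 1 by rewrite cabsV la1 invr1.
have Xl0 : 0 <= X ^+ l by rewrite exprn_ge0.
have prodX (a b : C R) : cabs a <= X -> cabs b <= K * X ^+ l -> cabs (a * b) <= K * s ^+ 4.
  move=> ha hb; rewrite cabsM.
  apply: le_trans (_ : X * (K * X ^+ l) <= _).
    by apply: ler_pM; rewrite ?cabs_ge0.
  rewrite mulrCA -exprS; apply: ler_wpM2l => //; lra.
have ze2 := prodX _ _ zX e2X; have we1 := prodX _ _ wX e1X.
have ee : cabs (e1 * e2) <= K ^+ 2 * s ^+ 4.
  rewrite cabsM; apply: le_trans (_ : (K * X ^+ l) * (K * X ^+ l) <= _).
    by apply: ler_pM; rewrite ?cabs_ge0.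
  have -> : K * X ^+ l * (K * X ^+ l) = K ^+ 2 * X ^+ (l + l) by rewrite exprD; ring.
  rewrite ler_wpM2l ?sqr_ge0//; apply: le_trans XS.
  by apply: ler_wiXn2l => //; rewrite -addn1 leq_add2l.
have s4 : 0 < s ^+ 4 by rewrite exprn_gt0.
have cu : cabs u = s by rewrite sE.
have h2 : cabs (1 - u / 2) <= 3 / 2.
  apply: le_trans (cabsB _ _) _; rewrite cabs1 cabsM cu cabsV.
  have -> : cabs (2 : C R) = 2 by rewrite -(rc_nat R 2) cabs_rc ger0_norm.
  by lra.
have K2 : K <= K ^+ 2 by rewrite expr2; nra.
exists ((la * z * (1 - u / 2) * e2 + la^-1 * w * (1 - u / 2) * e1 + e1 * e2) / u ^+ 4).
exists (la * (z * e2) / u ^+ 4).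
have u4 : u ^+ 4 != 0 by rewrite expf_neq0.
have two : (2 : C R) != 0 by rewrite pnatr_eq0.
split.
- rewrite cabsM cabsV cabsX cu ler_pdivrMr//.
  have t1 : cabs (la * z * (1 - u / 2) * e2) <= 3 / 2 * (K * s ^+ 4).
    have -> : la * z * (1 - u / 2) * e2 = la * (1 - u / 2) * (z * e2) by ring.
    rewrite cabsM; apply: ler_pM; rewrite ?cabs_ge0//.
    by rewrite cabsM la1 mul1r.
  have t2 : cabs (la^-1 * w * (1 - u / 2) * e1) <= 3 / 2 * (K * s ^+ 4).
    have -> : la^-1 * w * (1 - u / 2) * e1 = la^-1 * (1 - u / 2) * (w * e1) by ring.
    rewrite cabsM; apply: ler_pM; rewrite ?cabs_ge0//.
    by rewrite cabsM cla mul1r.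
  apply: le_trans (cabsD _ _) _; apply: le_trans (lerD (cabsD _ _) (lexx _)) _.
  by nra.
- rewrite cabsM cabsV cabsX cu ler_pdivrMr// cabsM la1 mul1r.
  by apply: le_trans ze2 _; nra.
- rewrite /z1 /w1 /u; field.
  by rewrite la0 z0 w0.
- rewrite /w1 /u; field.
  by rewrite la0 z0 w0.
Qed.

(** Expand 1 / (1 - u + u^2 / 4 + k u^3) to second order: the terms of order u and
    u^2 are 1 and 3/4 times the respective power, and the rest is divisible
    by u^3. *)
Lemma inverse_step (u k : C R) (s K : R) : u != 0 -> cabs u = s -> s <= 1 / 8 ->
  1 <= K -> K * s <= 1 -> cabs k <= K ->
  let u1 := u * (1 - u + u ^+ 2 / 4 + u ^+ 3 * k) in
  u1 != 0 /\ cabs (u1^-1 - (u^-1 + 1 + 3 / 4 * u)) <= 6 * K * s ^+ 2.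
Proof.
move=> u0 cu s8 K1 Ks kK u1.
have s0 : 0 < s by rewrite -cu cabs_gt0.
pose D := 1 - u + u ^+ 2 / 4 + u ^+ 3 * k.
have nat_c n : cabs (n%:R : C R) = n%:R by rewrite -(rc_nat R n) cabs_rc ger0_norm.
have cM2 : cabs (u ^+ 2 / 4) = s ^+ 2 / 4.
  by rewrite cabsM cabsV cabsX nat_c cu.
have cM3 : cabs (u ^+ 3 * k) = s ^+ 3 * cabs k.
  by rewrite cabsM cabsX cu.
have D1 : cabs (D - 1) <= 1 / 2.
  have -> : D - 1 = - u + u ^+ 2 / 4 + u ^+ 3 * k by rewrite /D; ring.
  apply: le_trans (cabsD _ _) _; apply: le_trans (lerD (cabsD _ _) (lexx _)) _.
  rewrite cabsN cM2 cM3 cu.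
  have : s ^+ 3 * cabs k <= s ^+ 2.
    have -> : s ^+ 3 * cabs k = s ^+ 2 * (s * cabs k) by ring.
    rewrite -[X in _ <= X]mulr1 ler_wpM2l ?sqr_ge0//; nra.
  rewrite !expr2; nra.
have Dh : 1 / 2 <= cabs D.
  have := cabs_le_dist (1 : C R) (1 - D); rewrite cabs1.
  have -> : 1 - (1 - D) = D by ring.
  by rewrite cabsC; lra.
have D0 : D != 0 by rewrite -cabs_gt0; lra.
have u1E : u1 = u * D by [].
split; first by rewrite u1E mulf_neq0.
have two : (4 : C R) != 0 by rewrite pnatr_eq0.
have -> : u1^-1 - (u^-1 + 1 + 3 / 4 * u) =
   D^-1 * (u ^+ 2 * (1 / 2 - 3 / 16 * u - (1 + u + 3 / 4 * u ^+ 2) * k)).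
  have gen (E : C R) : E != 0 -> (u * E)^-1 - (u^-1 + 1 + 3 / 4 * u) =
      E^-1 * (u^-1 * (1 - (1 + u + 3 / 4 * u ^+ 2) * E)).
    by move=> E0; field; rewrite ?pnatr_eq0 ?u0 ?E0.
  rewrite u1E gen//; congr (_ * _); rewrite /D; field.
  by rewrite ?pnatr_eq0 ?u0.
rewrite 2!cabsM cabsV cabsX cu.
have Di : (cabs D)^-1 <= 2.
  by rewrite -[2]invrK lef_pV2 ?posrE ?invr_gt0//; lra.
have B : cabs (1 / 2 - 3 / 16 * u - (1 + u + 3 / 4 * u ^+ 2) * k) <= 3 * K.
  apply: le_trans (cabsB _ _) _; apply: le_trans (lerD (cabsB _ _) (lexx _)) _.
  have -> : cabs ((1 + u + 3 / 4 * u ^+ 2) * k) = cabs (1 + u + 3 / 4 * u ^+ 2) * cabs k by exact: cabsM.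
  have -> : cabs (1 / 2) = 1 / 2 :> R by rewrite cabsM cabsV cabs1 nat_c.
  have -> : cabs (3 / 16 * u) = 3 / 16 * s by rewrite 2!cabsM cabsV !nat_c cu.
  have H : cabs (1 + u + 3 / 4 * u ^+ 2) <= 3 / 2.
    apply: le_trans (cabsD _ _) _; apply: le_trans (lerD (cabsD _ _) (lexx _)) _.
    have -> : cabs (3 / 4 * u ^+ 2) = 3 / 4 * s ^+ 2 by rewrite 2!cabsM cabsX cabsV !nat_c cu.
    rewrite cabs1 cu !expr2; nra.
  have : cabs (1 + u + 3 / 4 * u ^+ 2) * cabs k <= 3 / 2 * K.
    by apply: ler_pM; rewrite ?cabs_ge0.
  lra.
have -> : 6 * K * s ^+ 2 = 2 * (s ^+ 2 * (3 * K)) by ring.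
apply: ler_pM; [by rewrite invr_ge0 cabs_ge0|by apply: mulr_ge0; rewrite ?sqr_ge0 ?cabs_ge0|exact: Di|].
by rewrite ler_wpM2l ?sqr_ge0.
Qed.

(** The orbit of 1 under U -> U + 1 + 3 / (4 U), the principal part of F in the
    coordinate U = 1 / (z w).  Measuring U against it removes the drift and the
    logarithmic term at once. *)
Fixpoint model_orbit (n : nat) : R := if n is m.+1 then model_orbit m + 1 + 3 / 4 / model_orbit m else 1.

Lemma model_orbit_ge n : n.+1%:R <= model_orbit n.
Proof.
elim: n => [|n IH] //=; rewrite -natr1.
have : 0 <= 3 / 4 / model_orbit n by rewrite divr_ge0//; have := ler0n R n.+1; lra.
by lra.
Qed.
Lemma model_orbit_ge1 n : 1 <= model_orbit n.
Proof. by apply: le_trans (model_orbit_ge n); rewrite ler1n. Qed.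

(** The growth of sqrt(a_n) in one step, which is to compensate the factor
    1 - u / 2 by which |w| is multiplied. *)
Lemma sqrt_ratio (a : R) : 1 <= a ->
  1 + 1 / 2 / a <= Num.sqrt ((a + 1 + 3 / 4 / a) / a) <= 1 + 1 / 2 / a + 1 / 2 / a ^+ 2.
Proof.
move=> a1; have a0 : 0 < a by lra.
pose v := a^-1; have v0 : 0 < v by rewrite invr_gt0.
have v2 : 0 < v ^+ 2 by rewrite exprn_gt0.
have E : (a + 1 + 3 / 4 / a) / a = 1 + v + 3 / 4 * v ^+ 2 by rewrite /v; field; lra.
have E2 : 1 / 2 / a ^+ 2 = 1 / 2 * v ^+ 2 by rewrite /v; field; lra.
rewrite E E2 -/v; apply/andP; split.
  rewrite -[X in X <= _]ger0_norm; last by lra.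
  rewrite -sqrtr_sqr ler_wsqrtr// !expr2; rewrite expr2 in v2; nra.
rewrite -[X in _ <= X]ger0_norm; last by lra.
rewrite -sqrtr_sqr ler_wsqrtr//.
have : 0 < v ^+ 3 by rewrite exprn_gt0.
have : 0 < v ^+ 4 by rewrite exprn_gt0.
have -> : (1 + 1 / 2 * v + 1 / 2 * v ^+ 2) ^+ 2 = 1 + v + 5 / 4 * v ^+ 2 + 1 / 2 * v ^+ 3 + 1 / 4 * v ^+ 4 by field.
by lra.
Qed.

(** The increment of x = U - a is 3/4 (u - 1 / a) up to O(u^2), and
    u - 1 / a = - x u / a is itself of order |x| / a^2. *)
Lemma first_coord_step (u k : C R) (a K : R) : u != 0 -> 1 <= a -> cabs u <= 4 / a ->
  cabs u <= 1 / 8 -> 1 <= K -> K * cabs u <= 1 -> cabs k <= K ->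
  let u1 := u * (1 - u + u ^+ 2 / 4 + u ^+ 3 * k) in
  let x := u^-1 - rc a in
  is_true (cabs (u1^-1 - rc (a + 1 + 3 / 4 / a) - x) <= 200 * K * (1 + cabs x) / a ^+ 2).
Proof.
move=> u0 a1 ua u8 K1 Ku kK u1 x.
have a0 : 0 < a by lra.
have [u10 H] := inverse_step u0 (erefl _) u8 K1 Ku kK; rewrite -/u1 in u10 H.
have rca : rc a != 0 by rewrite rc_eq0 lt0r_neq0.
pose s := cabs u; rewrite -/s in H ua; clearbody u1.
have s0 : 0 < s by rewrite cabs_gt0.
have aE : rc (a + 1 + 3 / 4 / a) = rc a + 1 + 3 / 4 / rc a.
  by rewrite !rcD rc1 !rcM !rcV !rc_nat.
have -> : u1^-1 - rc (a + 1 + 3 / 4 / a) - x =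
   (u1^-1 - (u^-1 + 1 + 3 / 4 * u)) - 3 / 4 * (x * u / rc a).
  rewrite aE /x; field.
  by rewrite ?pnatr_eq0 ?rca ?u0 ?u10.
apply: le_trans (cabsB _ _) _.
have nat_c n : cabs (n%:R : C R) = n%:R by rewrite -(rc_nat R n) cabs_rc ger0_norm.
rewrite !cabsM !cabsV !nat_c cabs_rc gtr0_norm// -/s.
have x0 := cabs_ge0 x.
have sa : s * a <= 4 by rewrite -ler_pdivlMr.
have a2 : 0 < a ^+ 2 by rewrite exprn_gt0.
rewrite ler_pdivlMr// mulrDl.
have E1 : cabs (u1^-1 - (u^-1 + 1 + 3 / 4 * u)) * a ^+ 2 <= 96 * K.
  apply: le_trans (_ : 6 * K * s ^+ 2 * a ^+ 2 <= _).
    by rewrite ler_wpM2r// ltW.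
  have -> : 6 * K * s ^+ 2 * a ^+ 2 = 6 * K * (s * a) ^+ 2 by ring.
  have : (s * a) ^+ 2 <= 4 ^+ 2.
    by apply: lerXn2r; rewrite ?nnegrE// ?mulr_ge0// ltW.
  by nra.
have -> : 3 / 4 * (cabs x * s / a) * a ^+ 2 = 3 / 4 * (cabs x * (s * a)) by field; lra.
have : cabs x * (s * a) <= cabs x * 4 by rewrite ler_wpM2l.
have : 0 <= K * cabs x by rewrite mulr_ge0//; lra.
by nra.
Qed.

(** The factors 1 + 1 / (2 a) and 1 - u / 2 are inverse to each other up to
    O(1 / a^2), as u is 1 / a up to O(|x| / a^2). *)
Lemma second_coord_step (u k : C R) (a K : R) : u != 0 -> 1 <= a -> cabs u <= 4 / a ->
  1 <= K -> cabs k <= K ->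
  let x := u^-1 - rc a in
  is_true (cabs (rc (Num.sqrt ((a + 1 + 3 / 4 / a) / a)) * (1 - u / 2 + u ^+ 3 * k) - 1)
    <= 200 * K * (1 + cabs x) / a ^+ 2).
Proof.
move=> u0 a1 ua K1 kK x; have a0 : 0 < a by lra.
have rca : rc a != 0 by rewrite rc_eq0 lt0r_neq0.
set tau := Num.sqrt _; have /andP[t1 t2] := sqrt_ratio a1; rewrite -/tau in t1 t2.
pose th := tau - (1 + 1 / 2 / a).
have th0 : 0 <= th by rewrite /th; lra.
have thE : th * a ^+ 2 <= 1 / 2.
  have : th <= 1 / 2 / a ^+ 2 by rewrite /th; lra.
  by rewrite ler_pdivlMr// exprn_gt0.
pose s := cabs u; rewrite -/s in ua.
have s0 : 0 < s by rewrite cabs_gt0.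
have sa : s * a <= 4 by rewrite -ler_pdivlMr.
have x0 := cabs_ge0 x.
have a2 : 0 < a ^+ 2 by rewrite exprn_gt0.
have ia : 0 < a^-1 <= 1 by rewrite invr_gt0 a0 invf_le1.
have nat_c n : cabs (n%:R : C R) = n%:R by rewrite -(rc_nat R n) cabs_rc ger0_norm.
have tauE : rc tau = 1 + 1 / 2 / rc a + rc th.
  by rewrite /th !rcB !rcD !rc1 !rcM !rcV !rc_nat rc1; ring.
have -> : rc tau * (1 - u / 2 + u ^+ 3 * k) - 1 =
  - (1 / 4 / rc a ^+ 2) + rc th * (1 - 1 / 2 / rc a)
   + rc tau * (x * u / rc a / 2 + u ^+ 3 * k).
  rewrite tauE /x; field.
  by rewrite ?pnatr_eq0 ?rca ?u0.
rewrite ler_pdivlMr//.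
have T1 : cabs (- (1 / 4 / rc a ^+ 2)) * a ^+ 2 <= 1.
  rewrite cabsN !cabsM !cabsV cabsX cabs1 nat_c cabs_rc gtr0_norm//.
  by rewrite mul1r divfK ?lt0r_neq0//; lra.
have T2 : cabs (rc th * (1 - 1 / 2 / rc a)) * a ^+ 2 <= 1.
  rewrite cabsM cabs_rc ger0_norm//.
  have H : cabs (1 - 1 / 2 / rc a) <= 3 / 2.
    apply: le_trans (cabsB _ _) _.
    rewrite !cabsM !cabsV cabs1 nat_c cabs_rc gtr0_norm//.
    by case/andP: ia => ia0 ia1; lra.
  rewrite mulrAC; have := cabs_ge0 (1 - 1 / 2 / rc a).
  have : 0 <= th * a ^+ 2 by rewrite mulr_ge0// ltW.
  by nra.
have tau2 : tau <= 2.
  apply: le_trans t2 _; have : 1 / 2 / a ^+ 2 <= 1 / 2.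
    rewrite ler_pdivrMr// ler_peMr//; last by rewrite exprn_ege1.
    by lra.
have tau0 : 0 <= tau by rewrite sqrtr_ge0.
have T3 : cabs (x * u / rc a / 2 + u ^+ 3 * k) * a ^+ 2 <= 2 * cabs x + 64 * K.
  apply: le_trans (_ : (cabs (x * u / rc a / 2) + cabs (u ^+ 3 * k)) * a ^+ 2 <= _).
    by rewrite ler_wpM2r ?cabsD// ltW.
  have -> : cabs (u ^+ 3 * k) = s ^+ 3 * cabs k by rewrite cabsM cabsX.
  rewrite !cabsM !cabsV nat_c cabs_rc gtr0_norm// -/s mulrDl; apply: lerD.
    have -> : cabs x * s / a / 2 * a ^+ 2 = cabs x / 2 * (s * a) by field; lra.
    have : cabs x / 2 * (s * a) <= cabs x / 2 * 4 by rewrite ler_wpM2l//; lra.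
    by lra.
  have -> : s ^+ 3 * cabs k * a ^+ 2 = (s * a) ^+ 3 * a^-1 * cabs k by field; lra.
  apply: ler_pM; rewrite ?cabs_ge0//.
    by rewrite mulr_ge0 ?exprn_ge0 ?mulr_ge0 ?invr_ge0// ltW.
  have H : (s * a) ^+ 3 <= 4 ^+ 3.
    by apply: lerXn2r; rewrite ?nnegrE// ?mulr_ge0// ltW.
  have : 0 <= (s * a) ^+ 3 by rewrite exprn_ge0// mulr_ge0// ltW.
  have -> : 64 = 4 ^+ 3 :> R by rewrite !exprS expr0; ring.
  by move: ia => /andP[ia0 ia1]; nra.
apply: le_trans (ler_wpM2r (ltW a2) (cabsD _ _)) _.
rewrite mulrDl; apply: le_trans (lerD (ler_wpM2r (ltW a2) (cabsD _ _)) (lexx _)) _.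
rewrite mulrDl [cabs (rc tau * _)]cabsM cabs_rc ger0_norm// -[_ * cabs _ * a ^+ 2]mulrA.
have T3' := cabs_ge0 (x * u / rc a / 2 + u ^+ 3 * k).
have T4 : tau * (cabs (x * u / rc a / 2 + u ^+ 3 * k) * a ^+ 2) <= 2 * (2 * cabs x + 64 * K).
  apply: ler_pM => //; by rewrite mulr_ge0// ltW.
have : 0 <= K * cabs x by rewrite mulr_ge0//; lra.
by nra.
Qed.

End OneStep.

(** * Rescaled coordinates *)

Section Charts.
Variable R : realType.
Implicit Types (p q : C2 R).
Local Notation a := (model_orbit R).

(** Coordinates depending on the time n, in which the model orbit and the rotation
    and contraction of w are divided out. *)
Definition chart (la : C R) n p : C2 R :=
  ((p.1 * p.2)^-1 - rc (a n), la ^+ n * rc (Num.sqrt (a n)) * p.2).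
Definition unchart_snd (la : C R) n q : C R :=
  (la ^+ n * rc (Num.sqrt (a n)))^-1 * q.2.
Definition unchart (la : C R) n q : C2 R :=
  (((rc (a n) + q.1) * unchart_snd la n q)^-1, unchart_snd la n q).

Lemma cabs1_neq0 (la : C R) : cabs la = 1 -> la != 0.
Proof. by move=> h; rewrite -cabs_gt0 h. Qed.

Lemma model_orbit_gt0 n : 0 < a n.
Proof. by have := @model_orbit_ge1 R n; lra. Qed.

Lemma chart_factor_neq0 (la : C R) n : cabs la = 1 -> la ^+ n * rc (Num.sqrt (a n)) != 0.
Proof.
move=> /cabs1_neq0 la0; apply: mulf_neq0; first exact: expf_neq0.
by rewrite rc_eq0 sqrtr_eq0 -ltNge model_orbit_gt0.
Qed.

Lemma chartK (la : C R) n p : cabs la = 1 -> p.1 * p.2 != 0 -> unchart la n (chart la n p) = p.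
Proof.
move=> la1; rewrite mulf_eq0 negb_or => /andP[p1 p2].
have f0 := chart_factor_neq0 n la1.
have w : unchart_snd la n (chart la n p) = p.2.
  by rewrite /unchart_snd /= mulrA mulVf// mul1r.
apply: c2_ext; rewrite /unchart w //=.
have -> : rc (a n) + ((p.1 * p.2)^-1 - rc (a n)) = (p.1 * p.2)^-1 by ring.
by field; rewrite p1 p2.
Qed.

Lemma unchart_prod (la : C R) n q : cabs la = 1 -> q.2 != 0 ->
  (unchart la n q).1 * (unchart la n q).2 = (rc (a n) + q.1)^-1.
Proof.
move=> la1 q2; have f0 := chart_factor_neq0 n la1; rewrite /unchart /=.
by rewrite invfM divfK// /unchart_snd mulf_neq0// invr_eq0.
Qed.

Lemma unchartK (la : C R) n q : cabs la = 1 -> q.2 != 0 ->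
  chart la n (unchart la n q) = q.
Proof.
move=> la1 q2; have f0 := chart_factor_neq0 n la1.
apply: c2_ext; rewrite /chart unchart_prod//=.
  by rewrite invrK; ring.
by rewrite /unchart_snd mulrA mulfV// mul1r.
Qed.

Lemma expansion_real (la : C R) (F : C2 R -> C2 R) l :
  (fun p => F p - F_N la p) =O_ (0 : C2 R) (fun p => `|p| ^+ l) ->
  exists rho K : R, [/\ 0 < rho, 1 <= K &
    forall p, maxnorm p < rho -> maxnorm (F p - F_N la p) <= K * maxnorm p ^+ l].
Proof.
move=> /eqO_exP [k /posC [K K0 ->]] /nbhsC2P [rho rho0 h].
exists rho, (K + 1); split => //; first by lra.
move=> p hp; have := h p; rewrite subr0 => /(_ hp).
rewrite !maxnormE.
have -> : rc (maxnorm p) ^+ l = rc (maxnorm p ^+ l) by rewrite /rc rmorphXn.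
have n0 : 0 <= maxnorm p ^+ l by rewrite exprn_ge0// maxnorm_ge0.
rewrite normE cabs_rc ger0_norm// -rcM rc_le => H.
by apply: le_trans H _; rewrite ler_wpM2r//; lra.
Qed.

Lemma conj_inv (la : C R) : cabs la = 1 -> la^* = la^-1.
Proof.
move=> la1; have la0 := cabs1_neq0 la1.
have : `|la| ^+ 2 = la * la^* by exact: normCK.
rewrite normE la1 rc1 expr1n => E.
by apply: (mulfI la0); rewrite -E mulfV.
Qed.

Lemma relative_form (la : C R) (F : C2 R -> C2 R) l (beta rho0 K : R) :
  cabs la = 1 -> (0 < l)%N -> 0 < beta -> 4 <= beta * l.+1%:R -> 0 < rho0 -> 1 <= K ->
  (forall p, maxnorm p < rho0 -> maxnorm (F p - F_N la p) <= K * maxnorm p ^+ l) ->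
  forall p, maxnorm p < rho0 -> maxnorm p <= 1 -> W_set beta p -> p.1 * p.2 != 0 ->
  let u := p.1 * p.2 in
  exists k1 k2 : C R, [/\ cabs k1 <= 4 * K ^+ 2, cabs k2 <= 4 * K ^+ 2,
    (F p).1 * (F p).2 = u * (1 - u + u ^+ 2 / 4 + u ^+ 3 * k1) &
    (F p).2 = la^-1 * p.2 * (1 - u / 2 + u ^+ 3 * k2)].
Proof.
move=> la1 l0 b0 bl r0 K1 hF p pr p1 [W1 W2] u0 u.
pose s := cabs u; pose X := s `^ beta.
have s0 : 0 < s by rewrite cabs_gt0.
have s1 : s <= 1.
  rewrite /s /u cabsM; have := cabs_fst p; have := cabs_snd p.
  have := cabs_ge0 p.1; have := cabs_ge0 p.2 => c2 c1 d2 d1.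
  have : cabs p.1 * cabs p.2 <= 1 * 1 by apply: ler_pM => //; lra.
  by rewrite mulr1.
have X1 : X <= 1.
  by rewrite /X -[X in _ <= X](powRr0 s); apply: ger_powR; rewrite ?s0//=; exact: ltW.
have XS := powR_estimate s0 s1 bl.
have pX : maxnorm p <= X by rewrite maxnorm_le; apply/andP; split; apply: ltW.
have eX : maxnorm (F p - F_N la p) <= K * X ^+ l.
  apply: le_trans (hF p pr) _; rewrite ler_wpM2l//; first by lra.
  by apply: lerXn2r; rewrite ?nnegrE ?maxnorm_ge0//; apply: le_trans (maxnorm_ge0 p) pX.
have := @normal_form_step R la p.1 p.2 (F p - F_N la p).1 (F p - F_N la p).2 X K s l
  la1 l0 K1 (erefl _) s0 s1 X1 XS (ltW W1) (ltW W2)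
  (le_trans (cabs_fst _) eX) (le_trans (cabs_snd _) eX).
lazy zeta; rewrite -(conj_inv la1).
have -> : la * p.1 * (1 - p.1 * p.2 / 2) + (F p - F_N la p).1 = (F p).1.
  by rewrite /F_N /= addrC subrK.
have -> : la^* * p.2 * (1 - p.1 * p.2 / 2) + (F p - F_N la p).2 = (F p).2.
  by rewrite /F_N /= addrC subrK.
by [].
Qed.

(** The first statement says that orbits in the region move to the right at speed
    at least 3/4; it yields the lower bound on |U| under which the second statement
    applies.  There the displacement in the rescaled coordinates is of order
    1 / n^2. *)
Lemma chart_step (la : C R) (F : C2 R -> C2 R) l (beta : R) :
  cabs la = 1 -> (0 < l)%N -> 0 < beta -> 4 <= beta * l.+1%:R ->
  (fun p => F p - F_N la p) =O_ (0 : C2 R) (fun p => `|p| ^+ l) ->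
  exists rho c : R, [/\ 0 < rho, 0 <= c &
    forall p, maxnorm p < rho -> W_set beta p -> p.1 * p.2 != 0 ->
    re (p.1 * p.2)^-1 + 3 / 4 <= re ((F p).1 * (F p).2)^-1 /\
    (forall n, a n / 4 <= cabs (p.1 * p.2)^-1 ->
      cabs ((chart la n.+1 (F p)).1 - (chart la n p).1)
        <= c * (1 + cabs (chart la n p).1) / n.+1%:R ^+ 2 /\
      cabs ((chart la n.+1 (F p)).2 - (chart la n p).2)
        <= c * (1 + cabs (chart la n p).1) / n.+1%:R ^+ 2 * cabs (chart la n p).2)].
Proof.
move=> la1 l0 b0 bl /expansion_real [rho0 [K [r0 K1 hF]]].
have la0 := cabs1_neq0 la1.
pose K' := 4 * K ^+ 2; have K'1 : 1 <= K' by rewrite /K' expr2; nra.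
exists (Num.min rho0 (Num.min (1 / 32) (1 / K'))), (200 * K').
split; [|lra|].
  rewrite !lt_min; apply/and3P; split; [exact: r0|by lra|].
  by apply: divr_gt0 => //; lra.
move=> p; rewrite !lt_min => /and3P[p1 p2 p3] pW u0.
have [|k1 [k2 [hk1 hk2 E1 E2]]] := relative_form la1 l0 b0 bl r0 K1 hF p1 _ pW u0; first by lra.
set u := p.1 * p.2 in u0 E1 E2 *.
have s_le : cabs u <= maxnorm p.
  rewrite /u cabsM -[X in _ <= X]mulr1; apply: ler_pM; rewrite ?cabs_ge0 ?cabs_fst//.
  by apply: le_trans (cabs_snd p) _; lra.
have s8 : cabs u <= 1 / 8 by lra.
have Ks : K' * cabs u <= 1.
  by rewrite mulrC -ler_pdivlMr; [lra|lra].
have s0 : 0 < cabs u by rewrite cabs_gt0.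
have [u10 H] := inverse_step u0 (erefl _) s8 K'1 Ks hk1.
split.
  rewrite -/u E1; set U1 := (_ * _)^-1 in H *.
  have := le_trans (re_le_cabs _) H; rewrite reB !reD.
  have -> : re 1 = 1 :> R by [].
  have := re_le_cabs (3 / 4 * u); rewrite cabsM.
  have -> : cabs (3 / 4) = 3 / 4 :> R.
    rewrite cabsM cabsV -(rc_nat R 3) -(rc_nat R 4) !cabs_rc !ger0_norm//.
  rewrite !ler_norml => /andP[g1 g2] /andP[g3 g4].
  have : 6 * K' * cabs u ^+ 2 <= 6 * cabs u.
    by move: Ks s0; clear; rewrite expr2; nra.
  by move: g1 g2 g3 g4 p2 s_le s8; clear; lra.
move=> n hn.
have a1 := @model_orbit_ge1 R n; have a0 := model_orbit_gt0 n.
have ua : cabs u <= 4 / a n.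
  have : a n / 4 * cabs u <= 1 by rewrite -ler_pdivlMr// mul1r -cabsV.
  by rewrite ler_pdivlMr//; lra.
have G1 := first_coord_step u0 a1 ua s8 K'1 Ks hk1.
have G2 := second_coord_step u0 a1 ua K'1 hk2.
have nn : 200 * K' * (1 + cabs (chart la n p).1) / a n ^+ 2 <=
    200 * K' * (1 + cabs (chart la n p).1) / n.+1%:R ^+ 2.
  apply: ler_wpM2l.
    apply: mulr_ge0; first by clear -K'1; lra.
    by rewrite addr_ge0 ?cabs_ge0.
  rewrite lef_pV2 ?posrE ?exprn_gt0// ?ltr0n//.
  by apply: lerXn2r; rewrite ?nnegrE ?ler0n ?(ltW a0)//; exact: model_orbit_ge.
split.
  by apply: le_trans nn; rewrite /chart /= E1; exact: G1.
have y0 : (chart la n.+1 (F p)).2 - (chart la n p).2 =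
   (rc (Num.sqrt ((a n + 1 + 3 / 4 / a n) / a n)) * (1 - u / 2 + u ^+ 3 * k2) - 1) * (chart la n p).2.
  rewrite /chart /= E2 sqrtrM; last first.
    exact: ltW (model_orbit_gt0 n.+1).
  have -> : Num.sqrt (a n)^-1 = (Num.sqrt (a n))^-1 by rewrite sqrtrV// ltW.
  have sq0 : rc (Num.sqrt (a n)) != 0 by rewrite rc_eq0 sqrtr_eq0 -ltNge.
  rewrite rcM rcV exprS; field.
  by rewrite la0 sq0.
rewrite y0 cabsM; apply: ler_wpM2r; first exact: cabs_ge0.
exact: le_trans G2 nn.
Qed.

End Charts.

(** * Sequences with increments of order 1/n^2 *)

Section Sequences.
Variable R : realType.
Local Notation a := (model_orbit R).

Lemma inv_sq_tele (n : nat) : (0 < n)%N ->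
  1 / n.+1%:R ^+ 2 <= 1 / n%:R - 1 / n.+1%:R :> R.
Proof.
move=> n0; have n1 : 0 < n%:R :> R by rewrite ltr0n.
have -> : 1 / n%:R - 1 / n.+1%:R = 1 / (n%:R * n.+1%:R) :> R.
  rewrite -natr1; field; rewrite lt0r_neq0//=; lra.
rewrite ler_pM2l ?ltr01// lef_pV2 ?posrE ?mulr_gt0 ?exprn_gt0 ?ltr0n//.
by rewrite expr2 ler_wpM2r// ?ler_nat ?ler0n.
Qed.

Lemma tele_ge0 N k : (0 < N)%N -> 0 <= 1 / N%:R - 1 / (N + k)%:R :> R.
Proof.
move=> N0; rewrite subr_ge0 !mul1r lef_pV2 ?posrE ?ltr0n ?addn_gt0 ?N0//.
by rewrite ler_nat leq_addr.
Qed.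

Lemma tele_le N k : (0 < N)%N -> 1 / N%:R - 1 / (N + k)%:R <= 1 / N%:R :> R.
Proof. by move=> N0; rewrite gerBl divr_ge0. Qed.

(** With al the tail sum 1/N - 1/n, the bound t n <= t N (1 + 2 c al) propagates
    because c al <= 1/2 throughout. *)
Lemma gronwall (t : nat -> R) (c : R) N : (0 < N)%N -> 0 <= c -> 2 * c <= N%:R ->
  (forall n, (N <= n)%N -> 0 <= t n /\ t n.+1 <= t n * (1 + c / n.+1%:R ^+ 2)) ->
  forall n, (N <= n)%N -> t n <= 2 * t N.
Proof.
move=> N0 c0 cN ht n Nn; rewrite -(subnKC Nn); set k := (n - N)%N; clearbody k.
have cN1 : 2 * c * (1 / N%:R) <= 1 by rewrite mul1r ler_pdivrMr ?mul1r// ltr0n.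
have T0 := (ht N (leqnn _)).1.
suff H : t (N + k)%N <= t N * (1 + 2 * c * (1 / N%:R - 1 / (N + k)%:R)).
  apply: le_trans H _; have := tele_le k N0; have := tele_ge0 k N0 => h1 h2.
  have : 2 * c * (1 / N%:R - 1 / (N + k)%:R) <= 1.
    by apply: le_trans cN1; rewrite ler_wpM2l//; lra.
  by nra.
elim: k => [|k IH]; first by rewrite addn0 subrr mulr0 addr0 mulr1.
rewrite addnS; have [t0 t1] := ht (N + k)%N (leq_addr _ _).
apply: le_trans t1 _.
have nk : (0 < N + k)%N by rewrite addn_gt0 N0.
have := inv_sq_tele nk; have := tele_ge0 k N0; have := tele_le k N0.
set al := 1 / N%:R - 1 / (N + k)%:R in IH *; set be := 1 / (N + k).+1%:R ^+ 2.
move=> h1 h2 h3.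
have be0 : 0 <= be by rewrite divr_ge0// exprn_ge0.
have -> : c / (N + k).+1%:R ^+ 2 = c * be by rewrite /be mul1r.
have -> : 1 / N%:R - 1 / (N + k).+1%:R = al + (1 / (N + k)%:R - 1 / (N + k).+1%:R) by rewrite /al; ring.
set ga := (_ - _) in h3 *.
have al1 : 2 * c * al <= 1 by apply: le_trans cN1; rewrite ler_wpM2l//; lra.
apply: le_trans (ler_wpM2r _ IH) _; first by have := mulr_ge0 c0 be0; lra.
rewrite -[X in X <= _]mulrA; apply: ler_wpM2l => //.
have cb : 0 <= c * be by rewrite mulr_ge0.
have : c * be <= c * ga by rewrite ler_wpM2l.
by nra.
Qed.

Lemma gronwall_low (t : nat -> R) (c : R) N : (0 < N)%N -> 0 <= c -> 2 * c <= N%:R ->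
  (forall n, (N <= n)%N -> 0 <= t n /\ t n * (1 - c / n.+1%:R ^+ 2) <= t n.+1) ->
  forall n, (N <= n)%N -> t N / 2 <= t n.
Proof.
move=> N0 c0 cN ht n Nn; rewrite -(subnKC Nn); set k := (n - N)%N; clearbody k.
have cN1 : 2 * c * (1 / N%:R) <= 1 by rewrite mul1r ler_pdivrMr ?mul1r// ltr0n.
have T0 := (ht N (leqnn _)).1.
suff H : t N * (1 - c * (1 / N%:R - 1 / (N + k)%:R)) <= t (N + k)%N.
  apply: le_trans _ H; have := tele_le k N0; have := tele_ge0 k N0 => h1 h2.
  have : 2 * c * (1 / N%:R - 1 / (N + k)%:R) <= 1.
    by apply: le_trans cN1; rewrite ler_wpM2l//; lra.
  by nra.
elim: k => [|k IH]; first by rewrite addn0 subrr mulr0 subr0 mulr1.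
rewrite addnS; have [t0 t1] := ht (N + k)%N (leq_addr _ _).
apply: le_trans _ t1.
have nk : (0 < N + k)%N by rewrite addn_gt0 N0.
have := inv_sq_tele nk; have := tele_ge0 k N0; have := tele_le k N0.
set al := 1 / N%:R - 1 / (N + k)%:R in IH *; set be := 1 / (N + k).+1%:R ^+ 2.
move=> h1 h2 h3.
have be0 : 0 <= be by rewrite divr_ge0// exprn_ge0.
have -> : c / (N + k).+1%:R ^+ 2 = c * be by rewrite /be mul1r.
have -> : 1 / N%:R - 1 / (N + k).+1%:R = al + (1 / (N + k)%:R - 1 / (N + k).+1%:R) by rewrite /al; ring.
set ga := (_ - _) in h3 *.
have cb : 0 <= c * be by rewrite mulr_ge0.
have cseg_int : c * be <= c * ga by rewrite ler_wpM2l.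
have cg1 : c * (al + ga) <= 1 / 2.
  have -> : al + ga = 1 / N%:R - 1 / (N + k).+1%:R by rewrite /al /ga; ring.
  have := @tele_le N k.+1 N0; rewrite addnS => h4.
  by apply: le_trans (ler_wpM2l c0 h4) _; lra.
have al0 : 0 <= c * al by rewrite mulr_ge0.
apply: le_trans (_ : t N * ((1 - c * al) * (1 - c * be)) <= _).
  by apply: ler_wpM2l => //; have := mulr_ge0 al0 cb; lra.
have cb1 : c * be <= 1 by have : 0 <= c * al := al0; rewrite mulrDr in cg1; lra.
by rewrite mulrA; apply: ler_wpM2r => //; lra.
Qed.

Lemma tele_steps (u : nat -> C2 R) (c : R) N : (0 < N)%N ->
  (forall n, (N <= n)%N -> maxnorm (u n.+1 - u n) <= c / n.+1%:R ^+ 2) -> 0 <= c ->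
  forall k, maxnorm (u (N + k)%N - u N) <= c * (1 / N%:R - 1 / (N + k)%:R).
Proof.
move=> N0 hu c0; elim=> [|k IH]; first by rewrite addn0 !subrr maxnorm_0 mulr0.
rewrite addnS; apply: le_trans (maxnorm_tri _ (u (N + k)%N) _) _.
have nk : (0 < N + k)%N by rewrite addn_gt0 N0.
have h1 := hu (N + k)%N (leq_addr _ _).
have h2 := ler_wpM2l c0 (inv_sq_tele nk).
have h3 : c * (1 / N%:R - 1 / (N + k).+1%:R) =
    c * (1 / (N + k)%:R - 1 / (N + k).+1%:R) + c * (1 / N%:R - 1 / (N + k)%:R) by ring.
by rewrite h3; apply: lerD IH; apply: le_trans h1 _; rewrite -[c / _]mulr1 -mulrA [_ * 1]mulrC.
Qed.

Lemma tele_cauchy (u : nat -> C2 R) (c : R) N : (0 < N)%N -> 0 <= c ->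
  (forall n, (N <= n)%N -> maxnorm (u n.+1 - u n) <= c / n.+1%:R ^+ 2) ->
  exists l, forall e : R, 0 < e -> exists M, forall n, (M <= n)%N -> maxnorm (u n - l) <= e.
Proof.
move=> N0 c0 hu; apply: complex2_cauchy => e e0.
pose M := maxn N (Num.bound (2 * c / e)).
have M0 : (0 < M)%N by rewrite /M leq_max N0.
have MN : (N <= M)%N by exact: leq_maxl.
have cM : 2 * c / M%:R <= e.
  rewrite ler_pdivrMr ?ltr0n// [e * _]mulrC -ler_pdivrMr//.
  have x0 : 0 <= 2 * c / e by rewrite divr_ge0 ?mulr_ge0// ltW.
  apply: le_trans (ltW (archi_boundP x0)) _.
  by rewrite ler_nat leq_maxr.
have H := tele_steps M0 (fun n hn => hu n (leq_trans MN hn)) c0.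
have H1 n : (M <= n)%N -> maxnorm (u n - u M) <= c / M%:R.
  move=> hn; have := H (n - M)%N; rewrite subnKC// => h; apply: le_trans h _.
  have := @tele_le M (n - M) M0; rewrite subnKC// => h'.
  by apply: le_trans (ler_wpM2l c0 h') _; rewrite mul1r.
exists M => n m hn hm; apply: le_trans (maxnorm_tri _ (u M) _) _.
rewrite (maxnormC (u M)); have := H1 n hn; have := H1 m hm; lra.
Qed.

End Sequences.

(** * Convergence of rescaled orbits *)

Section OrbitLimit.
Variable R : realType.
Local Notation a := (model_orbit R).

Lemma large_nat (x : R) : exists N : nat, (0 < N)%N /\ x <= N%:R.
Proof.
exists (Num.bound `|x|).+1; split => //.
apply: le_trans (ler_norm x) _; apply: le_trans (ltW (archi_boundP (normr_ge0 x))) _.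
by rewrite ler_nat.
Qed.

(** First x stays bounded by [gronwall], so the increments of both coordinates are
    O(1 / n^2).  Then |y| is bounded above and, by [gronwall_low], away from 0. *)
Lemma orbit_limit (q : nat -> C2 R) (c : R) N : 0 <= c ->
  (forall n, (N <= n)%N -> (q n).2 != 0) ->
  (forall n, (N <= n)%N ->
    cabs ((q n.+1).1 - (q n).1) <= c * (1 + cabs (q n).1) / n.+1%:R ^+ 2 /\
    cabs ((q n.+1).2 - (q n).2) <= c * (1 + cabs (q n).1) / n.+1%:R ^+ 2 * cabs (q n).2) ->
  exists l : C2 R, l.2 != 0 /\
   forall e : R, 0 < e -> exists M, forall n, (M <= n)%N -> maxnorm (q n - l) <= e.
Proof.
move=> c0 q0 hq.
have sq (n : nat) : 0 < n.+1%:R ^+ 2 :> R by rewrite exprn_gt0// ltr0n.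
have [N1' [N1'0 cN1']] := large_nat (2 * c).
pose N1 := maxn N N1'.
have N10 : (0 < N1)%N by rewrite leq_max N1'0 orbT.
have cN1 : 2 * c <= N1%:R by apply: le_trans cN1' _; rewrite ler_nat leq_maxr.
have NN1 : (N <= N1)%N by exact: leq_maxl.
pose t n := 1 + cabs (q n).1.
have ht n : (N1 <= n)%N -> t n <= 2 * t N1.
  apply: (gronwall N10 c0 cN1) => {}n hn; split.
    by rewrite /t; have := cabs_ge0 (q n).1; lra.
  have [+ _] := hq n (leq_trans NN1 hn); rewrite /t => h.
  have := cabsD ((q n.+1).1 - (q n).1) (q n).1; rewrite subrK => h'.
  have -> : (1 + cabs (q n).1) * (1 + c / n.+1%:R ^+ 2) =
    1 + cabs (q n).1 + c * (1 + cabs (q n).1) / n.+1%:R ^+ 2 by ring.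
  by set D := c * _ / _ in h *; lra.
set T := 2 * t N1 in ht.
have T0 : 0 <= T by rewrite /T /t; have := cabs_ge0 (q N1).1; lra.
pose c1 := c * T; have c10 : 0 <= c1 by rewrite mulr_ge0.
have hq1 n : (N1 <= n)%N -> c * (1 + cabs (q n).1) / n.+1%:R ^+ 2 <= c1 / n.+1%:R ^+ 2.
  move=> hn; apply: ler_wpM2r; first by rewrite invr_ge0 ltW.
  by rewrite /c1 ler_wpM2l//; exact: ht.
have [N2' [N2'0 cN2']] := large_nat (2 * c1).
pose N2 := maxn N1 N2'.
have N20 : (0 < N2)%N by rewrite leq_max N2'0 orbT.
have cN2 : 2 * c1 <= N2%:R by apply: le_trans cN2' _; rewrite ler_nat leq_maxr.
have N12 : (N1 <= N2)%N by exact: leq_maxl.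
have ystep n : (N2 <= n)%N -> cabs ((q n.+1).2 - (q n).2) <= c1 / n.+1%:R ^+ 2 * cabs (q n).2.
  move=> hn; have hn1 := leq_trans N12 hn.
  have [_ h] := hq n (leq_trans NN1 hn1); apply: le_trans h _.
  by apply: ler_wpM2r; [exact: cabs_ge0|exact: hq1].
have yup n : (N2 <= n)%N -> cabs (q n).2 <= 2 * cabs (q N2).2.
  apply: (@gronwall _ (fun n => cabs (q n).2) c1) => // {}n hn; split; first exact: cabs_ge0.
  have := cabsD ((q n.+1).2 - (q n).2) (q n).2; rewrite subrK => h'.
  by have := ystep n hn; set D := c1 / _; lra.
have ylow n : (N2 <= n)%N -> cabs (q N2).2 / 2 <= cabs (q n).2.
  apply: (@gronwall_low _ (fun n => cabs (q n).2) c1) => // {}n hn; split; first exact: cabs_ge0.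
  have := cabsD ((q n).2 - (q n.+1).2) (q n.+1).2; rewrite subrK => h'.
  by have := ystep n hn; rewrite cabsC; set D := c1 / _; lra.
pose Y := 2 * cabs (q N2).2.
have Y0 : 0 <= Y by rewrite mulr_ge0// cabs_ge0.
pose c2 := c1 * (1 + Y); have c20 : 0 <= c2 by rewrite mulr_ge0//; lra.
have [|l hl] := @tele_cauchy _ q c2 N2 N20 c20.
  move=> n hn; rewrite maxnorm_le /=; apply/andP; split.
    have [h _] := hq n (leq_trans NN1 (leq_trans N12 hn)); apply: le_trans h _.
    apply: le_trans (hq1 n (leq_trans N12 hn)) _.
    apply: ler_wpM2r; first by rewrite invr_ge0 ltW.
    by rewrite /c2 ler_peMr//; lra.
  apply: le_trans (ystep n hn) _; rewrite mulrAC.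
  apply: ler_wpM2r; first by rewrite invr_ge0 ltW.
  by rewrite /c2 ler_wpM2l//; have := yup n hn; rewrite -/Y; lra.
exists l; split => //.
have y0 : 0 < cabs (q N2).2 by rewrite cabs_gt0; apply: q0; exact: leq_trans NN1 N12.
have [M hM] := hl (cabs (q N2).2 / 4) ltac:(lra).
pose n := maxn N2 M.
have h1 := hM n (leq_maxr _ _); have h2 := ylow n (leq_maxl _ _).
have h3 := cabs_snd (q n - l); rewrite /= in h3.
have h4 := cabs_le_dist (q n).2 l.2.
rewrite -cabs_gt0; lra.
Qed.

(** Stated for all u: for u = 0 both sides are pi / 2. *)
Lemma carg_abs (u : C R) : 
  `|carg u| = acos (re u / cabs u).
Proof.
have h : 0 <= acos (re u / cabs u).
  have [u0|u0] := eqVneq (cabs u) 0.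
    by rewrite u0 invr0 mulr0 acos0 divr_ge0// pi_ge0.
  have c0 : 0 < cabs u by rewrite lt_def u0 cabs_ge0.
  apply: acos_ge0; have := re_le_cabs u; rewrite ler_norml => /andP[h1 h2].
  by rewrite ler_pdivlMr// ler_pdivrMr//; apply/andP; split; lra.
rewrite /carg -/(re u) -/(im u); case: ifP => _; last rewrite normrN; exact: ger0_norm.
Qed.

Lemma acos_lt (t theta : R) : 0 < theta -> theta < pi -> -1 <= t <= 1 -> cos theta < t -> acos t < theta.
Proof.
move=> t0 tpi t1 ct; have [/andP[a0 api] ca] := acos_def t1.
rewrite ltNge; apply/negP; rewrite le_eqVlt => /orP[/eqP E|lt1].
  by move: ct; rewrite E ca ltxx.
have : cos (acos t) < cos theta by rewrite ltr_cos// in_itv /=; apply/andP; split => //; lra.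
by rewrite ca; lra.
Qed.

Lemma powR_unbounded (g M : R) : 0 < g -> exists b0 : R, 0 < b0 /\ forall b, b0 < b -> M < b `^ g.
Proof.
move=> g0; pose m := `|M| + 1.
have m0 : 0 < m by rewrite /m; have := normr_ge0 M; lra.
exists (m `^ g^-1); split; first by rewrite powR_gt0.
move=> b hb; apply: lt_le_trans (_ : m <= _).
  by rewrite /m; have := ler_norm M; lra.
have -> : m = (m `^ g^-1) `^ g by rewrite -powRrM mulVf ?powRr1 ?ltW// lt0r_neq0.
apply: ge0_ler_powR; rewrite ?nnegrE ?powR_ge0//; first exact: ltW.
  by apply: ltW; apply: lt_trans hb; rewrite powR_gt0.
exact: ltW.
Qed.

End OrbitLimit.

(** * Rescaled points lie in the invariant region *)

Section Region.
Variable R : realType.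
Local Notation a := (model_orbit R).

(** Inversion maps the disc |u - r| < r to the half plane Re U > 1 / (2 r) and
    preserves the modulus of the argument. *)
Lemma sector_inv (r theta : R) (A : R) (x : C R) : 0 < r -> 0 < theta -> theta < pi / 2 ->
  1 / (2 * r) < A - cabs x -> cos theta * (A + cabs x) < A - cabs x ->
  sector r theta (rc A + x)^-1.
Proof.
move=> r0 t0 tpi h1 h2; set U := rc A + x.
have xr := re_le_cabs x; rewrite ler_norml in xr; case/andP: xr => xr1 xr2.
have x0 := cabs_ge0 x.
have rU : A - cabs x <= re U by rewrite /U reD re_rc; lra.
have r2 : 0 < 1 / (2 * r) by rewrite divr_gt0//; lra.
have U0 : U != 0 by apply: contraTneq rU => ->; rewrite -ltNge /re /=; lra.
have cU : 0 < cabs U by rewrite cabs_gt0.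
have cUA : cabs U <= A + cabs x.
  apply: le_trans (cabsD _ _) _; rewrite cabs_rc ger0_norm//; lra.
have cU2 : cabs U ^+ 2 = re U ^+ 2 + im U ^+ 2.
  by rewrite cabsE sqr_sqrtr// addr_ge0 ?sqr_ge0.
have D0 : 0 < re U ^+ 2 + im U ^+ 2 by rewrite -cU2 exprn_gt0.
split.
  rewrite carg_abs re_inv cabsV invrK -cU2.
  have -> : re U / cabs U ^+ 2 * cabs U = re U / cabs U by field; lra.
  have pi0 := pi_gt0 R.
  apply: acos_lt => //; first by lra.
    have := re_le_cabs U; rewrite ler_norml => /andP[g1 g2].
    by rewrite ler_pdivlMr// ler_pdivrMr//; apply/andP; split; lra.
  rewrite ltr_pdivlMr//.
  have ct : 0 < cos theta by apply: cos_gt0_pihalf; apply/andP; split; lra.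
  have := ler_wpM2l (ltW ct) cUA; lra.
have rE : real_complex R r = rc r by [].
rewrite rE.
have -> : U^-1 - rc r = U^-1 * (1 - rc r * U) by rewrite mulrBr mulr1 mulrCA mulVf// mulr1.
rewrite cabsM cabsV mulrC ltr_pdivrMr//.
rewrite -(@ltr_pXn2r _ 2)//; last 2 first.
  by rewrite nnegrE cabs_ge0.
  by rewrite nnegrE mulr_ge0// ltW.
have -> : cabs (1 - rc r * U) ^+ 2 = (1 - r * re U) ^+ 2 + (r * im U) ^+ 2.
  rewrite cabsE sqr_sqrtr ?addr_ge0 ?sqr_ge0// reB imB reM imM re_rc im_rc.
  have -> : re 1 = 1 :> R by []. have -> : im 1 = 0 :> R by [].
  by ring.
rewrite [(r * cabs U) ^+ 2]exprMn cU2.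
have : 1 < 2 * r * re U.
  have : 1 / (2 * r) < re U by lra.
  by rewrite ltr_pdivrMr 1?mulrC//; lra.
lra.
Qed.

(** Both |z| and |w| are at most M / sqrt(a_n), whereas |u|^beta is at least
    (2 a_n)^(- beta); as beta < 1/2, the former is smaller for large n.  The other
    conditions hold since U = a_n + x with x bounded. *)
Lemma region_estimate (la : C R) (r0 theta beta rho X yl Y : R) : cabs la = 1 ->
  0 < r0 -> 0 < theta -> theta < pi / 2 -> 0 < beta -> beta < 1 / 2 -> 0 < rho ->
  0 <= X -> 0 < yl ->
  exists N0, forall n q, (N0 <= n)%N -> cabs q.1 <= X -> yl <= cabs q.2 -> cabs q.2 <= Y ->
  [/\ B_check r0 theta beta (unchart la n q), maxnorm (unchart la n q) < rho,
      a n / 4 <= cabs (rc (a n) + q.1) & rc (a n) + q.1 != 0].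
Proof.
move=> la1 r00 t0 tpi b0 b1 rho0 X0 yl0.
(* Y bounds y in w = y / (la^n sqrt a_n), and 2 / yl bounds the factor in
   z = u / w. *)
pose M := `|Y| + 2 / yl.
have yi : 0 < 2 / yl by rewrite divr_gt0.
have M0 : 0 < M by rewrite /M; have := normr_ge0 Y; lra.
have g0 : 0 < 1 / 2 - beta by lra.
have [bb [bb0 hbb]] := powR_unbounded (M * Num.sqrt 2) g0.
have ct1 : cos theta < 1.
  by rewrite -(cos0 R) ltr_cos// in_itv /=; apply/andP; split; have := pi_gt0 R; lra.
have ct0 : 0 < cos theta by apply: cos_gt0_pihalf; apply/andP; split; have := pi_gt0 R; lra.
have [N0 [_ hN0]] := large_nat (2 * X + 1 / (2 * r0) + 2 * X / (1 - cos theta) + bb + (M / rho) ^+ 2 + 1).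
have p1 : 0 < 1 / (2 * r0) by rewrite divr_gt0//; lra.
have p2 : 0 <= 2 * X / (1 - cos theta) by rewrite divr_ge0//; lra.
have p3 := sqr_ge0 (M / rho).
exists N0 => n q hn q1 q2l q2u.
have aN : N0%:R <= a n.
  apply: le_trans (model_orbit_ge R n); rewrite ler_nat; exact: leq_trans hn (leqnSn n).
move: aN; set A := a n => aN.
have A1 : 2 * X < A by lra.
have A2 : 1 / (2 * r0) < A - X by lra.
have A3 : 2 * X < A * (1 - cos theta).
  by rewrite -ltr_pdivrMr; lra.
have A4 : bb < 2 * A by lra.
have A5 : (M / rho) ^+ 2 < A by lra.
have A0 : 0 < A by lra.
have x0 := cabs_ge0 q.1.
set U := rc A + q.1.
have UA : cabs U <= A + X.
  apply: le_trans (cabsD _ _) _; rewrite cabs_rc gtr0_norm//.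
  by rewrite lerD2l.
have UA' : A - X <= cabs U.
  have := cabs_le_dist (rc A) (- q.1); rewrite opprK cabsN cabs_rc gtr0_norm// -/U.
  by apply: le_trans; rewrite lerD2l lerN2.
have UA2 : A / 2 <= cabs U by apply: le_trans UA'; move: A1; clear; lra.
have U0 : U != 0.
  by rewrite -cabs_gt0; apply: lt_le_trans UA2; rewrite divr_gt0.
have qy : q.2 != 0 by rewrite -cabs_gt0; exact: lt_le_trans yl0 q2l.
have sA0 : 0 < Num.sqrt A by rewrite sqrtr_gt0.
have cw : cabs (unchart la n q).2 = cabs q.2 / Num.sqrt A.
  rewrite /unchart /= /unchart_snd cabsM cabsV cabsM cabsX la1 expr1n mul1r cabs_rc gtr0_norm//.
  by rewrite mulrC.
have cu : cabs ((unchart la n q).1 * (unchart la n q).2) = (cabs U)^-1.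
  by rewrite unchart_prod// cabsV.
have cz : cabs (unchart la n q).1 = (cabs U)^-1 * Num.sqrt A / cabs q.2.
  have w0 : cabs (unchart la n q).2 != 0.
    by rewrite cw mulf_neq0// ?invr_eq0 ?lt0r_neq0// cabs_gt0.
  apply: (mulIf w0); rewrite -cabsM cu cw; field.
  by rewrite lt0r_neq0 ?lt0r_neq0// ?cabs_gt0//; lra.
have MA : M / Num.sqrt A < (cabs U)^-1 `^ beta.
  pose b := 2 * A; have bp : 0 < b by rewrite mulr_gt0.
  apply: lt_le_trans (_ : (b^-1) `^ beta <= _); last first.
    have cU : 0 < cabs U by rewrite cabs_gt0.
    apply: ge0_ler_powR; rewrite ?nnegrE ?invr_ge0 ?cabs_ge0 ?(ltW b0) ?(ltW bp)//.
    rewrite lef_pV2 ?posrE//.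
    by rewrite /b; move: UA A1 A0 X0; clear; lra.
  have bE : Num.sqrt 2 * Num.sqrt A = b `^ (1 / 2 - beta) * b `^ beta.
    rewrite -powRD; last by rewrite (gt_eqF bp) implybT.
    by rewrite subrK mul1r powR12_sqrt ?ltW// /b sqrtrM.
  have bb1 : 0 < b `^ beta by rewrite powR_gt0.
  have := hbb b A4; rewrite -(ltr_pM2r bb1) -bE => H.
  have s2 : 0 < Num.sqrt 2 :> R by rewrite sqrtr_gt0.
  have H' : M * b `^ beta < Num.sqrt A.
    by rewrite -(ltr_pM2l s2); apply: le_lt_trans H; rewrite mulrCA mulrA.
  have -> : b^-1 `^ beta = (b `^ beta)^-1.
    rewrite -powR_inv1 ?ltW// -powRrM mulN1r powRN//.
  by rewrite ltr_pdivrMr// mulrC ltr_pdivlMr.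
have wM : cabs (unchart la n q).2 <= M / Num.sqrt A.
  rewrite cw ler_pM2r ?invr_gt0//; apply: le_trans q2u _; apply: le_trans (ler_norm Y) _.
  by rewrite lerDl ltW.
have zM : cabs (unchart la n q).1 <= M / Num.sqrt A.
  rewrite cz; apply: le_trans (_ : 2 / yl / Num.sqrt A <= _); last first.
    by rewrite ler_pM2r ?invr_gt0// /M lerDr normr_ge0.
  have c2 : 0 < cabs q.2 by exact: lt_le_trans yl0 q2l.
  apply: le_trans (_ : (A / 2)^-1 * Num.sqrt A / yl <= _).
    apply: ler_pM; rewrite ?invr_ge0 ?cabs_ge0//.
    - by rewrite mulr_ge0 ?invr_ge0 ?cabs_ge0// ltW.
    - by rewrite ler_wpM2r ?(ltW sA0)// lef_pV2 ?posrE ?divr_gt0// cabs_gt0.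
    - by rewrite lef_pV2 ?posrE.
  rewrite le_eqVlt; apply/orP; left; apply/eqP.
  have AA : A = Num.sqrt A ^+ 2 by rewrite sqr_sqrtr// ltW.
  rewrite {1}AA; field; rewrite lt0r_neq0//= lt0r_neq0//.
split => //.
- split.
    by split; rewrite cu; apply: le_lt_trans MA.
  rewrite unchart_prod// -/A; apply: sector_inv => //.
    by apply: lt_le_trans A2 _; rewrite lerD2l lerN2.
  have : cos theta * cabs q.1 <= cabs q.1 by rewrite ler_piMl// ltW.
  by move: A3 q1; clear; lra.
- suff H : M / Num.sqrt A < rho by rewrite maxnorm_lt; apply/andP; split; apply: le_lt_trans H.
  rewrite ltr_pdivrMr// mulrC -ltr_pdivrMr//.
  rewrite -[X in X < _]ger0_norm; last by rewrite divr_ge0// ltW.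
  by rewrite -sqrtr_sqr ltr_sqrt.
- by apply: le_trans UA2; move: A0; clear; lra.
Qed.

End Region.

(** * The limit map near a point *)

Section LocalInverse.
Variable R : realType.
Implicit Types (p q : C2 R).
Local Notation a := (model_orbit R).

Lemma differentiable_cst2 (k : C R) p : differentiable (fun _ : C2 R => k) p.
Proof. exact: (differentiable_cst k). Qed.

Lemma differentiable_chart (la : C R) n p : p.1 * p.2 != 0 -> differentiable (chart la n) p.
Proof.
move=> p0; have d1 := differentiable_fst (differentiable_id2 p).
have d2 := differentiable_snd (differentiable_id2 p).
have d12 : differentiable (fun q : C2 R => q.1 * q.2) p by exact: differentiableM d1 d2.
apply: differentiable_prod.
  apply: (@differentiableB _ _ _ (fun q : C2 R => (q.1 * q.2)^-1) (fun=> rc (a n))).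
    exact: differentiableV d12 p0.
  exact: differentiable_cst2.
apply: (@differentiableM _ _ (fun=> la ^+ n * rc (Num.sqrt (a n))) (fun q : C2 R => q.2)).
  exact: differentiable_cst2.
exact: d2.
Qed.

Lemma differentiable_unchart (la : C R) n q : cabs la = 1 -> q.2 != 0 -> rc (a n) + q.1 != 0 ->
  differentiable (unchart la n) q.
Proof.
move=> la1 q2 q1; have d1 := differentiable_fst (differentiable_id2 q).
have d2 := differentiable_snd (differentiable_id2 q).
have f0 := chart_factor_neq0 n la1.
have ds : differentiable (unchart_snd la n) q.
  apply: (@differentiableM _ _ (fun=> (la ^+ n * rc (Num.sqrt (a n)))^-1) (fun q : C2 R => q.2)).
    exact: differentiable_cst2.
  exact: d2.
apply: differentiable_prod; last exact: ds.
apply: (@differentiableV _ _ (fun q => (rc (a n) + q.1) * unchart_snd la n q)); last first.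
  by rewrite mulf_neq0// /unchart_snd mulf_neq0// invr_eq0.
apply: (@differentiableM _ _ (fun q : C2 R => rc (a n) + q.1) (unchart_snd la n)); last exact: ds.
apply: (@differentiableD _ _ _ (fun=> rc (a n)) (fun q : C2 R => q.1)); last exact: d1.
exact: differentiable_cst2.
Qed.

Lemma differentiable_iter (F : C2 R -> C2 R) n p : (forall q, differentiable F q) ->
  differentiable (iter n F) p.
Proof.
move=> dF; elim: n => [|n IH]; first exact: differentiable_id2.
exact: (@differentiable_comp _ _ _ _ (iter n F) F p IH (dF _)).
Qed.

Lemma sector_neq0 (r theta : R) (u : C R) : sector r theta u -> u != 0.
Proof.
move=> [_ h]; apply: contraTneq h => ->.
have -> : real_complex R r = rc r by [].
by rewrite sub0r cabsN cabs_rc -leNgt ler_norm.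
Qed.

Definition chart_limit (la : C R) (F : C2 R -> C2 R) p q := forall e : R, 0 < e ->
  exists M, forall n, (M <= n)%N -> maxnorm (chart la n (iter n F p) - q) <= e.

Lemma limit_unique (u : nat -> C2 R) q q' :
  (forall e : R, 0 < e -> exists M, forall n, (M <= n)%N -> maxnorm (u n - q) <= e) ->
  (forall e : R, 0 < e -> exists M, forall n, (M <= n)%N -> maxnorm (u n - q') <= e) -> q = q'.
Proof.
move=> h h'; apply/eqP; rewrite -subr_eq0; apply/eqP; apply: maxnorm_eq0.
apply/le_anti; rewrite maxnorm_ge0 andbT; apply/ler_addgt0Pr => e e0; rewrite add0r.
have e2 : 0 < e / 2 by lra.
have [M hM] := h _ e2; have [M' hM'] := h' _ e2.
have := hM (maxn M M') (leq_maxl _ _); have := hM' (maxn M M') (leq_maxr _ _).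
by have := maxnorm_tri q (u (maxn M M')) q'; rewrite (maxnormC q (u _)); lra.
Qed.

(** Let q range over the ball of radius d around q0 and follow the coordinates
    v q n, at time n >= N, of the orbit that starts at time N at q.  They stay in
    the ball of radius 2 d, where each step is at most cc / n^2; this keeps the
    orbit in the region where the step estimate applies, and makes v q n converge
    uniformly to Th q with |Th q - q| <= cc / N.  The radius d depends on q0 only,
    so N may be chosen after d. *)
Lemma local_limit (la : C R) (F : C2 R -> C2 R) (r0 theta beta rho c : R) :
  cabs la = 1 -> 0 < r0 -> 0 < theta -> theta < pi / 2 -> 0 < beta -> beta < 1 / 2 ->
  (forall q, differentiable F q) ->
  0 < rho -> 0 <= c ->
  (forall p, maxnorm p < rho -> W_set beta p -> p.1 * p.2 != 0 ->
    forall n, a n / 4 <= cabs (p.1 * p.2)^-1 ->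
      cabs ((chart la n.+1 (F p)).1 - (chart la n p).1)
        <= c * (1 + cabs (chart la n p).1) / n.+1%:R ^+ 2 /\
      cabs ((chart la n.+1 (F p)).2 - (chart la n p).2)
        <= c * (1 + cabs (chart la n p).1) / n.+1%:R ^+ 2 * cabs (chart la n p).2) ->
  (forall p, B_check r0 theta beta p -> B_check r0 theta beta (F p)) ->
  forall q0, q0.2 != 0 -> exists2 d : R, 0 < d & forall N', exists N, (N' <= N)%N /\
   exists Th : C2 R -> C2 R, exists eta : R, [/\ eta <= d / 256,
    forall q, maxnorm (q - q0) < d -> differentiable Th q,
    forall q, maxnorm (q - q0) < d -> maxnorm (Th q - q) <= eta &
    forall q, maxnorm (q - q0) < d -> [/\ q.2 != 0, rc (a N) + q.1 != 0,
       B_check r0 theta beta (unchart la N q) &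
       forall p, iter N F p = unchart la N q -> chart_limit la F p (Th q)]].
Proof.
move=> la1 r00 t0 tpi b0 b1 dF rho0 c0 hstep hB q0 q02.
have y0 : 0 < cabs q0.2 by rewrite cabs_gt0.
pose d := Num.min (1 / 4) (cabs q0.2 / 4).
have d0 : 0 < d by rewrite /d lt_min; apply/andP; split; lra.
have d1 : d <= 1 / 4 by rewrite /d ge_min lexx.
have d2 : d <= cabs q0.2 / 4 by rewrite /d ge_min lexx orbT.
exists d => // N'.
pose X := cabs q0.1 + 1; pose Y := cabs q0.2 + 1; pose yl := cabs q0.2 / 2.
have X0 : 0 <= X by rewrite /X; have := cabs_ge0 q0.1; lra.
have yl0 : 0 < yl by rewrite /yl; lra.
have inball q : maxnorm (q - q0) < 2 * d -> [/\ cabs q.1 <= X, yl <= cabs q.2 & cabs q.2 <= Y].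
  rewrite maxnorm_lt /= => /andP[h1 h2]; split.
  - by have := cabs_le_dist q.1 q0.1; rewrite /X; lra.
  - by have := cabs_le_dist q0.2 q.2; rewrite cabsC /yl; lra.
  - by have := cabs_le_dist q.2 q0.2; rewrite /Y; lra.
have [N0 hN0] := region_estimate Y la1 r00 t0 tpi b0 b1 rho0 X0 yl0.
pose cc := c * (1 + X) * (1 + Y).
have Y0 : 0 <= Y by rewrite /Y; lra.
have cc0 : 0 <= cc by rewrite /cc !mulr_ge0//; lra.
have [N1 [N10 hN1]] := large_nat (cc * 256 / d).
pose N := maxn N' (maxn N0 N1); exists N.
split; first exact: leq_maxl.
have NN0 : (N0 <= N)%N by rewrite /N !leq_max leqnn orbT.
have NN1 : (N1 <= N)%N by rewrite /N !leq_max leqnn !orbT.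
have Ngt0 : (0 < N)%N by exact: leq_trans N10 NN1.
have Np : 0 < N%:R :> R by rewrite ltr0n.
have eta_d : cc / N%:R <= d / 256.
  rewrite ler_pdivrMr//; have : cc * 256 / d <= N%:R.
    by apply: le_trans hN1 _; rewrite ler_nat.
  by rewrite ler_pdivrMr//; clear; lra.
have dd z : maxnorm (z - q0) < d -> maxnorm (z - q0) < 2 * d.
  by move=> h; apply: lt_trans h _; clear -d0; lra.
pose v q n := chart la n (iter (n - N) F (unchart la N q)).
(* What the region estimate says about points with coordinates near q0. *)
have reg n q : (N <= n)%N -> maxnorm (q - q0) < 2 * d ->
    [/\ B_check r0 theta beta (unchart la n q), maxnorm (unchart la n q) < rho,
      a n / 4 <= cabs (rc (a n) + q.1), rc (a n) + q.1 != 0 & q.2 != 0].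
  move=> hn /inball [h1 h2 h3]; have [k1 k2 k3 k4] := hN0 n q (leq_trans NN0 hn) h1 h2 h3.
  by split => //; rewrite -cabs_gt0; exact: lt_le_trans yl0 h2.
have Bnz p : B_check r0 theta beta p -> p.1 * p.2 != 0 by move=> [_ /sector_neq0].
have vE q k : v q (N + k)%N = chart la (N + k) (iter k F (unchart la N q)).
  by rewrite /v addKn.
have step q k : maxnorm (q - q0) < d ->
    maxnorm (v q (N + k)%N - q) <= cc * (1 / N%:R - 1 / (N + k)%:R) ->
    B_check r0 theta beta (iter k F (unchart la N q)) ->
    maxnorm (v q (N + k).+1 - v q (N + k)%N) <= cc / (N + k).+1%:R ^+ 2.
  move=> hq IH1 IH2; have vk := vE q k.
  have vk1 : v q (N + k).+1 = chart la (N + k).+1 (F (iter k F (unchart la N q))).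
    by rewrite -addnS vE addnS.
  set pk := iter k F (unchart la N q) in IH2 vk vk1.
  have pk0 := Bnz _ IH2.
  have pkE : unchart la (N + k) (v q (N + k)%N) = pk by rewrite vk chartK.
  have inb : maxnorm (v q (N + k)%N - q0) < 2 * d.
    apply: le_lt_trans (maxnorm_tri _ q _) _.
    have : cc * (1 / N%:R - 1 / (N + k)%:R) <= cc * (1 / N%:R).
      by rewrite ler_wpM2l// tele_le.
    by rewrite mul1r; move: IH1 hq eta_d d0; clear; lra.
  have [k1 k2 k3 k4 k5] := reg (N + k)%N _ (leq_addr _ _) inb.
  rewrite pkE in k1 k2.
  have uE : (pk.1 * pk.2)^-1 = rc (a (N + k)) + (v q (N + k)%N).1.
    by rewrite vk /chart /=; ring.
  have [|s1 s2] := hstep pk k2 k1.1 pk0 (N + k)%N; first by rewrite uE.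
  rewrite -vk -vk1 in s1 s2.
  have [g1 g2 g3] := inball _ inb.
  have sq0 : 0 <= (N + k).+1%:R ^- 2 :> R by rewrite invr_ge0 exprn_ge0.
  have cX : c * (1 + cabs (v q (N + k)%N).1) <= c * (1 + X) by rewrite ler_wpM2l// lerD2l.
  have cX0 : 0 <= c * (1 + X) by rewrite mulr_ge0// addr_ge0.
  rewrite maxnorm_le /=; apply/andP; split.
    apply: le_trans s1 _; rewrite ler_wpM2r//; apply: le_trans cX _.
    by rewrite /cc ler_peMr// lerDl.
  apply: le_trans s2 _; rewrite mulrAC ler_wpM2r//.
  apply: ler_pM => //; [|exact: cabs_ge0|by apply: le_trans g3 _; rewrite lerDr].
  by rewrite mulr_ge0// addr_ge0 ?cabs_ge0.
have vN q : maxnorm (q - q0) < d -> v q N = q.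
  by move=> hq; have [k1 k2 k3 k4 k5] := reg N q (leqnn _) (dd _ hq); rewrite /v subnn /= unchartK.
have claim q k : maxnorm (q - q0) < d ->
    maxnorm (v q (N + k)%N - q) <= cc * (1 / N%:R - 1 / (N + k)%:R) /\
    B_check r0 theta beta (iter k F (unchart la N q)).
  move=> hq; elim: k => [|k [IH1 IH2]].
    have [k1 k2 k3 k4 k5] := reg N q (leqnn _) (dd _ hq).
    by rewrite addn0 vN// !subrr maxnorm_0 mulr0; split.
  split; last by rewrite iterS; exact: hB.
  have nk : (0 < N + k)%N by rewrite addn_gt0 Ngt0.
  have st := step q k hq IH1 IH2; rewrite addnS.
  have h2 := ler_wpM2l cc0 (@inv_sq_tele R (N + k) nk); rewrite mulrA mulr1 in h2.
  apply: le_trans (maxnorm_tri _ (v q (N + k)%N) _) _.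
  have -> : cc * (1 / N%:R - 1 / (N + k).+1%:R) =
    cc * (1 / (N + k)%:R - 1 / (N + k).+1%:R) + cc * (1 / N%:R - 1 / (N + k)%:R) by ring.
  by apply: lerD IH1; exact: le_trans st h2.
have vstep q n : maxnorm (q - q0) < d -> (N <= n)%N -> maxnorm (v q n.+1 - v q n) <= cc / n.+1%:R ^+ 2.
  move=> hq hn; rewrite -(subnKC hn); have [h1 h2] := claim q (n - N)%N hq.
  exact: step.
have lim q : exists l, maxnorm (q - q0) < d -> forall e : R, 0 < e ->
    exists M, forall n, (M <= n)%N -> maxnorm (v q n - l) <= e.
  have [hq|] := pselect (maxnorm (q - q0) < d); last by exists q.
  by have [l hl] := tele_cauchy Ngt0 cc0 (fun n hn => vstep q n hq hn); exists l.
have [Th hTh] := choice lim.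
have close q n : maxnorm (q - q0) < d -> (N <= n)%N -> maxnorm (v q n - Th q) <= cc / n%:R.
  move=> hq hn; apply/ler_addgt0Pr => e e0; have [M hM] := hTh q hq e e0.
  have n0 : (0 < n)%N by exact: leq_trans Ngt0 hn.
  have := tele_steps n0 (fun m hm => vstep q m hq (leq_trans hn hm)) cc0 M.
  have := hM (n + M)%N (leq_addl _ _).
  have := maxnorm_tri (v q n) (v q (n + M)%N) (Th q); rewrite (maxnormC (v q n) (v q (n + M)%N)).
  have := ler_wpM2l cc0 (@tele_le R n M n0); rewrite mul1r.
  by set t := cc * _; clearbody t; clear; lra.
exists Th, (cc / N%:R); split => //.
- move=> q hq; apply: (@differentiable2_limit _ (fun k q => v q (N + k)%N) _ _ (d - maxnorm (q - q0))).
  + by rewrite subr_gt0.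
  + move=> k z hz; have hz' : maxnorm (z - q0) < d by have := maxnorm_tri z q q0; move: hz; clear; lra.
    have -> : (fun q => v q (N + k)%N) = (fun q => chart la (N + k) (iter k F (unchart la N q))).
      by apply/funext => x; rewrite vE.
    have [k1 k2 k3 k4 k5] := reg N z (leqnn _) (dd _ hz').
    apply: (@differentiable_comp _ _ _ _ (fun q => iter k F (unchart la N q)) (chart la (N + k))).
      apply: (@differentiable_comp _ _ _ _ (unchart la N) (iter k F)).
        exact: differentiable_unchart.
      exact: differentiable_iter.
    by apply: differentiable_chart; apply: Bnz; have [] := claim z k hz'.
  + move=> e e0; have [M [M0 hM]] := large_nat (cc / e); exists M => n hn z hz.
    have hz' : maxnorm (z - q0) < d by have := maxnorm_tri z q q0; move: hz; clear; lra.
    apply: le_trans (close z (N + n)%N hz' (leq_addr _ _)) _.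
    rewrite ler_pdivrMr; last by rewrite ltr0n addn_gt0 Ngt0.
    rewrite mulrC -ler_pdivrMr//; apply: le_trans hM _.
    by rewrite ler_nat; apply: leq_trans hn (leq_addl _ _).
- by move=> q hq; have := close q N hq (leqnn _); rewrite vN// maxnormC.
- move=> q hq; have [k1 k2 k3 k4 k5] := reg N q (leqnn _) (dd _ hq).
  split => // p hp e e0; have [M hM] := hTh q hq e e0.
  exists (maxn N M) => n; rewrite geq_max => /andP[n1 n2'].
  have -> : chart la n (iter n F p) = v q n.
    by rewrite /v -hp -iterD subnK.
  exact: hM.
Qed.

End LocalInverse.

(** * Fatou coordinates along an orbit *)

Section OrbitConvergence.
Variable R : realType.
Implicit Types (p q : C2 R).
Local Notation a := (model_orbit R).

(** Re U grows by at least 3/4 per step, and a_n by at most 7/4, so eventually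
    |U| >= a_n / 4, as the step estimate requires. *)
Lemma orbit_has_chart_limit (la : C R) (F : C2 R -> C2 R) (r0 theta beta rho c : R) :
  cabs la = 1 -> 0 <= c ->
  (forall p, maxnorm p < rho -> W_set beta p -> p.1 * p.2 != 0 ->
    re (p.1 * p.2)^-1 + 3 / 4 <= re ((F p).1 * (F p).2)^-1 /\
    (forall n, a n / 4 <= cabs (p.1 * p.2)^-1 ->
      cabs ((chart la n.+1 (F p)).1 - (chart la n p).1)
        <= c * (1 + cabs (chart la n p).1) / n.+1%:R ^+ 2 /\
      cabs ((chart la n.+1 (F p)).2 - (chart la n p).2)
        <= c * (1 + cabs (chart la n p).1) / n.+1%:R ^+ 2 * cabs (chart la n p).2)) ->
  forall p N0, (forall n, (N0 <= n)%N -> B_check r0 theta beta (iter n F p) /\ maxnorm (iter n F p) < rho) ->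
  exists q, q.2 != 0 /\ chart_limit la F p q.
Proof.
move=> la1 c0 hstep p N0 hp; pose P n := iter n F p.
have nz n : (N0 <= n)%N -> (P n).1 * (P n).2 != 0.
  by move=> hn; have [[_ hs] _] := hp n hn; apply: sector_neq0 hs.
have st n (hn : (N0 <= n)%N) := hstep (P n) (hp n hn).2 (hp n hn).1.1 (nz n hn).
pose u n := re ((P n).1 * (P n).2)^-1.
have grow k : u N0 + 3 / 4 * k%:R <= u (N0 + k)%N.
  elim: k => [|k IH]; first by rewrite mulr0 addr0 addn0.
  have [h _] := st (N0 + k)%N (leq_addr _ _).
  rewrite addnS -natr1; apply: le_trans _ h; rewrite -/(u (N0 + k)%N); lra.
have agrow k : a (N0 + k) <= a N0 + 7 / 4 * k%:R.
  elim: k => [|k IH]; first by rewrite mulr0 addr0 addn0.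
  rewrite addnS -natr1 /=; have a1 := @model_orbit_ge1 R (N0 + k).
  have : 3 / 4 / a (N0 + k) <= 3 / 4 by rewrite ler_pdivrMr; lra.
  by lra.
have [K [_ hK]] := large_nat ((a N0 / 4 - u N0) * 16 / 5).
have big n : (N0 + K <= n)%N -> a n / 4 <= cabs ((P n).1 * (P n).2)^-1.
  move=> hn; apply: le_trans (re_le_cabs _); apply: le_trans (ler_norm _); rewrite -/(u n).
  have hn0 : (N0 <= n)%N by apply: leq_trans hn; exact: leq_addr.
  rewrite -(subnKC hn0); set k := (n - N0)%N.
  have kK : (K%:R : R) <= k%:R by rewrite ler_nat /k -(leq_add2l N0) subnKC.
  by have := grow k; have := agrow k; lra.
have [||l [l0 hl]] := @orbit_limit R (fun n => chart la n (P n)) c (N0 + K) c0.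
- move=> n hn; have hn0 : (N0 <= n)%N by apply: leq_trans hn; exact: leq_addr.
  rewrite /chart /=; apply: mulf_neq0; first exact: chart_factor_neq0.
  by have := nz n hn0; rewrite mulf_eq0 negb_or => /andP[].
- move=> n hn; have hn0 : (N0 <= n)%N by apply: leq_trans hn; exact: leq_addr.
  by have [_ h] := st n hn0; exact: (h n (big n hn)).
by exists l.
Qed.

(** Passing from F p to p shifts time by one: the charts at times n and n + 1
    differ by a_(n+1) - a_n, which tends to 1, and by the factor
    sqrt(a_(n+1) / a_n) la, which tends to la. *)
Lemma chart_limit_shift (la : C R) (F : C2 R -> C2 R) p q : cabs la = 1 ->
  chart_limit la F p q -> chart_limit la F (F p) (q.1 + 1, la^-1 * q.2).
Proof.
move=> la1 hq e e0; have la0 := cabs1_neq0 la1.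
have e2 : 0 < e / 2 by lra.
have [M hM] := hq _ e2.
have q20 := cabs_ge0 q.2.
have [M' [M'0 hM']] := large_nat ((1 + cabs q.2) / (e / 2)).
exists (maxn M M') => n; rewrite geq_max => /andP[n1 n2'].
have {}hM := hM n.+1 (leq_trans n1 (leqnSn n)).
rewrite -iterSr.
have a1 := @model_orbit_ge1 R n; have a0 : 0 < a n by lra.
have small : (1 + cabs q.2) / a n <= e / 2.
  rewrite ler_pdivrMr// mulrC -ler_pdivrMr//; apply: le_trans hM' _.
  by apply: le_trans (model_orbit_ge R n); rewrite ler_nat; apply: leq_trans n2' (leqnSn n).
have /andP[t1 t2] := sqrt_ratio a1; set tau := Num.sqrt _ in t1 t2.
have ia : 0 < (a n)^-1 <= 1 by rewrite invr_gt0 a0 invf_le1.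
case/andP: ia => ia0 ia1.
have tau1 : 1 <= tau by apply: le_trans t1; lra.
have tau2 : tau <= 1 + 1 / a n.
  apply: le_trans t2 _; have : 1 / 2 / a n ^+ 2 <= 1 / 2 / a n.
    by rewrite ler_pM2l ?divr_gt0// lef_pV2 ?posrE ?exprn_gt0// ler_eXnr.
  by lra.
set P := iter n.+1 F p in hM *.
have h1 := le_trans (cabs_fst _) hM; have h2 := le_trans (cabs_snd _) hM.
rewrite /= in h1 h2.
have sa0 : rc (Num.sqrt (a n)) != 0 by rewrite rc_eq0 sqrtr_eq0 -ltNge.
have tauc : 0 < cabs (rc tau) by rewrite cabs_rc ger0_norm; lra.
have tau0 : rc tau != 0 by rewrite -cabs_gt0.
have sE : rc (Num.sqrt (a n.+1)) = rc (Num.sqrt (a n)) * rc tau.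
  rewrite -rcM /tau -sqrtrM; last by lra.
  by congr (rc (Num.sqrt _)); rewrite /=; field; lra.
have qn : 1 / a n <= (1 + cabs q.2) / a n by rewrite ler_pM2r ?invr_gt0//; lra.
have qn2 : cabs q.2 / a n <= (1 + cabs q.2) / a n by rewrite ler_pM2r ?invr_gt0//; lra.
rewrite maxnorm_le; apply/andP; split => /=.
  have -> : (P.1 * P.2)^-1 - rc (a n) - (q.1 + 1) =
     ((P.1 * P.2)^-1 - rc (a n.+1) - q.1) + rc (3 / 4 / a n).
    by rewrite /= !rcD rc1; ring.
  apply: le_trans (cabsD _ _) _; rewrite cabs_rc ger0_norm; last by rewrite divr_ge0// ltW.
  by rewrite /= in h1 *; lra.
have -> : la ^+ n * rc (Num.sqrt (a n)) * P.2 - la^-1 * q.2 =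
   la^-1 * (rc tau)^-1 * ((la ^+ n.+1 * rc (Num.sqrt (a n.+1)) * P.2 - q.2) - rc (tau - 1) * q.2).
  rewrite sE rcB rc1 exprS; field; by rewrite la0 tau0.
have ti : cabs (rc tau)^-1 <= 1.
  have tp : 0 < tau by apply: lt_le_trans tau1.
  by rewrite cabsV cabs_rc gtr0_norm// invf_le1.
rewrite cabsM cabsM cabsV la1 invr1 mul1r.
apply: le_trans (ler_wpM2r (cabs_ge0 _) ti) _; rewrite mul1r.
apply: le_trans (cabsB _ _) _; rewrite cabsM cabs_rc ger0_norm; last by lra.
have : (tau - 1) * cabs q.2 <= (1 / a n) * cabs q.2 by rewrite ler_wpM2r//; lra.
have -> : 1 / a n * cabs q.2 = cabs q.2 / a n by rewrite mul1r mulrC.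
by move: h2; rewrite /=; lra.
Qed.

End OrbitConvergence.

(** * The exponential twist *)

Section Twist.
Variable R : realType.

Lemma real_derivative_bound (f : R -> R) (x d : R) : is_derive x 1 f d ->
  forall e, 0 < e -> exists2 r, 0 < r & forall h, `|h| < r -> `|f (x + h) - f x - d * h| <= e * `|h|.
Proof.
move=> fd e e0.
have df : differentiable f x by apply/derivable1_diffP; exact: (@ex_derive _ _ _ _ _ _ _ fd).
have dE h : 'd f x h = d * h.
  have {1}-> : h = h *: (1 : R) by rewrite /GRing.scale /= mulr1.
  by rewrite linearZ /= -deriveE// (@derive_val _ _ _ _ _ _ _ fd) /GRing.scale /= mulrC.
have /diff_locallyP [_ /eqaddoP H] := df.
have /nbhs_ballP [r r0 hr] := H e e0.
exists r => // h hh; have := hr h; rewrite /ball /= sub0r normrN => /(_ hh).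
by rewrite !fctE /= dE [h + x]addrC opprD addrA.
Qed.

Lemma unit_angle (la : C R) : cabs la = 1 -> exists al : R, la = mkc (cos al) (sin al).
Proof.
move=> la1; have h : re la ^+ 2 + im la ^+ 2 = 1.
  by rewrite -[LHS]sqr_sqrtr ?addr_ge0 ?sqr_ge0// -cabsE la1 expr1n.
have r1 : -1 <= re la <= 1 by rewrite -ler_norml; have := re_le_cabs la; rewrite la1.
have si : sin (acos (re la)) = `|im la|.
  rewrite sin_acos// -sqrtr_sqr; congr Num.sqrt; lra.
have co : cos (acos (re la)) = re la by rewrite acosK// in_itv.
have [i0|i0] := leP 0 (im la).
  by exists (acos (re la)); apply: c_ext; rewrite /re /im /= -/(re la) -/(im la) ?co// si ger0_norm.
exists (- acos (re la)); apply: c_ext; rewrite /re /im /= -/(re la) -/(im la) ?cosN ?sinN ?co//.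
by rewrite si ltr0_norm// opprK.
Qed.

(** exp (i al z), the entire function with exp (i al (z + 1)) = la exp (i al z) when
    la = exp (i al). *)
Definition cis (al : R) (z : C R) : C R :=
  mkc (expR (- (al * im z)) * cos (al * re z)) (expR (- (al * im z)) * sin (al * re z)).

Lemma cisD al z w : cis al (z + w) = cis al z * cis al w.
Proof.
rewrite /cis reD imD !mulrDr cosD sinD opprD expRD.
by apply: c_ext; rewrite ?reM ?imM /re /im /=; ring.
Qed.

Lemma cis0 al : cis al 0 = 1.
Proof.
by rewrite /cis /re /im /= !mulr0 oppr0 expR0 cos0 sin0 mulr1 mulr0.
Qed.

Lemma cis_neq0 al z : cis al z != 0.
Proof.
apply/eqP => E; have := cis0 al; rewrite -(subrr z) cisD E mul0r => /eqP.
by rewrite eq_sym oner_eq0.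
Qed.

Lemma cisN al z : cis al (- z) = (cis al z)^-1.
Proof.
by apply: (mulfI (cis_neq0 al z)); rewrite -cisD subrr cis0 mulfV// cis_neq0.
Qed.

Lemma cis1 al : cis al 1 = mkc (cos al) (sin al).
Proof. by rewrite /cis /re /im /= mulr0 oppr0 expR0 !mulr1 !mul1r. Qed.

(** The derivative is i al.  The addition formula carries it to all points. *)
Lemma has_deriv_cis_at0 al : has_deriv (cis al) 0 (mkc 0 al).
Proof.
move=> e e0; set b := `|al| + 1.
have b0 : 0 < b by rewrite /b; have := normr_ge0 al; lra.
pose e' := Num.min (1 / 2) (e / (16 * b)).
have e'0 : 0 < e' by rewrite lt_min; apply/andP; split; [lra|apply: divr_gt0 => //; lra].
have e'1 : e' <= 1 / 2 by rewrite ge_min lexx.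
have e'2 : e' * (16 * b) <= e.
  by rewrite -ler_pdivlMr; [rewrite ge_min lexx orbT|lra].
clearbody e'.
have [r1 r10 h1] := real_derivative_bound (is_derive_expR 0) e'0.
have [r2 r20 h2] := real_derivative_bound (is_derive_cos 0) e'0.
have [r3 r30 h3] := real_derivative_bound (is_derive_sin 0) e'0.
(* Besides the three expansions, h must be so small that t s is negligible. *)
pose r := Num.min e' (Num.min r1 (Num.min r2 r3)).
have r0 : 0 < r by rewrite !lt_min e'0 r10 r20 r30.
exists (r / b); first by rewrite divr_gt0.
move=> h; rewrite ltr_pdivlMr// => hr; rewrite add0r cis0.
set x := re h; set y := im h.
pose t := - (al * y); pose s := al * x.
have tb : `|t| <= cabs h * b.
  rewrite /t normrN normrM mulrC; apply: ler_pM => //; first exact: im_le_cabs.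
  by rewrite /b; lra.
have sb : `|s| <= cabs h * b.
  rewrite /s normrM mulrC; apply: ler_pM => //; first exact: re_le_cabs.
  by rewrite /b; lra.
set H := cabs h * b in hr tb sb.
have := hr; rewrite !lt_min => /and4P[he' hr1 hr2 hr3].
have := h1 t (le_lt_trans tb hr1); have := h2 s (le_lt_trans sb hr2).
have := h3 s (le_lt_trans sb hr3).
rewrite !add0r expR0 cos0 sin0 subr0 mul1r oppr0 mul0r subr0 mul1r => g3 g2 g1.
have be3 : `|sin s - s| <= e' * H by apply: le_trans g3 _; rewrite ler_pM2l.
have be2 : `|cos s - 1| <= e' * H by apply: le_trans g2 _; rewrite ler_pM2l.
have be1 : `|expR t - 1 - t| <= e' * H by apply: le_trans g1 _; rewrite ler_pM2l.
have H0 : 0 <= H by rewrite mulr_ge0 ?cabs_ge0// ltW.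
have e'H : e' * H <= 1 / 2 * H by rewrite ler_wpM2r.
have HH : H * H <= e' * H by rewrite ler_wpM2r// ltW.
apply: le_trans (cabs_le_reim _) _.
have -> : e * cabs h = e / b * H by rewrite /H; field; exact: lt0r_neq0.
have eb : 16 * e' <= e / b by rewrite ler_pdivlMr//; move: e'2; clear; lra.
apply: le_trans (_ : 16 * e' * H <= _); last by rewrite ler_wpM2r.
have cosb : `|cos s| <= 1 by exact: cos_max.
have reE : re (cis al h - 1 - mkc 0 al * h) = (expR t - 1 - t) * cos s + (1 + t) * (cos s - 1).
  rewrite !reB reM /cis /re /im /= -/x -/y -/t -/s /t; ring.
have imE : im (cis al h - 1 - mkc 0 al * h) = (expR t - 1 - t) * sin s + t * sin s + (sin s - s).
  rewrite !imB imM /cis /re /im /= -/x -/y -/t -/s /t; ring.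
have H1 : H <= 1 / 2 by exact: le_trans (ltW he') e'1.
have sinb : `|sin s| <= 2 * H.
  by have := ler_normD (sin s - s) s; rewrite subrK; move: be3 sb e'H H0; clear; lra.
have A1 : `|(expR t - 1 - t) * cos s| <= e' * H.
  rewrite normrM -[X in _ <= X]mulr1; exact: ler_pM.
have A2 : `|(1 + t) * (cos s - 1)| <= 2 * (e' * H).
  rewrite normrM; apply: ler_pM => //.
  by have := ler_normD 1 t; rewrite normr1; move: tb H1; clear; lra.
have A3 : `|(expR t - 1 - t) * sin s| <= e' * H.
  rewrite normrM -[X in _ <= X]mulr1; apply: ler_pM => //.
  by move: sinb H1; clear; lra.
have A4 : `|t * sin s| <= 2 * (e' * H).
  rewrite normrM; apply: le_trans (_ : H * (2 * H) <= _); first exact: ler_pM.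
  by rewrite mulrCA ler_pM2l.
have B1 := ler_normD ((expR t - 1 - t) * cos s) ((1 + t) * (cos s - 1)).
have B2 := ler_normD ((expR t - 1 - t) * sin s + t * sin s) (sin s - s).
have B3 := ler_normD ((expR t - 1 - t) * sin s) (t * sin s).
have E0 : 0 <= e' * H by rewrite mulr_ge0// ltW.
by rewrite reE imE; move: B1 B2 B3 A1 A2 A3 A4 be3 E0; clear; lra.
Qed.

Lemma differentiable_cis al z : differentiable (cis al) z.
Proof.
apply: (@has_deriv_differentiable _ _ _ (cis al z * mkc 0 al)) => e e0.
have c0 : 0 < cabs (cis al z) by rewrite cabs_gt0 cis_neq0.
have [r r0 hr] := has_deriv_cis_at0 al (divr_gt0 e0 c0).
exists r => // h /hr; rewrite add0r cis0 => H.
have -> : cis al (z + h) - cis al z - cis al z * mkc 0 al * h =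
   cis al z * (cis al h - 1 - mkc 0 al * h) by rewrite cisD; ring.
rewrite cabsM mulrC -ler_pdivlMr//; apply: le_trans H _.
by rewrite mulrAC.
Qed.

End Twist.

(** * Assembling the conjugacy *)

Section Assembly.
Variable R : realType.
Implicit Types (p q : C2 R).
Local Notation a := (model_orbit R).

(** Injectivity makes the chosen global inverse agree near each point with the
    local one, which is holomorphic. *)
Lemma biholomorphic_of_local_inverse (U V : set (C2 R)) (f : C2 R -> C2 R) :
  (forall p, U p -> differentiable f p) -> (forall p, U p -> V (f p)) ->
  (forall p p', U p -> U p' -> f p = f p' -> p = p') ->
  (forall q0, V q0 -> exists2 r : R, 0 < r & exists G : C2 R -> C2 R,
     differentiable G q0 /\ forall q, maxnorm (q - q0) < r -> U (G q) /\ f (G q) = q) ->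
  biholomorphic_map U V f.
Proof.
move=> df fV finj floc.
have inv q : exists p, V q -> U p /\ f p = q.
  have [Vq|] := pselect (V q); last by exists q.
  have [r r0 [G [_ hG]]] := floc q Vq; exists (G q) => _; apply: hG.
  by rewrite subrr maxnorm_0.
have [g hg] := choice inv.
split.
- split=> //.
  + by move=> p p' /set_mem Up /set_mem Up'; exact: finj.
  + by move=> q /hg [Ug fg]; exists (g q).
- exact: df.
exists g.
  by move=> p /set_mem Up; have [Ug fg] := hg (f p) (fV p Up); exact: finj.
move=> q0 Vq0; have [r r0 [G [dG hG]]] := floc q0 Vq0.
apply: (differentiable2_local r0 _ dG) => q hq.
have [UG fG] := hG q hq; have Vq : V q by rewrite -fG; exact: fV.
by have [Ug fg] := hg q Vq; apply: finj => //; rewrite fG fg.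
Qed.

(** The limit (psi, sigma) of the rescaled orbits.  Near the orbit of a given point
    it equals Th o chart N o F^N for some late N, whence its holomorphy and, Th
    being injective and F an automorphism, its injectivity.  A local inverse is
    F^(-N) o unchart N o S, where S inverts Th. *)
Lemma fatou_coordinates (la : C R) (l : nat) (theta0 beta0 : R)
    (F : C2 R -> C2 R) (Omega : set (C2 R)) :
  `|la| = 1 -> (0 < l)%N -> 0 < theta0 -> theta0 < pi / 2 -> 0 < beta0 -> beta0 < 1 / 2 ->
  4 <= beta0 * l.+1%:R -> automorphism F ->
  (fun p => F p - F_N la p) =O_ (0 : C2 R) (fun p => `|p| ^+ l) ->
  (forall p, Omega p -> (fun n => iter n F p) @ \oo --> (0 : C2 R)) ->
  (exists2 r0 : R, 0 < r0 & F @` B_check r0 theta0 beta0 `<=` B_check r0 theta0 beta0 /\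
     Omega = \bigcup_n (iter n F @^-1` B_check r0 theta0 beta0)) ->
  exists Psi : C2 R -> C2 R,
  [/\ forall p, Omega p -> differentiable Psi p,
      forall p, Omega p -> (Psi p).2 != 0 /\ Psi (F p) = ((Psi p).1 + 1, la^-1 * (Psi p).2),
      forall p p', Omega p -> Omega p' -> Psi p = Psi p' -> p = p' &
      forall q0, q0.2 != 0 -> exists2 r : R, 0 < r & exists G : C2 R -> C2 R,
        differentiable G q0 /\ forall q, maxnorm (q - q0) < r -> Omega (G q) /\ Psi (G q) = q].
Proof.
move=> la1' l0 t0 tpi b0 b1 bl [[_ Finj Fsurj] dF' [Fi FiK dFi']] hF cvg0 [r0 r00 [hB OmE]].
have la1 : cabs la = 1 by rewrite /cabs la1'.
have dF q : differentiable F q by exact: dF'.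
have dFi q : differentiable Fi q by exact: dFi'.
have FK p : Fi (F p) = p by apply: FiK; exact: mem_set.
have FiF q : F (Fi q) = q by have [p _ <-] := Fsurj q I; rewrite FK.
have itK n q : iter n F (iter n Fi q) = q.
  by elim: n q => [//|n IH] q; rewrite iterS iterSr FiF IH || rewrite iterSr iterS FiF IH.
have itI n p p' : iter n F p = iter n F p' -> p = p'.
  elim: n p p' => [//|n IH] p p'; rewrite !iterS => /(congr1 Fi); rewrite !FK; exact: IH.
have {}hB p : B_check r0 theta0 beta0 p -> B_check r0 theta0 beta0 (F p).
  by move=> h; apply: hB; exists p.
have hBn n p : B_check r0 theta0 beta0 p -> B_check r0 theta0 beta0 (iter n F p).
  by move=> h; elim: n => [//|n IH]; rewrite iterS; exact: hB.
have Bnz p : B_check r0 theta0 beta0 p -> p.1 * p.2 != 0 by move=> [_ /sector_neq0].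
have Omn n p : B_check r0 theta0 beta0 (iter n F p) -> Omega p.
  by rewrite OmE => h; exists n.
have OmB p : Omega p -> exists N, forall n, (N <= n)%N -> B_check r0 theta0 beta0 (iter n F p).
  rewrite OmE => -[N _ /= h]; exists N => n hn.
  by rewrite -(subnK hn) iterD; exact: hBn.
have OmF p : Omega p -> Omega (F p).
  move=> /OmB [N hN]; apply: (Omn N); rewrite -iterSr; exact: hN.
have [rho [c [rho0 c0 hstep]]] := chart_step la1 l0 b0 bl hF.
have tend p : Omega p -> exists q, q.2 != 0 /\ chart_limit la F p q.
  move=> Op; have [N1 h1] := OmB p Op.
  have : nbhs (0 : C2 R) [set q | maxnorm q < rho].
    by apply/nbhsC2P; exists rho => // q; rewrite subr0.
  move=> /(cvg0 p Op) [N2 _ h2].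
  apply: (@orbit_has_chart_limit _ la F r0 theta0 beta0 rho c la1 c0 hstep p (maxn N1 N2)) => n.
  by rewrite geq_max => /andP[n1 n2']; split; [exact: h1|exact: h2].
have tend' p : exists q, Omega p -> q.2 != 0 /\ chart_limit la F p q.
  have [Op|] := pselect (Omega p); last by exists p.
  by have [q hq] := tend p Op; exists q.
have [Psi hPsi] := choice tend'.
have PsiE p q : Omega p -> chart_limit la F p q -> Psi p = q.
  by move=> Op hq; have [_ hP] := hPsi p Op; exact: limit_unique hP hq.
have loc := local_limit la1 r00 t0 tpi b0 b1 dF rho0 c0
  (fun p h1 h2 h3 => (hstep p h1 h2 h3).2) hB.
(* At late times the point is seen near its limit and lies in the region. *)
have late p (e : R) : Omega p -> 0 < e -> exists N, forall n, (N <= n)%N ->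
    maxnorm (chart la n (iter n F p) - Psi p) < e /\ B_check r0 theta0 beta0 (iter n F p).
  move=> Op e0; have [N1 h1] := OmB p Op; have e2 : 0 < e / 2 by lra.
  have [N2 h2] := (hPsi p Op).2 _ e2; exists (maxn N1 N2) => n.
  rewrite geq_max => /andP[n1 n2']; split; last exact: h1.
  by have := h2 n n2'; move: e0; clear; lra.
exists Psi; split.
- move=> p0 Op0; set q0 := Psi p0.
  have [d d0 hd] := loc q0 (hPsi p0 Op0).1.
  have [N' hN'] := late p0 d Op0 d0.
  have [N [NN' [Th [eta [_ dTh _ hTh]]]]] := hd N'.
  have [hc hBN] := hN' N NN'; have nz := Bnz _ hBN.
  have dit := @differentiable_iter R F N p0 dF.
  have dG : differentiable (fun p => chart la N (iter N F p)) p0.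
    exact: (@differentiable_comp _ _ _ _ (iter N F) (chart la N) p0 dit (differentiable_chart la N nz)).
  have [r1 r10 hr1] := @differentiable2_eps R _ _ dG (d - maxnorm (chart la N (iter N F p0) - q0)) ltac:(by rewrite subr_gt0).
  have dprod : differentiable (fun p => ((iter N F p).1 * (iter N F p).2, 0 : C R)) p0.
    apply: differentiable_prod; last exact: differentiable_cst2.
    exact: differentiableM (differentiable_fst dit) (differentiable_snd dit).
  have [r2 r20 hr2] := @differentiable2_eps R _ _ dprod
    (cabs ((iter N F p0).1 * (iter N F p0).2)) ltac:(by rewrite cabs_gt0).
  apply: (@differentiable2_local R (fun p => Th (chart la N (iter N F p))) Psi p0 (Num.min r1 r2)).
  + by rewrite lt_min r10.
  + move=> p; rewrite lt_min => /andP[/hr1 p1 /hr2 p2].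
    have nzp : (iter N F p).1 * (iter N F p).2 != 0.
      apply: contraTneq p2 => E; rewrite -leNgt E.
      apply: le_trans (cabs_fst _); by rewrite /= sub0r cabsN.
    have inb : maxnorm (chart la N (iter N F p) - q0) < d.
      apply: le_lt_trans (maxnorm_tri _ (chart la N (iter N F p0)) _) _; move: p1; clear; lra.
    have [_ _ hBp hT] := hTh _ inb; rewrite chartK// in hBp hT.
    by apply/esym/PsiE; [exact: (Omn N)|exact: hT].
  + apply: (@differentiable_comp _ _ _ _ (fun p => chart la N (iter N F p)) Th p0 dG).
    exact: dTh.
- move=> p Op; have [h1 h2] := hPsi p Op; split => //.
  by apply: PsiE; [exact: OmF|exact: chart_limit_shift].
- move=> p p' Op Op' E; set q0 := Psi p.
  have [d d0 hd] := loc q0 (hPsi p Op).1.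
  have d32 : 0 < d / 32 by rewrite divr_gt0.
  have [N1 hN1] := late p _ Op d32; have [N2 hN2] := late p' _ Op' d32.
  have [N [NN' [Th [eta [he dTh hTe hTh]]]]] := hd (maxn N1 N2).
  move: NN'; rewrite geq_max => /andP[n1 n2'].
  have [c1 B1] := hN1 N n1; have [c2 B2] := hN2 N n2'; rewrite -E -/q0 in c2; rewrite -/q0 in c1.
  have ThE z : Omega z -> B_check r0 theta0 beta0 (iter N F z) ->
      maxnorm (chart la N (iter N F z) - q0) < d / 32 -> Th (chart la N (iter N F z)) = Psi z.
    move=> Oz Bz cz; have [|_ _ _ hT] := hTh (chart la N (iter N F z)); first by move: cz d0; clear; lra.
    by apply/esym/PsiE => //; apply: hT; rewrite chartK//; exact: Bnz.
  have := near_id_inj d0 he dTh hTe c1 c2; rewrite !ThE// => /(_ E) Ec.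
  apply: (itI N).
  by rewrite -[LHS](chartK N la1 (Bnz _ B1)) -[RHS](chartK N la1 (Bnz _ B2)) Ec.
- move=> q0 q02; have [d d0 hd] := loc q0 q02.
  have [N [_ [Th [eta [he dTh hTe hTh]]]]] := hd 0%N.
  have [S hS] := near_id_inverse d0 he dTh hTe.
  exists (d / 128); first by rewrite divr_gt0.
  exists (fun q => iter N Fi (unchart la N (S q))); split.
    have [|dS Sin _] := hS q0; first by rewrite subrr maxnorm_0 divr_gt0.
    have [|s2 s1 _ _] := hTh (S q0); first by move: Sin d0; clear; lra.
    apply: (@differentiable_comp _ _ _ _ (fun q => unchart la N (S q)) (iter N Fi)).
      exact: (@differentiable_comp _ _ _ _ S (unchart la N) q0 dS (differentiable_unchart la1 s2 s1)).
    exact: differentiable_iter.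
  move=> q hq; have [dS Sin ThS] := hS q hq.
  have [|s2 s1 hBS hT] := hTh (S q); first by move: Sin d0; clear; lra.
  have OG : Omega (iter N Fi (unchart la N (S q))) by apply: (Omn N); rewrite itK.
  by split => //; rewrite -[RHS]ThS; apply: PsiE => //; apply: hT; rewrite itK.
Qed.

End Assembly.

Theorem proposition4p8 (R : realType) (la : C R) (l : nat) (theta0 beta0 : R)
    (F : C2 R -> C2 R) (Omega : set (C2 R))
    (la_circle : `|la| = 1)
    (la_brjuno : brjuno la)
    (l_ge4 : (4 <= l)%N)
    (theta0_gt0 : 0 < theta0) (theta0_lt : theta0 < pi / 2)
    (beta0_gt0 : 0 < beta0) (beta0_lt : beta0 < 1 / 2)
    (beta0_l : 4 <= beta0 * (l.+1)%:R)
    (F_aut : automorphism F)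
    (F_expansion :
       (fun p => F p - F_N la p) =O_ (0 : C2 R) (fun p => `|p| ^+ l))
    (Omega_attracted : attracted_component F theta0 beta0 Omega) :
  exists2 Psi : C2 R -> C2 R,
    biholomorphic_map Omega (@C_x_Cstar R) Psi &
    forall p, Omega p -> Psi (F p) = translation (Psi p).
Proof.
case: Omega_attracted => _ _ _ _ cvg0 [r0 r00 [hB _ OmE]].
have l0 : (0 < l)%N by apply: leq_trans l_ge4.
have [Psi [dPsi PsiF Psi_inj Psi_loc]] := fatou_coordinates la_circle l0 theta0_gt0
  theta0_lt beta0_gt0 beta0_lt beta0_l F_aut F_expansion cvg0
  (ex_intro2 _ _ r0 r00 (conj hB OmE)).
have la1 : cabs la = 1 by rewrite /cabs la_circle.
have la0 := cabs1_neq0 la1.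
have [al laE] := unit_angle la1.
(* For s = 1 and s = -1 these are mutually inverse. *)
pose tw (s : C R) (q : C2 R) : C2 R := (q.1, q.2 * cis al (s * q.1)).
have dtw s q : differentiable (tw s) q.
  have d1 := differentiable_fst (differentiable_id2 q).
  have d2 := differentiable_snd (differentiable_id2 q).
  apply: differentiable_prod; first exact: d1.
  apply: (@differentiableM _ _ (fun q : C2 R => q.2) (fun q : C2 R => cis al (s * q.1)) q d2).
  apply: (@differentiable_comp _ _ _ _ (fun q : C2 R => s * q.1) (cis al)).
    exact: (@differentiableM _ _ (fun=> s) (fun q : C2 R => q.1) _ (differentiable_cst2 _ _) d1).
  exact: differentiable_cis.
have twK q : tw 1 (tw (-1) q) = q.
  apply: c2_ext => //=; rewrite mulN1r mul1r cisN -mulrA mulVf ?mulr1//; exact: cis_neq0.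
have twK' q : tw (-1) (tw 1 q) = q.
  apply: c2_ext => //=; rewrite mulN1r mul1r cisN -mulrA mulfV ?mulr1//; exact: cis_neq0.
exists (fun p => tw 1 (Psi p)).
  apply: biholomorphic_of_local_inverse.
  - by move=> p Op; apply: (@differentiable_comp _ _ _ _ Psi (tw 1) p (dPsi p Op) (dtw _ _)).
  - move=> p Op; rewrite /C_x_Cstar /=; apply: mulf_neq0; last exact: cis_neq0.
    by have [] := PsiF p Op.
  - move=> p p' Op Op' /(congr1 (tw (-1))); rewrite !twK'; exact: Psi_inj.
  - move=> q0 q02.
    have [|r r0' [G [dG hG]]] := Psi_loc (tw (-1) q0).
      by apply: mulf_neq0; [exact: q02|exact: cis_neq0].
    have [r1 r10 hr1] := differentiable2_eps (dtw (-1) q0) r0'.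
    exists r1 => //; exists (fun q => G (tw (-1) q)); split.
      exact: (@differentiable_comp _ _ _ _ (tw (-1)) G q0 (dtw _ _) dG).
    by move=> q /hr1 /hG [OG PG]; rewrite PG twK.
move=> p Op; have [_ ->] := PsiF p Op; rewrite /translation /tw /=; congr pair.
by rewrite !mul1r cisD cis1 -laE; field; exact: la0.
Qed.
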